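(* Let $W=H_3$ and let $\tau_1,\dots,\tau_{10}$ be its ten irreducible representations, numbered as in the context. For each $i$ let $\kappa_-(\tau_i)$ and $\kappa_+(\tau_i)$ denote the negative, respectively positive, singular value of smallest absolute value for $\mathcal{P}_{\tau_i}$ (when one exists). These values are as follows, and in each case there are singular polynomials in $\mathcal{P}_{\tau_i}$ for that value of the isotype indicated: - $\tau_1$: there is no positive singular value; $\kappa_-=-\frac1{10}$ (isotype $\tau_3$). - $\tau_2$: there is no negative singular value; $\kappa_+=\frac1{10}$ (isotype $\tau_4$). - $\tau_3$: $\kappa_-=-\frac1{10}$ (isotype $\tau_4$), $\kappa_+=\frac1{10}$ (isotype $\tau_1$). - $\tau_4$: $\kappa_-=-\frac1{10}$ (isotype $\tau_2$), $\kappa_+=\frac1{10}$ (isotype $\tau_3$). - $\tau_5$: $\kappa_-=-\frac15$ (isotype $\tau_7$), $\kappa_+=\frac3{10}$ (isotype $\tau_1$). - $\tau_6$: $\kappa_-=-\frac3{10}$ (isotype $\tau_2$), $\kappa_+=\frac15$ (isotype $\tau_8$). - $\tau_7$: $\kappa_-=-\frac15$ (isotype $\tau_2$), $\kappa_+=\frac15$ (isotype $\tau_5$). - $\tau_8$: $\kappa_-=-\frac15$ (isotype $\tau_6$), $\kappa_+=\frac15$ (isotype $\tau_1$). - $\tau_9$: $\kappa_-=-\frac16$ (isotype $\tau_{10}$), $\kappa_+=\frac16$ (isotype $\tau_1$). - $\tau_{10}$: $\kappa_-=-\frac16$ (isotype $\tau_2$), $\kappa_+=\frac16$ (isotype $\tau_9$).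 Consequently, the set of $\kappa\in\mathbb{R}$ for which the Gaussian form $\langle\cdot,\cdot\rangle_\kappa$ on $\mathcal{P}_{\tau_i}$ is positive definite is the open interval $(\kappa_-(\tau_i),\kappa_+(\tau_i))$, where $\kappa_+(\tau_1)$ is read as $+\infty$ and $\kappa_-(\tau_2)$ as $-\infty$. In particular, for the $3$-dimensional representations $\tau_5$ and $\tau_6$ this interval is not symmetric about $0$.
   Context: Group. Let $\phi=\frac12(1+\sqrt5)$. The root system $R\subset\mathbb{R}^3$ consists of the $30$ vectors obtained as cyclic permutations of the coordinates of $(\pm2,0,0)$ and of $(\pm\phi,\pm(\phi-1),\pm1)$ (independent signs). For $v\in R$, $\sigma_v$ is the reflection $x\sigma_v=x-2\frac{\langle x,v\rangle}{\langle v,v\rangle}v$ (row vectors, group acting on the right, $\langle\cdot,\cdot\rangle$ the standard inner product). $H_3$ is the group generated by the $\sigma_v$, $v\in R$; it has order $120$, contains $-I$, and has a single conjugacy class of reflections. $R_+$ is the set of the $15$ roots having positive inner product with $(3,2\phi,1)$. Irreducible representations of $H_3$ (all realizable as orthogonal representations on real vector spaces; $\chi_i$ is the character of $\tau_i$, $V_i$ the space of $\tau_i$, $\sigma$ any reflection): - $\tau_1$ is the trivial representation and $\tau_2=\det$ is the sign representation. - $\tau_3$ is the reflection representation (the defining representation on $\mathbb{R}^3$) and $\tau_4=\det\otimes\tau_3$. - $\tau_5$ is the other $3$-dimensional irreducible representation with $\chi_5(\sigma)=1$ (not isomorphic to $\tau_3$; its character is obtained from $\chi_3$ by $\sqrt5\mapsto-\sqrt5$),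 and $\tau_6=\det\otimes\tau_5$. - $\tau_7$ is the $4$-dimensional irreducible representation with $\chi_7(-I)=4$, and $\tau_8=\det\otimes\tau_7$ is the $4$-dimensional irreducible representation with $\chi_8(-I)=-4$. - $\tau_9$ is the $5$-dimensional irreducible representation with $\chi_9(-I)=5$, $\chi_9(\sigma)=1$, and $\tau_{10}=\det\otimes\tau_9$. Dunkl operators. Let $\mathcal{P}$ be the space of real polynomials in $x=(x_1,x_2,x_3)$. For an irreducible orthogonal representation $\tau$ of $W=H_3$ on a finite-dimensional real vector space $V$, let $\mathcal{P}_\tau=\mathcal{P}\otimes V$, on which $W$ acts by the linear extension of $w(p(x)\otimes u)=p(xw)\otimes\tau(w)u$. For a real parameter $\kappa$ the Dunkl operators $\mathcal{D}_i$ ($1\le i\le3$) on $\mathcal{P}_\tau$ are the linear extensions of $$\mathcal{D}_i(p(x)\otimes u)=\frac{\partial p(x)}{\partial x_i}\otimes u+\kappa\sum_{v\in R_+}\frac{p(x)-p(x\sigma_v)}{\langle x,v\rangle}\,v_i\otimes\tau(\sigma_v)u .$$ They commute with each other. A number $\kappa_0\in\mathbb{Q}$ is a singular value for $\mathcal{P}_\tau$ if, for $\kappa=\kappa_0$, there is a nonconstant (as a polynomial in $x$) $p\in\mathcal{P}_\tau$ with $\mathcal{D}_ip=0$ for all $i$; such a $p$ is called a singular polynomial for $\kappa_0$. A polynomial $p\in\mathcal{P}_\tau$ is of isotype $\rho$ ($\rho$ an irreducible representation of $W$) if $\mathrm{span}\{wp:w\in W\}$ is a $W$-submodule isomorphic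 to $\rho$. Gaussian form. For $\kappa\in\mathbb{R}$, $\langle\cdot,\cdot\rangle_\kappa$ is the symmetric bilinear form on $\mathcal{P}_\tau$ satisfying $\langle wf,wg\rangle_\kappa=\langle f,g\rangle_\kappa$ and $\langle\mathcal{D}_if,g\rangle_\kappa=\langle f,(x_i-\mathcal{D}_i)g\rangle_\kappa$ for all $f,g\in\mathcal{P}_\tau$, $w\in W$, $1\le i\le3$, normalized so that on constants $1\otimes V$ it equals a fixed $W$-invariant (positive definite) inner product on $V$. *)

(* Defs.v *)
From HB Require Import structures.
From mathcomp Require Import all_boot all_order all_algebra all_fingroup.
From mathcomp Require Import mxrepresentation ring.
From mathcomp Require Import boolp reals.
From mathcomp Require Import mpoly.

Set Implicit Arguments.
Unset Strict Implicit.
Unset Printing Implicit Defensive.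

Import Order.TTheory GRing.Theory Num.Theory.
Local Open Scope ring_scope.

Section Roots.
Variable R : realType.
Implicit Types x v : 'rV[R]_3.

Definition phi : R := (1 + Num.sqrt 5) / 2.

Lemma phi_sqr : phi ^+ 2 = phi + 1.
Proof.
have h5 : (Num.sqrt 5 : R) ^+ 2 = 5 by rewrite sqr_sqrtr.
rewrite /phi; transitivity ((1 + 2 * Num.sqrt 5 + (Num.sqrt 5 : R) ^+ 2) / 4).
  by field.
by rewrite h5; field.
Qed.

Definition vec3 (a b c : R) : 'rV[R]_3 := \row_(i < 3) [:: a; b; c]`_i.

Definition cyclic3 (a b c : R) : seq 'rV[R]_3 :=
  [:: vec3 a b c; vec3 c a b; vec3 b c a].

Definition signs : seq R := [:: 1; -1].

Definition H3_roots : seq 'rV[R]_3 :=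
  flatten [seq cyclic3 (s * 2) 0 0 | s <- signs] ++
  flatten (flatten [seq flatten [seq [seq
    cyclic3 (s * phi) (t * (phi - 1)) u | u <- signs] | t <- signs]
    | s <- signs]).

Definition dot x v : R := \sum_(i < 3) x 0 i * v 0 i.

Definition positive_roots : seq 'rV[R]_3 :=
  [seq v <- H3_roots | 0 < dot v (vec3 3 (2 * phi) 1)].

(* The matrix of the reflection, acting on row vectors from the right;
   see [reflE]. *)
Definition refl v : 'M[R]_3 := 1 - (2 / dot v v) *: (v^T *m v).

Lemma mul_trmx_dot x v : x *m v^T *m v = dot x v *: v.
Proof.
rewrite [x *m v^T]mx11_scalar mul_scalar_mx mxE; congr (_ *: _).
by apply: eq_bigr => i _; rewrite mxE.
Qed.

Lemma reflE x v : x *m refl v = x - (2 * dot x v / dot v v) *: v.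
Proof.
rewrite /refl mulmxBr mulmx1 -scalemxAr mulmxA mul_trmx_dot scalerA.
by rewrite mulrAC.
Qed.

End Roots.

(** That reflections permute the roots is checked by computing in Z[phi], whose
    elements a + b phi are coded as pairs of integers. *)
Module ZPhi.

Definition t := (int * int)%type.
Definition add (x y : t) : t := (x.1 + y.1, x.2 + y.2).
Definition opp (x : t) : t := (- x.1, - x.2).
Definition mul (x y : t) : t :=
  (x.1 * y.1 + x.2 * y.2, x.1 * y.2 + x.2 * y.1 + x.2 * y.2).
Definition v3 := (t * t * t)%type.
Definition dot (x y : v3) : t :=
  add (add (mul x.1.1 y.1.1) (mul x.1.2 y.1.2)) (mul x.2 y.2).
Definition scale (a : t) (x : v3) : v3 :=
  (mul a x.1.1, mul a x.1.2, mul a x.2).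
Definition sub (x y : v3) : v3 :=
  (add x.1.1 (opp y.1.1), add x.1.2 (opp y.1.2), add x.2 (opp y.2)).
Definition cyclic3 (a b c : t) : seq v3 := [:: (a, b, c); (c, a, b); (b, c, a)].
Definition signs : seq t := [:: (1, 0); (-1, 0)].
Definition roots : seq v3 :=
  flatten [seq cyclic3 (mul s (2 : int, 0 : int)) (0, 0) (0, 0) | s <- signs] ++
  flatten (flatten [seq flatten [seq [seq
    cyclic3 (mul s (0 : int, 1 : int)) (mul r (-1 : int, 1 : int)) u
    | u <- signs] | r <- signs] | s <- signs]).

Definition two : t := (2, 0).

Lemma roots_norm : all (fun v => dot v v == (4, 0)) roots.
Proof. by vm_compute. Qed.

Lemma roots_refl :
  all (fun v => all (fun x => has (fun y =>
    sub (scale two x) (scale (dot x v) v) == scale two y) roots) roots) roots.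
Proof. by vm_compute. Qed.

Section Eval.
Variable R : realType.
Definition ev (x : t) : R := x.1%:~R + x.2%:~R * phi R.
Definition evv (x : v3) : 'rV[R]_3 := vec3 (ev x.1.1) (ev x.1.2) (ev x.2).

Lemma ev_add x y : ev (add x y) = ev x + ev y.
Proof. by rewrite /ev !rmorphD /=; ring. Qed.
Lemma ev_opp x : ev (opp x) = - ev x.
Proof. by rewrite /ev !rmorphN /=; ring. Qed.
Lemma ev_mul x y : ev (mul x y) = ev x * ev y.
Proof.
rewrite /ev /= !rmorphD !rmorphM /=.
have h := phi_sqr R; rewrite expr2 in h.
transitivity (x.1%:~R * y.1%:~R + (x.1%:~R * y.2%:~R + x.2%:~R * y.1%:~R) * phi R
  + x.2%:~R * y.2%:~R * (phi R * phi R)); last by ring.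
by rewrite h; ring.
Qed.

Lemma ev_dot x y : ev (dot x y) = Defs.dot (evv x) (evv y).
Proof.
rewrite /dot /Defs.dot !big_ord_recl big_ord0 !mxE /= !ev_add !ev_mul; ring.
Qed.
Lemma evv_scale a x : evv (scale a x) = ev a *: evv x.
Proof.
by apply/rowP => i; rewrite !mxE; case: i => [[|[|[|//]]] ?] /=; rewrite ev_mul.
Qed.
Lemma evv_sub x y : evv (sub x y) = evv x - evv y.
Proof.
by apply/rowP => i; rewrite !mxE; case: i => [[|[|[|//]]] ?] /=;
  rewrite ev_add ev_opp.
Qed.

Lemma ev_roots : [seq evv x | x <- roots] = H3_roots R.
Proof.
have e0 : ev (0, 0) = 0 by rewrite /ev /=; ring.
have e1 : ev (1, 0) = 1 by rewrite /ev /=; ring.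
have eN1 : ev (-1, 0) = -1 by rewrite /ev /= rmorphN1; ring.
have e2 : ev (2 : int, 0 : int) = 2 by rewrite /ev /=; ring.
have ep : ev (0 : int, 1 : int) = phi R by rewrite /ev /=; ring.
have eq : ev (-1 : int, 1 : int) = phi R - 1 by rewrite /ev /= rmorphN1; ring.
rewrite /roots /H3_roots /signs /Defs.signs /cyclic3 /Defs.cyclic3.
cbn [map flatten foldr cat]; rewrite /evv.
by cbn [fst snd]; rewrite !ev_mul !e0 !e1 !eN1 !e2 !ep !eq.
Qed.

End Eval.
End ZPhi.

Section RootLemmas.
Variable R : realType.
Implicit Types x v : 'rV[R]_3.

Lemma root_norm v : v \in H3_roots R -> dot v v = 4.
Proof.
rewrite -ZPhi.ev_roots => /mapP[w wR ->].
rewrite -ZPhi.ev_dot (eqP (allP ZPhi.roots_norm w wR)) /ZPhi.ev /=.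
by ring.
Qed.

Lemma root_refl v x : v \in H3_roots R -> x \in H3_roots R -> x *m refl v \in H3_roots R.
Proof.
move=> vR xR; rewrite reflE (root_norm vR).
move: vR xR; rewrite -ZPhi.ev_roots => /mapP[w wR ->] /mapP[y yR ->].
have /hasP[z zR /eqP hz] := allP (allP ZPhi.roots_refl w wR) y yR.
have := congr1 (@ZPhi.evv R) hz.
rewrite ZPhi.evv_sub !ZPhi.evv_scale ZPhi.ev_dot.
have -> : ZPhi.ev R ZPhi.two = 2 by rewrite /ZPhi.ev /=; ring.
set d := dot _ _ => e.
suff -> : ZPhi.evv R y - (2 * d / 4) *: ZPhi.evv R w = ZPhi.evv R z.
  exact: map_f.
have n2 : (2 : R) != 0 by rewrite pnatr_eq0.
apply: (scalerI n2); rewrite -e scalerBr scalerA; congr (_ - _ *: _).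
by field.
Qed.

Lemma refl_invol v : v \in H3_roots R -> refl v * refl v = 1.
Proof.
move=> /root_norm h; apply/row_matrixP => i; rewrite !rowE mulmxA !reflE.
have -> : delta_mx 0 i *m 1 = delta_mx 0 i :> 'rV[R]_3 by rewrite mulmx1.
set x := delta_mx _ _; set y := x - _.
have -> : dot y v = - dot x v.
  have dotB a b c : dot (a - b *: c) v = dot a v - b * dot c v.
    rewrite /dot mulr_sumr -sumrB; apply: eq_bigr => j _.
    by rewrite !mxE; ring.
  by rewrite /y dotB h; field.
by rewrite mulrN mulNr scaleNr opprK /y subrK.
Qed.

Lemma root_2e (i : 'I_3) : 2 *: delta_mx 0 i \in H3_roots R.
Proof.
have -> : 2 *: delta_mx 0 i =
    nth 0 (cyclic3 (1 * 2) 0 0) i :> 'rV[R]_3.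
  apply/rowP => j; case: i => [[|[|[|//]]] ?]; case: j => [[|[|[|//]]] ?];
  by rewrite !mxE -!val_eqE /= ?mulr1 ?mulr0 ?mul1r.
rewrite /H3_roots mem_cat; apply/orP; left; apply/flattenP.
by exists (cyclic3 (1 * 2) 0 0); [rewrite mem_head | apply/mem_nth/ltn_ord].
Qed.

End RootLemmas.

Section Group.
Variable R : realType.

(* Reflections are involutions, so the group they generate consists of the
   finite products of reflections. *)
Definition in_H3 : pred 'M[R]_3 := fun w =>
  `[< exists2 s : seq 'rV[R]_3, {subset s <= H3_roots R} &
        w = \prod_(v <- s) refl v >].

Record H3 := MkH3 { H3_mx :> 'M[R]_3; H3_mxP : in_H3 H3_mx }.

HB.instance Definition _ := [isSub for H3_mx].
HB.instance Definition _ := [Choice of H3 by <:].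

Lemma in_H3_1 : in_H3 1.
Proof. by apply/asboolP; exists [::]; rewrite ?big_nil. Qed.

Lemma in_H3_mul w1 w2 : in_H3 w1 -> in_H3 w2 -> in_H3 (w1 * w2).
Proof.
move=> /asboolP[s1 h1 ->] /asboolP[s2 h2 ->]; apply/asboolP.
exists (s1 ++ s2); last by rewrite big_cat.
by move=> v; rewrite mem_cat => /orP[/h1|/h2].
Qed.

Lemma in_H3_refl v : v \in H3_roots R -> in_H3 (refl v).
Proof.
move=> vR; apply/asboolP; exists [:: v]; last by rewrite big_seq1.
by move=> u; rewrite inE => /eqP->.
Qed.

Lemma in_H3_inv w : in_H3 w -> exists2 w', in_H3 w' & w' * w = 1.
Proof.
move=> /asboolP[s h ->]; exists (\prod_(v <- rev s) refl v).
  by apply/asboolP; exists (rev s) => // v; rewrite mem_rev => /h.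
elim: s h => [|v s IH] h; first by rewrite big_nil mulr1.
rewrite rev_cons -cats1 big_cat big_seq1 big_cons /= -mulrA.
rewrite [refl v * (_ * _)]mulrA refl_invol; last by rewrite h ?mem_head.
by rewrite mul1r IH // => u us; rewrite h // inE us orbT.
Qed.

Lemma in_H3_invmx w : in_H3 w -> in_H3 (invmx w) /\ invmx w * w = 1.
Proof.
move=> /in_H3_inv[w' hw' e].
have /mulmx1_unit[u' u] : w' *m w = 1%:M by [].
suff -> : invmx w = w' by [].
by rewrite -[LHS]mul1mx -(e : w' *m w = 1%:M) -mulmxA mulmxV // mulmx1.
Qed.

Lemma in_H3_root w x : in_H3 w -> x \in H3_roots R -> x *m w \in H3_roots R.
Proof.
move=> /asboolP[s h ->]; elim: s h x => [|v s IH] h x xR.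
  by rewrite big_nil mulmx1.
rewrite big_cons mulmxA IH // => [u us|]; first by rewrite h // inE us orbT.
by rewrite root_refl // h ?mem_head.
Qed.

Lemma in_H3_N1 : in_H3 (-1).
Proof.
pose r (i : 'I_3) := 2 *: delta_mx 0 i : 'rV[R]_3.
suff -> : -1 = refl (r 0) * refl (r 1) * refl (r 2%:R).
  by rewrite !in_H3_mul ?in_H3_refl ?root_2e.
have rE i (x : 'rV[R]_3) : x *m refl (r i) = x - (2 * x 0 i) *: delta_mx 0 i.
  rewrite reflE root_norm ?root_2e // /r scalerA; congr (_ - _ *: _).
  rewrite /dot (bigD1 i) //= !mxE !eqxx big1 => [|j /negPf ji].
    by rewrite /=; field.
  by rewrite !mxE ji andbF !mulr0.
apply/row_matrixP => i; rewrite !rowE !mulmxA !rE.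
by apply/rowP => j; case: i => [[|[|[|//]]] ?]; case: j => [[|[|[|//]]] ?];
  rewrite !mxE big_ord_recl !big_ord_recl big_ord0 !mxE -!val_eqE /=; ring.
Qed.

(* H3 is finite since it acts faithfully on the roots. *)
Definition H3_code (w : H3) : {ffun seq_sub (H3_roots R) -> seq_sub (H3_roots R)} :=
  [ffun x => SeqSub (in_H3_root (H3_mxP w) (ssvalP x))].

Definition H3_decode (f : {ffun seq_sub (H3_roots R) -> seq_sub (H3_roots R)}) :
    option H3 :=
  insub (\matrix_(i < 3) (2^-1 *: ssval (f (SeqSub (root_2e R i))))).

Lemma H3_codeK : pcancel H3_code H3_decode.
Proof.
move=> w; rewrite /H3_decode.
set A := \matrix_i _; suff -> : A = \val w by rewrite valK.
apply/row_matrixP => i; rewrite rowK ffunE /= -scalemxAl scalerA mulVf.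
  by rewrite scale1r -rowE.
by rewrite pnatr_eq0.
Qed.

HB.instance Definition _ : isCountable H3 := PCanIsCountable H3_codeK.
HB.instance Definition _ : isFinite H3 := PCanIsFinite H3_codeK.

Definition H3_one : H3 := MkH3 in_H3_1.
Definition H3_mul (w1 w2 : H3) : H3 := MkH3 (in_H3_mul (H3_mxP w1) (H3_mxP w2)).
Definition H3_inv (w : H3) : H3 := MkH3 (in_H3_invmx (H3_mxP w)).1.

Lemma H3_mulA : associative H3_mul.
Proof. by move=> a b c; apply/val_inj; rewrite /= mulrA. Qed.
Lemma H3_mul1 : left_id H3_one H3_mul.
Proof. by move=> a; apply/val_inj; rewrite /= mul1r. Qed.
Lemma H3_mulV : left_inverse H3_one H3_inv H3_mul.
Proof. by move=> a; apply/val_inj; exact: (in_H3_invmx (H3_mxP a)).2. Qed.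

HB.instance Definition _ := Finite_isGroup.Build H3 H3_mulA H3_mul1 H3_mulV.

Definition minus_one : H3 := MkH3 in_H3_N1.

(* The reflection in v as an element of H3, with junk value 1 outside H3. *)
Definition sigma (v : 'rV[R]_3) : H3 := insubd (H3_one) (refl v).

Lemma sigmaE v : v \in H3_roots R -> sigma v = refl v :> 'M[R]_3.
Proof. by move=> vR; rewrite /sigma; apply/insubdK/in_H3_refl. Qed.

End Group.

Notation H3_repr R n := (mx_representation R [set: H3 R]%G n).

Section Representations.
Variable R : realType.

(* A representation acts on 'cV[R]_n by u |-> tau w *m u. *)
Definition orthogonal_repr n (tau : H3_repr R n) :=
  forall w : H3 R, (tau w)^T *m tau w = 1%:M.

Lemma trivial_repr_proof : mx_repr [set: H3 R] (fun=> 1%:M : 'M[R]_1).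
Proof. by split=> // w1 w2 _ _; rewrite mulmx1. Qed.
Definition trivial_repr : H3_repr R 1 := MxRepresentation trivial_repr_proof.

Lemma reflection_repr_proof : mx_repr [set: H3 R] (fun w : H3 R => w : 'M[R]_3).
Proof. by split. Qed.
Definition reflection_repr : H3_repr R 3 :=
  MxRepresentation reflection_repr_proof.

Lemma det_twist_proof n (tau : H3_repr R n) :
  mx_repr [set: H3 R] (fun w : H3 R => \det w *: tau w).
Proof.
split=> [|w1 w2 _ _]; first by rewrite repr_mx1 /= det1 scale1r.
rewrite /= repr_mxM ?inE // (det_mulmx (H3_mx w1) w2).
by rewrite -scalemxAl -scalemxAr scalerA.
Qed.
Definition det_twist n (tau : H3_repr R n) : H3_repr R n :=
  MxRepresentation (det_twist_proof tau).

Definition trace_on_reflections n (tau : H3_repr R n) (c : R) :=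
  forall v, v \in H3_roots R -> \tr (tau (sigma v)) = c.

End Representations.

Inductive label := T1 | T2 | T3 | T4 | T5 | T6 | T7 | T8 | T9 | T10.

Definition irrep_dim (i : label) : nat :=
  match i with
  | T1 | T2 => 1 | T3 | T4 | T5 | T6 => 3 | T7 | T8 => 4 | T9 | T10 => 5
  end.

(* [tau] lists the irreducible orthogonal representations, each one in an
   arbitrary orthonormal basis. *)
Definition irreps_of_H3 (R : realType) (tau : forall i, H3_repr R (irrep_dim i)) :=
  (forall i, orthogonal_repr (tau i) /\ mx_irreducible (tau i)) /\
  [/\ mx_rsim (tau T1) (trivial_repr R)
    & mx_rsim (tau T2) (det_twist (trivial_repr R))] /\
  [/\ mx_rsim (tau T3) (reflection_repr R)
    & mx_rsim (tau T4) (det_twist (tau T3))] /\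
  [/\ trace_on_reflections (tau T5) 1, ~ mx_rsim (tau T5) (tau T3)
    & mx_rsim (tau T6) (det_twist (tau T5))] /\
  [/\ \tr (tau T7 (minus_one R)) = 4
    & mx_rsim (tau T8) (det_twist (tau T7))] /\
  [/\ \tr (tau T9 (minus_one R)) = 5, trace_on_reflections (tau T9) 1
    & mx_rsim (tau T10) (det_twist (tau T9))].

Section Polynomials.
Variable R : realType.
Notation poly3 := {mpoly R[3]}.

Definition subst_mx (w : 'M[R]_3) (p : poly3) : poly3 :=
  p \mPo [tuple \sum_(k < 3) w k i *: 'X_k | i < 3].

Definition linear_form (v : 'rV[R]_3) : poly3 := \sum_(i < 3) v 0 i *: 'X_i.

Lemma divided_difference_ex v p :
  exists q, linear_form v * q == p - subst_mx (refl v) p.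
Proof.
have s1 : subst_mx (refl v) 1 = 1 by rewrite /subst_mx rmorph1.
have sM a b : subst_mx (refl v) (a * b) =
    subst_mx (refl v) a * subst_mx (refl v) b by rewrite /subst_mx rmorphM.
have sX i : exists q, linear_form v * q = 'X_i - subst_mx (refl v) 'X_i.
  exists (2 / dot v v * v 0 i)%:MP.
  rewrite /subst_mx comp_mpolyXU -tnth_nth tnth_mktuple.
  have -> : \sum_(k < 3) refl v k i *: 'X_k =
      'X_i - (2 / dot v v * v 0 i) *: linear_form v :> poly3.
    transitivity (\sum_(k < 3) ((k == i)%:R *: 'X_k -
        (2 / dot v v * v 0 i * v 0 k) *: 'X_k) : poly3).
      apply: eq_bigr => k _; rewrite !mxE big_ord1 !mxE scalerBl.
      by congr (_ - _ *: _); ring.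
    rewrite sumrB; congr (_ - _).
      rewrite (bigD1 i) //= eqxx scale1r big1 ?addr0 // => k /negPf->.
      by rewrite scale0r.
    by rewrite scaler_sumr; apply: eq_bigr => k _; rewrite scalerA.
  by rewrite opprB addrC subrK mulrC mul_mpolyC.
have sP a b : (exists q, linear_form v * q = a - subst_mx (refl v) a) ->
    (exists q, linear_form v * q = b - subst_mx (refl v) b) ->
    exists q, linear_form v * q = a * b - subst_mx (refl v) (a * b).
  move=> [q hq] [r hr]; exists (q * b + subst_mx (refl v) a * r).
  by rewrite mulrDr mulrA hq mulrCA hr sM; ring.
suff [q hq] : exists q, linear_form v * q = p - subst_mx (refl v) p.
  by exists q; rewrite hq.
elim/mpolyind: p => [|c m p _ _ [q hq]].
  by exists 0; rewrite /subst_mx raddf0 mulr0 subr0.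
have [r hr] : exists r, linear_form v * r = 'X_[m] - subst_mx (refl v) 'X_[m].
  rewrite mpolyXE_id; apply: (big_ind (fun a =>
    exists q, linear_form v * q = a - subst_mx (refl v) a)) => //.
    by exists 0; rewrite s1 mulr0 subrr.
  move=> i _; elim: (m i) => [|k IH]; first by exists 0; rewrite s1 mulr0 subrr.
  by rewrite exprS; exact: sP.
exists (c *: r + q); rewrite mulrDr hq -scalerAr hr.
by rewrite /subst_mx comp_mpolyD comp_mpolyZ scalerBr opprD addrACA.
Qed.

(* (p(x) - p(x sigma_v)) / <x, v> *)
Definition divided_difference v p : poly3 := xchoose (divided_difference_ex v p).

Lemma divided_differenceE v p :
  linear_form v * divided_difference v p = p - subst_mx (refl v) p.
Proof. exact/eqP/(xchooseP (divided_difference_ex v p)). Qed.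

(* The space P (x) R^n, as n-tuples of polynomials: p (x) u has components
   u_j p. *)
Definition vpoly n := {ffun 'I_n -> poly3}.

Definition pure_tensor n (p : poly3) (u : 'cV[R]_n) : vpoly n :=
  [ffun j => u j 0 *: p].

Definition vact n (tau : H3_repr R n) (w : H3 R) (f : vpoly n) : vpoly n :=
  [ffun j => \sum_(k < n) tau w j k *: subst_mx w (f k)].

Lemma vact_pure n (tau : H3_repr R n) w p u :
  vact tau w (pure_tensor p u) = pure_tensor (subst_mx w p) (tau w *m u).
Proof.
apply/ffunP => j; rewrite !ffunE mxE scaler_suml; apply: eq_bigr => k _.
by rewrite ffunE /subst_mx comp_mpolyZ scalerA.
Qed.

Definition mulX n (i : 'I_3) (f : vpoly n) : vpoly n := [ffun j => 'X_i * f j].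

Definition dunkl n (tau : H3_repr R n) (kappa : R) (i : 'I_3) (f : vpoly n) :
    vpoly n :=
  [ffun j => (f j)^`M(i) + kappa *: \sum_(v <- positive_roots R) v 0 i *:
     \sum_(k < n) tau (sigma v) j k *: divided_difference v (f k)].

Definition constant_vpoly n (u : 'cV[R]_n) : vpoly n := pure_tensor 1 u.

Definition singular_poly n (tau : H3_repr R n) (kappa : R) (p : vpoly n) :=
  ~ (exists u, p = constant_vpoly u) /\ forall i, dunkl tau kappa i p = 0.

Definition singular_value n (tau : H3_repr R n) (kappa : rat) :=
  exists p, singular_poly tau (ratr kappa) p.

Definition smallest_negative_singular_value n (tau : H3_repr R n)
    (kappa : rat) :=
  [/\ singular_value tau kappa, kappa < 0
    & forall k, singular_value tau k -> k < 0 -> `|kappa| <= `|k| ].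

Definition smallest_positive_singular_value n (tau : H3_repr R n)
    (kappa : rat) :=
  [/\ singular_value tau kappa, 0 < kappa
    & forall k, singular_value tau k -> 0 < k -> `|kappa| <= `|k| ].

(* The span of {w p : w in H3} is isomorphic to rho as an H3-module: h is an
   isomorphism of 'cV[R]_m onto it. *)
Definition of_isotype n (tau : H3_repr R n) m (rho : H3_repr R m)
    (p : vpoly n) :=
  exists h : {linear 'cV[R]_m -> vpoly n},
    [/\ injective h,
        forall w u, h (rho w *m u) = vact tau w (h u)
      & forall q, (exists u, q = h u) <->
          (exists c : H3 R -> R, q = \sum_(w : H3 R) c w *: vact tau w p)].

Definition singular_of_isotype n (tau : H3_repr R n) (kappa : rat)
    m (rho : H3_repr R m) :=
  exists p, singular_poly tau (ratr kappa) p /\ of_isotype tau rho p.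

(* Gram matrices of the invariant inner products on 'cV[R]_n *)
Definition invariant_inner_product n (tau : H3_repr R n) (G : 'M[R]_n) :=
  [/\ G^T = G, forall u : 'cV[R]_n, u != 0 -> 0 < (u^T *m G *m u) 0 0
    & forall w, (tau w)^T *m G *m tau w = G].

Definition is_gaussian_form n (tau : H3_repr R n) (G : 'M[R]_n) (kappa : R)
    (B : vpoly n -> vpoly n -> R) :=
  [/\ (forall f g, B f g = B g f) /\ (forall f, scalar (B f)),
      forall w f g, B (vact tau w f) (vact tau w g) = B f g,
      forall i f g,
        B (dunkl tau kappa i f) g = B f (mulX i g - dunkl tau kappa i g)
    & forall u u', B (constant_vpoly u) (constant_vpoly u') =
        (u^T *m G *m u') 0 0].

(* "The Gaussian form is positive definite": the form is the unique one with
   the above properties. *)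
Definition gaussian_posdef n (tau : H3_repr R n) (G : 'M[R]_n) (kappa : R) :=
  exists B, unique (is_gaussian_form tau G kappa) B /\
    forall f, f != 0 -> 0 < B f f.

End Polynomials.

(* The assertions about tau i: [neg] and [pos] give the extreme negative and
   positive singular value together with the isotype, if they exist. *)
Definition singular_row (R : realType) (tau : forall i, H3_repr R (irrep_dim i))
    (i : label) (neg pos : option (rat * label)) : Prop :=
  [/\ match neg with
      | Some (k, j) => smallest_negative_singular_value (tau i) k /\
                       singular_of_isotype (tau i) k (tau j)
      | None => ~ exists k, singular_value (tau i) k /\ k < 0
      end,
      match pos with
      | Some (k, j) => smallest_positive_singular_value (tau i) k /\
                       singular_of_isotype (tau i) k (tau j)
      | None => ~ exists k, singular_value (tau i) k /\ 0 < k
      end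
    & forall G, invariant_inner_product (tau i) G -> forall kappa : R,
        gaussian_posdef (tau i) G kappa <->
        (if neg is Some (k, _) then ratr k < kappa else True) /\
        (if pos is Some (k, _) then kappa < ratr k else True)].

(* Main.v *)
(** On a homogeneous p in P (x) V of degree d, the operator \sum_i x_i D_i is
    d + kappa (gamma(tau) - Omega), where Omega is the sum of the reflections of
    the group acting on P (x) V and gamma(tau) its scalar value on V. So it acts
    as lambda = d + kappa (gamma(tau) - gamma(rho)) on the isotypic component of
    rho in degree d. A singular polynomial forces some lambda to vanish.

    Let (p, q) be the contravariant form, for which x_i is adjoint to D_i. Then
    lambda (p, p) = \sum_i (D_i p, D_i p), so by induction on d the form is
    positive definite as long as every lambda is positive, and if it is positive
    definite in degree d - 1 and lambda = 0, then D_i p = 0 for all i. The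
    Gaussian form is (e^{Delta/2} f, e^{Delta/2} g) with Delta = \sum_i D_i^2.
    Conversely, lambda is an eigenvalue of \sum_i (x_i - D_i) D_i, and x_i - D_i
    is adjoint to D_i for the Gaussian form; so lambda is positive if this form
    is positive definite.

    Hence everything depends on which rho occur in degree d. As lambda is
    affine in kappa and equals d at kappa = 0, it is enough to know that
    lambda >= 0 at the two endpoints. For d >= 4 this holds for every rho, and for
    d <= 3 it holds for the constituents of (R^3)^{(x) d} (x) V. These, and
    the nonvanishing of the rho-component of x_1^d (x) V in the critical degree,
    are computed from the character table over Z[phi]. *)

From HB Require Import structures.
Require Import Defs.
From mathcomp Require Import all_boot all_order all_algebra all_fingroup.
From mathcomp Require Import mxrepresentation ring boolp functions reals ssrcomplements mpoly.
Set Implicit Arguments.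
Unset Strict Implicit.
Unset Printing Implicit Defensive.
Import Order.TTheory GRing.Theory Num.Theory.
Local Open Scope ring_scope.

(** * Sums over the roots *)

(** The [tau i] are real representations known only through a few traces and isomorphisms, so their
    characters must be recovered before the tables apply. Over the reals Schur's lemma only says
    that a commutant is a division algebra; a rank-one projection built from reflections in
    coordinate axes forces it to consist of scalars. The tables themselves are never assumed to be
    characters: a few identities checked over Z[phi] make them act as isotypic projections in any
    representation, and irrationality of sqrt 5 carries nonvanishing from Z[phi] to the reals.

    Tensor powers replace symmetric powers because their character is just a power of the trace of
    w. They can only add constituents, and the inequalities still hold for those. Degree 4 is where
    the bound by the extreme values of gamma starts to suffice: the worst case is [T5] at -1/5
    against [T2], where 4 - 20/5 = 0. A zero at an endpoint is harmless, as affinity makes the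
    values strictly positive before it. *)

Section RootSums.
Variable R : realType.
Implicit Types (v x : 'rV[R]_3) (w : H3 R).

(** Irrationality of sqrt 5: for positive [n] the exponent of 5 would be even on the left and odd on
    the right. *)
Lemma sqr_5sqr (m n : nat) : (m ^ 2 = 5 * n ^ 2)%N -> n = 0%N.
Proof.
case: n => // n e; have m0 : (0 < m)%N by case: m e.
have := congr1 (logn 5) e; rewrite lognM ?expn_gt0 // !lognX (@logn_prime 5 5) //=.
by move=> /(congr1 odd); rewrite oddD !oddM.
Qed.

(** If a + b phi = 0, then 2 a + b = - b sqrt 5, and squaring gives an equation between integers. *)
Lemma ev_eq0 (x : ZPhi.t) : ZPhi.ev R x = 0 -> x = (0, 0).
Proof.
case: x => a b; rewrite /ZPhi.ev /= => e.
have /eqP : (2 * a + b) ^+ 2 = 5 * b ^+ 2 :> int.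
  apply/(@intr_inj R); rewrite !(rmorphXn, rmorphM, rmorphD) /=.
  have -> : a%:~R = - (b%:~R * phi R) by apply/eqP; rewrite -addr_eq0 e.
  have -> : (2 * - (b%:~R * phi R) + b%:~R) ^+ 2 =
    b%:~R ^+ 2 * (4 * (phi R ^+ 2) - 4 * phi R + 1) :> R by ring.
  by rewrite phi_sqr; ring.
move=> /eqP /(congr1 absz); rewrite abszM !abszX => /sqr_5sqr/eqP.
rewrite absz_eq0 => /eqP b0; move: e; rewrite b0 mul0r addr0 => /eqP.
by rewrite intr_eq0 => /eqP->.
Qed.

Lemma evv_inj : injective (@ZPhi.evv R).
Proof.
have evB (a b : ZPhi.t) : ZPhi.ev R a = ZPhi.ev R b -> a = b.
  move=> e; have : ZPhi.ev R (ZPhi.add a (ZPhi.opp b)) = 0.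
    by rewrite ZPhi.ev_add ZPhi.ev_opp e subrr.
  by move/ev_eq0; case: a b {e} => [? ?] [? ?] [/eqP + /eqP];
    rewrite !subr_eq0 => /eqP-> /eqP->.
move=> [[a1 a2] a3] [[b1 b2] b3] /rowP e.
have := e 0; have := e 1; have := e 2%:R; rewrite !mxE /=.
by move=> /evB -> /evB -> /evB ->.
Qed.

Lemma uniq_roots : uniq (H3_roots R).
Proof.
by rewrite -ZPhi.ev_roots (map_inj_uniq evv_inj); vm_compute.
Qed.

Lemma dot_nv x v : dot (- v) x = - dot v x.
Proof. by rewrite /dot -sumrN; apply: eq_bigr => i _; rewrite mxE mulNr. Qed.

(** This makes exactly one of v and -v positive. *)
Lemma dot_generic v : v \in H3_roots R -> dot v (vec3 3 (2 * phi R) 1) != 0.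
Proof.
rewrite -ZPhi.ev_roots => /mapP[w wR ->].
have -> : vec3 3 (2 * phi R) 1 =
    ZPhi.evv R ((3 : int, 0 : int), (0 : int, 2 : int), (1 : int, 0 : int)).
  by congr vec3; rewrite /ZPhi.ev /=; ring.
rewrite -ZPhi.ev_dot; apply: contraTneq wR => /ev_eq0 e.
have /allP h : all (fun y : ZPhi.v3 => ZPhi.dot y
  ((3 : int, 0 : int), (0 : int, 2 : int), (1 : int, 0 : int)) != (0, 0))
  ZPhi.roots by vm_compute.
by apply/negP => /h; rewrite e.
Qed.

Lemma root_act v w : v \in H3_roots R -> v *m w \in H3_roots R.
Proof. by move=> vR; apply: in_H3_root => //; exact: H3_mxP. Qed.

Lemma root_opp v : v \in H3_roots R -> - v \in H3_roots R.
Proof.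
move=> vR; have := root_refl vR vR.
rewrite reflE (root_norm vR) -mulrA divff ?pnatr_eq0 // mulr1.
by rewrite scaler_nat mulr2n opprD addrA subrr sub0r.
Qed.

Lemma sum_roots_opp (Z : nmodType) (P : pred 'rV[R]_3) (F : 'rV[R]_3 -> Z) :
  \sum_(v <- H3_roots R | P v) F v = \sum_(v <- H3_roots R | P (- v)) F (- v).
Proof.
rewrite -[RHS](big_map -%R P F); apply: perm_big; apply: uniq_perm.
- exact: uniq_roots.
- by rewrite map_inj_uniq ?uniq_roots //; exact: oppr_inj.
move=> v; apply/idP/mapP => [vR|[x xR ->]]; last exact: root_opp.
by exists (- v); rewrite ?opprK // root_opp.
Qed.

Lemma sum_roots_act (Z : nmodType) w (F : 'rV[R]_3 -> Z) :
  \sum_(v <- H3_roots R) F (v *m w) = \sum_(v <- H3_roots R) F v.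
Proof.
have wK : cancel (fun v => v *m w) (fun v => v *m H3_mx (w^-1)%g).
  move=> v; rewrite -mulmxA -[_ *m H3_mx _]/(H3_mx (w * w^-1)%g) mulgV.
  exact: mulmx1.
have wVK : cancel (fun v => v *m H3_mx (w^-1)%g) (fun v => v *m w).
  move=> v; rewrite -mulmxA -[_ *m H3_mx _]/(H3_mx (w^-1 * w)%g) mulVg.
  exact: mulmx1.
rewrite -[LHS](big_map (fun v => v *m w) predT F); apply: perm_big.
apply: uniq_perm; rewrite ?map_inj_uniq ?uniq_roots //; first exact: can_inj wK.
move=> v; apply/mapP/idP => [[x xR ->]|vR]; first exact: root_act.
by exists (v *m H3_mx (w^-1)%g); rewrite ?root_act.
Qed.

(** The group does not preserve the positive roots. Passing to half the sum over all roots makes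
    reindexing by [sum_roots_act] possible. *)
Lemma sum_pos_roots (Z : lmodType R) (F : 'rV[R]_3 -> Z) :
  (forall v, F (- v) = F v) ->
  \sum_(v <- positive_roots R) F v = 2^-1 *: \sum_(v <- H3_roots R) F v.
Proof.
move=> FN; rewrite big_filter; pose d v := dot v (vec3 3 (2 * phi R) 1); rewrite -[LHS]/(\sum_(v <- H3_roots R | 0 < d v) F v).
rewrite [X in _ *: X](bigID (fun v => 0 < d v)) /= [X in _ + X]sum_roots_opp.
rewrite [X in _ + X](_ : _ = \sum_(v <- H3_roots R | 0 < d v) F v).
  by rewrite -mulr2n -scaler_nat scalerA mulVf ?pnatr_eq0 // scale1r.
rewrite big_seq_cond [RHS]big_seq_cond; apply: eq_big => [v|v _]; last exact: FN.
case vR: (v \in _) => //=; rewrite /d dot_nv oppr_gt0 -leNgt.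
by rewrite le_eqVlt eq_sym (negPf (dot_generic vR)).
Qed.

Lemma pos_roots_sub v : v \in positive_roots R -> v \in H3_roots R.
Proof. by rewrite mem_filter => /andP[]. Qed.

Lemma sigmaN v : sigma (- v) = sigma v.
Proof.
congr insubd; rewrite /refl.
have -> : dot (- v) (- v) = dot v v.
  by apply: eq_bigr => i _; rewrite !mxE mulrNN.
have -> : (- v)^T = - v^T by apply/matrixP => i j; rewrite !mxE.
by rewrite mulNmx mulmxN opprK.
Qed.

Lemma H3_orth w : (w : 'M[R]_3) *m w^T = 1%:M.
Proof.
have : in_H3 w := H3_mxP w.
case/asboolP=> s h ->; elim: s h => [|v s IH] h.
  by rewrite big_nil trmx1 mulmx1.
have vR : v \in H3_roots R by rewrite h ?mem_head.
have rT : (refl v)^T = refl v.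
  rewrite /refl linearB linearZ /= trmx_mul trmxK; congr (_ - _); exact: trmx1.
rewrite big_cons trmx_mul rT mulmxA -(mulmxA (refl v)) IH ?mulmx1.
  exact: refl_invol vR.
by move=> u us; rewrite h // inE us orbT.
Qed.

Lemma H3_inv_tr w : H3_mx (w^-1)%g = w^T.
Proof.
have e : H3_mx (w^-1)%g *m w = 1%:M.
  by rewrite -[LHS]/(H3_mx (w^-1 * w)%g) mulVg.
by rewrite -[LHS]mulmx1 -(H3_orth w) mulmxA e mul1mx.
Qed.

Lemma H3_mxM w1 w2 : H3_mx (w1 * w2)%g = w1 *m w2. Proof. by []. Qed.

Lemma sigma_inv v : v \in H3_roots R -> (sigma v * sigma v = 1)%g.
Proof. by move=> vR; apply/val_inj; rewrite -[LHS]/(H3_mx (sigma v) * H3_mx (sigma v)) sigmaE // refl_invol. Qed.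

Lemma sigma_act v w : v \in H3_roots R -> sigma (v *m w) = (w^-1 * sigma v * w)%g.
Proof.
move=> vR; apply/val_inj.
rewrite -[RHS]/(H3_mx (w^-1)%g *m H3_mx (sigma v) *m H3_mx w).
rewrite -[LHS]/(H3_mx (sigma (v *m w))) !sigmaE ?root_act // H3_inv_tr.
rewrite /refl !root_norm ?root_act // mulmxBr mulmxBl mulmx1.
have -> : w^T *m w = 1%:M :> 'M[R]_3 by rewrite -H3_inv_tr -H3_mxM mulVg.
by rewrite -scalemxAr -scalemxAl trmx_mul !mulmxA.
Qed.

End RootSums.

Lemma ord3P (i : 'I_3) : [\/ i = 0, i = 1 | i = 2%:R].
Proof.
by case: i => [[|[|[|//]]] lt3]; [constructor 1|constructor 2|constructor 3];
  apply/val_inj.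
Qed.

(** * Vector-valued polynomials as a graded free R[x]-module *)

Section VectorPolynomials.
Variables (R : realType) (n : nat).
Notation U := (vpoly R n).
Implicit Types (f g : U) (u : 'cV[R]_n) (i k : 'I_3).

Lemma mulX_is_linear i : linear (@mulX R n i).
Proof. by move=> a f g; apply/ffunP => j; rewrite !ffunE mulrDr scalerAr. Qed.
HB.instance Definition _ i :=
  GRing.isLinear.Build R U U *:%R (@mulX R n i) (mulX_is_linear i).

Lemma constant_vpoly_is_linear : linear (@constant_vpoly R n).
Proof. by move=> a u v; apply/ffunP => j; rewrite !ffunE !mxE scalerDl scalerA. Qed.
HB.instance Definition _ :=
  GRing.isLinear.Build R 'cV[R]_n U *:%R (@constant_vpoly R n)
    constant_vpoly_is_linear.

Lemma mulXC i k f : mulX i (mulX k f) = mulX k (mulX i f).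
Proof. by apply/ffunP => j; rewrite !ffunE mulrCA. Qed.

Definition vmono (m : 'X_{1..3}) (j : 'I_n) : U :=
  pure_tensor 'X_[m] (delta_mx j 0).

Lemma vmono0 (j : 'I_n) : vmono 0%MM j = constant_vpoly (delta_mx j 0).
Proof. by rewrite /vmono mpolyX0. Qed.

Lemma vmonoS i m j : vmono (U_(i) + m)%MM j = mulX i (vmono m j).
Proof. by apply/ffunP => k; rewrite !ffunE mpolyXD scalerAr. Qed.

Lemma mnm_ind (P : 'X_{1..3} -> Prop) :
  P 0%MM -> (forall i m, P m -> P (U_(i) + m)%MM) -> forall m, P m.
Proof.
move=> P0 PS m; have [d] := ubnP (mdeg m); elim: d m => // d IH m ltmd.
have [->|/eqP] := eqVneq m 0%MM; first exact: P0.
rewrite mnmP => /existsNP[i /eqP]; rewrite mnm0E -lt0n => mi.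
have le1 : (U_(i) <= m)%MM.
  by apply/mnm_lepP => k; rewrite mnm1E; case: eqP => // <-.
rewrite -(submK le1) addmC; apply: PS; apply: IH.
by move: ltmd; rewrite -{1}(submK le1) mdegD mdeg1 addn1.
Qed.

Lemma vpolyE f : f = \sum_j \sum_(m <- msupp (f j)) (f j)@_m *: vmono m j.
Proof.
apply/ffunP => k; rewrite sum_ffunE (bigD1 k) //= [X in _ + X]big1 => [|j jk].
  rewrite addr0 sum_ffunE {1}[f k]mpolyE; apply: eq_bigr => m _.
  by rewrite !ffunE mxE !eqxx scale1r.
rewrite sum_ffunE big1 // => m _.
by rewrite !ffunE mxE eq_sym (negPf jk) scale0r scaler0.
Qed.

Lemma vpoly_ind (P : U -> Prop) :
  (forall u, P (constant_vpoly u)) -> (forall i f, P f -> P (mulX i f)) ->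
  (forall a f g, P f -> P g -> P (a *: f + g)) -> forall f, P f.
Proof.
move=> Pc PX PL f; have P0 : P 0 by have := Pc 0; rewrite linear0.
have PD g h : P g -> P h -> P (g + h) by move=> ? ?; rewrite -[g]scale1r; exact: PL.
have PZ a g : P g -> P (a *: g) by move=> ?; rewrite -[_ *: _]addr0; exact: PL.
rewrite [f]vpolyE; apply: (big_ind P) => // j _.
apply: (big_ind P) => // m _; apply: PZ.
elim/mnm_ind: m => [|i m IH]; first by rewrite vmono0.
by rewrite vmonoS; exact: PX.
Qed.

Definition vhomog (d : nat) f := forall j, f j \is d.-homog.

Lemma vhomog_lin d a f g : vhomog d f -> vhomog d g -> vhomog d (a *: f + g).
Proof. by move=> hf hg j; rewrite !ffunE dhomogD // dhomogZ. Qed.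
Lemma vhomog0 d : vhomog d 0.
Proof. by move=> j; rewrite ffunE dhomog0. Qed.

Lemma vhomog_const u : vhomog 0 (constant_vpoly u).
Proof. by move=> j; rewrite ffunE dhomogZ // dhomog1. Qed.

Lemma vhomog_mulX d i f : vhomog d f -> vhomog d.+1 (mulX i f).
Proof.
move=> hf j; rewrite ffunE -[d.+1]add1n; apply: dhomogM => //.
by rewrite dhomogX /= mdeg1.
Qed.

Lemma vhomog_ind (P : nat -> U -> Prop) :
  (forall u, P 0 (constant_vpoly u)) ->
  (forall d i f, vhomog d f -> P d f -> P d.+1 (mulX i f)) ->
  (forall d a f g, vhomog d f -> vhomog d g -> P d f -> P d g -> P d (a *: f + g)) ->
  forall d f, vhomog d f -> P d f.
Proof.
move=> Pc PX PL d f hf.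
pose Q d f := vhomog d f /\ P d f; suff: Q d f by case.
have QX e i g : Q e g -> Q e.+1 (mulX i g).
  by case=> h Pg; split; [exact: vhomog_mulX|exact: PX].
have QL e a g h : Q e g -> Q e h -> Q e (a *: g + h).
  by move=> [? ?] [? ?]; split; [exact: vhomog_lin|exact: PL].
have Qc u : Q 0 (constant_vpoly u) by split=> //; exact: vhomog_const.
have Qm m j : Q (mdeg m) (vmono m j).
  elim/mnm_ind: m => [|i m IH]; first by rewrite mdeg0 vmono0.
  by rewrite mdegD mdeg1 vmonoS; exact: QX.
have Q00 : Q 0 0 by have := Qc 0; rewrite linear0.
(* The hypothesis on constants gives zero in degree 0 only; multiplying it by a variable moves it to
   the other degrees. *)
have Q0 e : Q e 0.
  elim: e => // e /(QX e 0); by rewrite linear0.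
have QD g h : Q d g -> Q d h -> Q d (g + h) by move=> ? ?; rewrite -[g]scale1r; exact: QL.
have QZ a g : Q d g -> Q d (a *: g) by move=> ?; rewrite -[_ *: _]addr0; exact: QL.
rewrite [f]vpolyE; apply: (big_ind (Q d)) => // j _.
rewrite big_seq; apply: (big_ind (Q d)) => // m mf; apply: QZ.
by have <- := dhomog_mf (hf j) mf; exact: Qm.
Qed.

Definition vcomp (d : nat) f : U := [ffun j => pihomog mdeg d (f j)].

Lemma vcomp_homog d f : vhomog d (vcomp d f).
Proof. by move=> j; rewrite ffunE pihomogP. Qed.

Lemma vcompE f : exists N, f = \sum_(d < N) vcomp d f.
Proof.
exists (\max_j msize (f j)); apply/ffunP => j; rewrite sum_ffunE.
rewrite {1}(pihomog_partitionE (mf := mdeg) (k := \max_j msize (f j)) (p := f j)).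
  by apply: eq_bigr => d _; rewrite ffunE.
by apply: (leq_trans _ (leq_bigmax j)).
Qed.

Lemma vcomp_id d f : vhomog d f -> vcomp d f = f.
Proof. by move=> h; apply/ffunP => j; rewrite ffunE pihomog_dE. Qed.

Lemma vcomp_ne d e f : d != e -> vhomog e f -> vcomp d f = 0.
Proof.
move=> de h; apply/ffunP => j; rewrite ffunE [RHS]ffunE; by rewrite (pihomog_ne0 _ (h j)) // eq_sym.
Qed.

Lemma vcomp_is_linear d : linear (vcomp d).
Proof. by move=> a f g; apply/ffunP => j; rewrite !ffunE linearP. Qed.
HB.instance Definition _ d :=
  GRing.isLinear.Build R U U *:%R (vcomp d) (vcomp_is_linear d).

(* The universal property of P (x) R^n as the free R[x]-module on R^n. *)
Section Extension.
Variables (Z : lmodType R) (T : 'I_3 -> {linear Z -> Z}).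
Variable c : {linear 'cV[R]_n -> Z}.
Hypothesis TC : forall i k z, T i (T k z) = T k (T i z).

Definition Tmono (m : 'X_{1..3}) (z : Z) : Z :=
  iter (m 0) (T 0) (iter (m 1) (T 1) (iter (m 2%:R) (T 2%:R) z)).

Definition vext f : Z :=
  \sum_j \sum_(m <- msupp (f j)) (f j)@_m *: Tmono m (c (delta_mx j 0)).

(** The support varies with [f]; an index set common to several polynomials is what makes additivity
    provable termwise. *)
Lemma vext_bound K f : (forall j, msize (f j) <= K)%N ->
  vext f = \sum_j \sum_(m : 'X_{1..3 < K}) (f j)@_m *: Tmono m (c (delta_mx j 0)).
Proof.
move=> h; apply: eq_bigr => j _.
rewrite (big_mksub 'X_{1..3 < K}) ?msupp_uniq //=; first last.
  by move=> m /msize_mdeg_lt /leq_trans ->.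
by rewrite big_rmcond //= => m /memN_msupp_eq0 ->; rewrite scale0r.
Qed.

Lemma vext_is_linear : linear vext.
Proof.
move=> a f g.
pose K := maxn (\max_j msize (f j)) (maxn (\max_j msize (g j))
  (\max_j msize ((a *: f + g) j))).
have le (F : 'I_n -> nat) j : (F j <= \max_j F j)%N by rewrite (leq_bigmax j).
rewrite !(@vext_bound K) => [|j|j|j]; last first.
- by rewrite !leq_max (le (fun j => msize ((a *: f + g) j))) !orbT.
- by rewrite leq_max (le (fun j => msize (f j))).
- by rewrite !leq_max (le (fun j => msize (g j))) orbT.
rewrite scaler_sumr -big_split; apply: eq_bigr => j _ /=.
rewrite scaler_sumr -big_split; apply: eq_bigr => m _ /=.
by rewrite !ffunE mcoeffD mcoeffZ scalerDl scalerA.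
Qed.
HB.instance Definition _ := GRing.isLinear.Build R U Z *:%R vext vext_is_linear.

Lemma vext_mono m j : vext (vmono m j) = Tmono m (c (delta_mx j 0)).
Proof.
rewrite /vext (bigD1 j) //= [X in _ + X]big1 => [|k kj].
  by rewrite !ffunE mxE !eqxx scale1r addr0 msuppX big_seq1 mcoeffX eqxx scale1r.
by rewrite !ffunE mxE (negPf kj) scale0r msupp0 big_nil.
Qed.

Lemma Tmono0 z : Tmono 0%MM z = z.
Proof. by rewrite /Tmono !mnm0E. Qed.

Lemma TmonoS i m z : Tmono (U_(i) + m)%MM z = T i (Tmono m z).
Proof.
have itC k l e y : iter e (T k) (T l y) = T l (iter e (T k) y).
  by elim: e => //= e ->; rewrite TC.
rewrite /Tmono !mnmDE !mnm1E.
by case: (ord3P i) => ->; rewrite /= ?itC.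
Qed.

Lemma vext_const u : vext (constant_vpoly u) = c u.
Proof.
have -> : u = \sum_j u j 0 *: delta_mx j 0.
  by rewrite {1}[u]matrix_sum_delta; apply: eq_bigr => j _; rewrite big_ord1.
rewrite !linear_sum; apply: eq_bigr => j _ /=.
by rewrite !linearZ /= -vmono0 vext_mono Tmono0.
Qed.

Lemma vext_mulX i f : vext (mulX i f) = T i (vext f).
Proof.
rewrite [f]vpolyE (linear_sum (mulX i)) 2!(linear_sum vext) (linear_sum (T i)).
apply: eq_bigr => j _ /=.
rewrite (linear_sum (mulX i)) 2!(linear_sum vext) (linear_sum (T i)).
apply: eq_bigr => m _ /=.
by rewrite 2!linearZ_LR [X in T i X]linearZ_LR linearZ_LR /= -vmonoS !vext_mono TmonoS.
Qed.

End Extension.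

End VectorPolynomials.

(** * Dunkl operators *)

Section LinearCombinations.
Variables (R : realType) (V : lmodType R) (c : R).

(** An equation x = c y + z is the shape of a linearity goal. These closure rules prove linearity of
    composite operators by following their structure. *)
Lemma scale_lin k (x y z : V) : x = c *: y + z -> k *: x = c *: (k *: y) + k *: z.
Proof. by move=> ->; rewrite scalerDr !scalerA [k * c]mulrC. Qed.

Lemma add_lin (x y z x' y' z' : V) :
  x = c *: y + z -> x' = c *: y' + z' -> x + x' = c *: (y + y') + (z + z').
Proof. by move=> -> ->; rewrite scalerDr addrACA. Qed.

Lemma sum_lin (I : eqType) (r : seq I) (F G H : I -> V) :
  {in r, forall i, F i = c *: G i + H i} ->
  \sum_(i <- r) F i = c *: (\sum_(i <- r) G i) + \sum_(i <- r) H i.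
Proof.
by move=> h; rewrite (eq_big_seq _ h) big_split /= scaler_sumr.
Qed.

End LinearCombinations.

Section DunklOperators.
Variables (R : realType) (n : nat) (tau : H3_repr R n) (kappa : R).
Notation U := (vpoly R n).
Notation D := (dunkl tau kappa).
Notation act := (vact tau).
Implicit Types (f g : U) (u : 'cV[R]_n) (w : H3 R) (p q : {mpoly R[3]}).
Local Opaque divided_difference positive_roots H3_roots sigma.

Lemma subst_mx_lin (w : 'M[R]_3) a p q :
  subst_mx w (a *: p + q) = a *: subst_mx w p + subst_mx w q.
Proof. by rewrite /subst_mx comp_mpolyD comp_mpolyZ. Qed.

Lemma subst_mxX (w : 'M[R]_3) i p :
  subst_mx w ('X_i * p) = \sum_k w k i *: ('X_k * subst_mx w p).
Proof.
rewrite /subst_mx rmorphM /= comp_mpolyXU -tnth_nth tnth_mktuple mulr_suml.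
by apply: eq_bigr => k _; rewrite scalerAl.
Qed.

Lemma subst_mxZ1 (w : 'M[R]_3) a : subst_mx w (a *: 1) = a *: 1.
Proof. by rewrite /subst_mx comp_mpolyZ rmorph1. Qed.

Lemma vact_is_linear w : linear (act w).
Proof.
move=> a f g; apply/ffunP => j.
rewrite [LHS]ffunE [RHS]ffunE [in X in _ = X + _]ffunE [in X in _ = _ *: X + _]ffunE.
rewrite [in X in _ = _ + X]ffunE; apply: sum_lin => k _; apply: scale_lin.
rewrite [X in subst_mx _ X]ffunE [in X in X + _]ffunE; exact: subst_mx_lin.
Qed.
HB.instance Definition _ w :=
  GRing.isLinear.Build R U U *:%R (act w) (vact_is_linear w).

Lemma vact_const w u : act w (constant_vpoly u) = constant_vpoly (tau w *m u).
Proof.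
apply/ffunP => j; rewrite [LHS]ffunE [RHS]ffunE mxE scaler_suml.
by apply: eq_bigr => k _; rewrite [X in subst_mx _ X]ffunE subst_mxZ1 scalerA.
Qed.

Lemma vact_mulX w i f : act w (mulX i f) = \sum_k (w : 'M_3) k i *: mulX k (act w f).
Proof.
apply/ffunP => j; rewrite [LHS]ffunE [RHS]sum_ffunE.
under eq_bigr => k _ do rewrite [X in subst_mx _ X]ffunE subst_mxX scaler_sumr.
rewrite exchange_big /=; apply: eq_bigr => k _.
rewrite [RHS]ffunE [X in _ *: X]ffunE [X in _ *: (_ * X)]ffunE mulr_sumr scaler_sumr.
by apply: eq_bigr => l _; rewrite -scalerAr !scalerA mulrC.
Qed.

Lemma linear_form_neq0 (v : 'rV[R]_3) : v != 0 -> linear_form v != 0.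
Proof.
apply: contra_neq => e; apply/rowP => i; rewrite mxE.
have := congr1 (mcoeff U_(i)%MM) e; rewrite mcoeff0 linear_sum /= (bigD1 i) //=.
rewrite mcoeffZ mcoeffXU eqxx mulr1 big1 ?addr0 // => k ki.
by rewrite mcoeffZ mcoeffXU (negPf ki) mulr0.
Qed.

Lemma root_neq0 (v : 'rV[R]_3) : v \in H3_roots R -> v != 0.
Proof.
move=> /root_norm h; apply/eqP => v0; move: h; rewrite v0 /dot big1 => [/eqP|i _].
  by rewrite eq_sym pnatr_eq0.
by rewrite mxE mul0r.
Qed.

(** The quotient is obtained by choice; since R[x] is a domain and the linear form of a root is
    nonzero, it is characterized by its equation. *)
Lemma divided_difference_uniq (v : 'rV[R]_3) p q : v \in H3_roots R ->
  linear_form v * q = p - subst_mx (refl v) p -> divided_difference v p = q.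
Proof.
move=> vR e; apply: (mulfI (linear_form_neq0 (root_neq0 vR))).
by rewrite divided_differenceE.
Qed.

Lemma divided_difference_lin (v : 'rV[R]_3) a p q : v \in H3_roots R ->
  divided_difference v (a *: p + q) =
  a *: divided_difference v p + divided_difference v q.
Proof.
move=> vR; apply: divided_difference_uniq => //.
rewrite mulrDr -scalerAr [X in _ *: X]divided_differenceE [X in _ + X]divided_differenceE.
by rewrite subst_mx_lin scalerBr opprD addrACA.
Qed.

(** Leibniz rule: x_i p - (x_i p)s = x_i (p - ps) + (x_i - x_i s) ps for s the reflection in v, and
    x_i - x_i s = (v_i / 2) <x, v> because <v, v> = 4. *)
Lemma divided_difference_mulX (v : 'rV[R]_3) i p : v \in H3_roots R ->
  divided_difference v ('X_i * p) =
  'X_i * divided_difference v p + (v 0 i / 2) *: subst_mx (refl v) p.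
Proof.
move=> vR; apply: divided_difference_uniq => //.
rewrite mulrDr mulrCA [X in _ * X + _]divided_differenceE subst_mxX mulrBr -addrA.
congr (_ + _).
rewrite (_ : \sum_k _ = 'X_i * subst_mx (refl v) p -
   linear_form v * ((v 0 i / 2) *: subst_mx (refl v) p)); first by rewrite opprB addrC.
rewrite /linear_form mulr_suml -sumrN.
rewrite [X in X + _](_ : _ = \sum_k (k == i)%:R *: ('X_k * subst_mx (refl v) p)).
  rewrite -big_split /=; apply: eq_bigr => k _.
  rewrite -scalerAl -scalerAr scalerA -scaleNr -scalerDl; congr (_ *: _).
  by rewrite /refl (root_norm vR) !mxE big_ord1 !mxE; congr (_ - _); field.
rewrite (bigD1 i) //= eqxx scale1r big1 ?addr0 // => k /negPf->.
by rewrite scale0r.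
Qed.

Lemma divided_differenceZ1 (v : 'rV[R]_3) a : v \in H3_roots R ->
  divided_difference v (a *: 1) = 0.
Proof.
by move=> vR; apply: divided_difference_uniq => //; rewrite subst_mxZ1 mulr0 subrr.
Qed.

Lemma dunkl_is_linear i : linear (D i).
Proof.
move=> a f g; apply/ffunP => j.
rewrite [LHS]ffunE [RHS]ffunE [in X in _ = X + _]ffunE [in X in _ = _ *: X + _]ffunE.
rewrite [in X in _ = _ + X]ffunE; apply: add_lin.
  rewrite [X in mderiv _ X]ffunE mderivD; congr (_ + _).
  rewrite [X in mderiv _ X]ffunE; exact: mderivZ.
apply: scale_lin; apply: sum_lin => v /pos_roots_sub vR; apply: scale_lin.
apply: sum_lin => k _; apply: scale_lin.
rewrite [X in divided_difference _ X]ffunE [in X in X + _]ffunE.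
exact: divided_difference_lin.
Qed.
HB.instance Definition _ i :=
  GRing.isLinear.Build R U U *:%R (D i) (dunkl_is_linear i).

Lemma dunkl_const i u : D i (constant_vpoly u) = 0.
Proof.
apply/ffunP => j; rewrite [LHS]ffunE [RHS]ffunE.
rewrite [X in mderiv _ X]ffunE mderivZ -mpolyC1 mderivC scaler0 add0r.
rewrite big1_seq ?scaler0 // => v /andP[_ /pos_roots_sub vR].
rewrite big1 ?scaler0 // => k _; rewrite [X in divided_difference _ X]ffunE.
by rewrite divided_differenceZ1 // scaler0.
Qed.

Definition Dcorr (i k : 'I_3) f : U :=
  \sum_(v <- positive_roots R) (v 0 i * v 0 k / 2) *: act (sigma v) f.

(** The commutation relation of the rational Cherednik algebra. Everything later about [dunkl]
    follows from it and from the vanishing on constants. *)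
Lemma dunkl_mulX i k f :
  D i (mulX k f) = mulX k (D i f) + (i == k)%:R *: f + kappa *: Dcorr i k f.
Proof.
apply/ffunP => j; rewrite [LHS]ffunE [RHS]ffunE [in X in _ = X + _]ffunE.
rewrite [in X in _ = X + _ + _]ffunE [in X in _ = _ * X + _ + _]ffunE.
rewrite [in X in _ = _ + X + _]ffunE [in X in _ = _ + X]ffunE.
rewrite [X in mderiv _ X]ffunE mderivM mderivX mulrDr.
have -> : (U_(k)%MM i)%:R *: 'X_[U_(k) - U_(i)] * f j = (i == k)%:R *: f j.
  rewrite mnmE eq_sym; case: eqP => [->|_]; last by rewrite !scale0r mul0r.
  rewrite (_ : (_ - _)%MM = 0%MM) ?mpolyX0 ?scale1r ?mul1r //.
  by apply/mnmP => l; rewrite mnmBE subnn mnm0E.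
rewrite [_ + 'X_k * _^`M(i)]addrC -!addrA; congr (_ + _).
rewrite [X in _ = X]addrCA; congr (_ + _).
rewrite -scalerAr -scalerDr; congr (_ *: _).
rewrite [in X in _ = _ + X]sum_ffunE mulr_sumr -big_split /=.
apply: eq_big_seq => v /pos_roots_sub vR.
rewrite -scalerAr [in X in _ = _ + X]ffunE [in X in _ = _ + _ *: X]ffunE.
have -> : v 0 i * v 0 k / 2 = v 0 i * (v 0 k / 2) by rewrite mulrA.
rewrite -scalerA -scalerDr; congr (_ *: _).
rewrite mulr_sumr scaler_sumr -big_split /=; apply: eq_bigr => l _.
rewrite [X in divided_difference _ X]ffunE divided_difference_mulX // sigmaE //.
by rewrite scalerDr -scalerAr !scalerA [v 0 k / 2 * _]mulrC.
Qed.

End DunklOperators.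

(* P (x) R^n with its Dunkl operators, abstracted to the properties that the
   proof needs: it is free over R[x] ([ch_ext]) on the constants [chc], and
   graded by [chh] with projections [chp]. *)
Record cherednik_module (R : realType) n (tau : H3_repr R n) (kappa : R) :=
  CherednikModule {
  chS :> lmodType R;
  chX : 'I_3 -> {linear chS -> chS};
  chD : 'I_3 -> {linear chS -> chS};
  chA : H3 R -> {linear chS -> chS};
  chc : {linear 'cV[R]_n -> chS};
  chh : nat -> chS -> Prop;
  chp : nat -> {linear chS -> chS};
  ch_mulXC : forall i k f, chX i (chX k f) = chX k (chX i f);
  ch_act_const : forall w u, chA w (chc u) = chc (tau w *m u);
  ch_act_mulX : forall w i f, chA w (chX i f) = \sum_k (w : 'M_3) k i *: chX k (chA w f);
  ch_dunkl_const : forall i u, chD i (chc u) = 0;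
  ch_dunkl_mulX : forall i k f, chD i (chX k f) =
    chX k (chD i f) + (i == k)%:R *: f +
    kappa *: \sum_(v <- positive_roots R) (v 0 i * v 0 k / 2) *: chA (sigma v) f;
  ch_ind : forall P : chS -> Prop,
    (forall u, P (chc u)) -> (forall i f, P f -> P (chX i f)) ->
    (forall a f g, P f -> P g -> P (a *: f + g)) -> forall f, P f;
  ch_ext : forall (Z : lmodType R) (T : 'I_3 -> {linear Z -> Z})
      (c : {linear 'cV[R]_n -> Z}),
    (forall i k z, T i (T k z) = T k (T i z)) ->
    {F : {linear chS -> Z} | (forall u, F (chc u) = c u) &
                             forall i f, F (chX i f) = T i (F f)};
  ch_hconst : forall u, chh 0 (chc u);
  ch_hmulX : forall d i f, chh d f -> chh d.+1 (chX i f);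
  ch_hlin : forall d a f g, chh d f -> chh d g -> chh d (a *: f + g);
  ch_h0 : forall d, chh d 0;
  ch_hind : forall P : nat -> chS -> Prop,
    (forall u, P 0 (chc u)) ->
    (forall d i f, chh d f -> P d f -> P d.+1 (chX i f)) ->
    (forall d a f g, chh d f -> chh d g -> P d f -> P d g -> P d (a *: f + g)) ->
    forall d f, chh d f -> P d f;
  ch_comp_homog : forall d f, chh d (chp d f);
  ch_compE : forall f, exists N, f = \sum_(d < N) chp d f;
  ch_comp_id : forall d f, chh d f -> chp d f = f;
  ch_comp_ne : forall d e f, d != e -> chh e f -> chp d f = 0
}.

Section DunklModule.
Variables (R : realType) (n : nat) (tau : H3_repr R n) (kappa : R).
Let act w : {linear vpoly R n -> vpoly R n} := vact tau w.
Let mX i : {linear vpoly R n -> vpoly R n} := @mulX R n i.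
Let cst : {linear 'cV[R]_n -> vpoly R n} := @constant_vpoly R n.
Let D i : {linear vpoly R n -> vpoly R n} := dunkl tau kappa i.
Let comp d : {linear vpoly R n -> vpoly R n} := vcomp d.

Definition dunkl_module : cherednik_module tau kappa.
Proof.
apply: (@CherednikModule R n tau kappa (vpoly R n) mX D act cst (@vhomog R n) comp).
- exact: mulXC.
- exact: vact_const.
- exact: vact_mulX.
- exact: dunkl_const.
- exact: dunkl_mulX.
- exact: vpoly_ind.
- move=> Z T c TC; exists (vext T c); first exact: vext_const.
  by move=> i f; exact: vext_mulX.
- exact: vhomog_const.
- exact: vhomog_mulX.
- exact: vhomog_lin.
- exact: vhomog0.
- exact: vhomog_ind.
- exact: vcomp_homog.
- exact: vcompE.
- exact: vcomp_id.
- exact: vcomp_ne.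
Defined.

End DunklModule.

(** * Equivariance and commutation of Dunkl operators, and the Euler operator *)

Section CherednikOperators.
Variables (R : realType) (n : nat) (tau : H3_repr R n) (kappa : R).
Variable M : cherednik_module tau kappa.
Notation D := (chD M).
Notation X := (chX M).
Notation act := (chA M).
Notation cst := (chc M).
Notation hmg := (@chh _ _ _ _ M).
Implicit Types (f g : M) (u : 'cV[R]_n) (w : H3 R).
Local Opaque positive_roots H3_roots sigma.

Lemma homogD d f g : hmg d f -> hmg d g -> hmg d (f + g).
Proof. by move=> hf hg; rewrite -[f]scale1r; exact: ch_hlin. Qed.
Lemma homogZ d a f : hmg d f -> hmg d (a *: f).
Proof. by move=> hf; rewrite -[_ *: _]addr0; apply: ch_hlin => //; exact: ch_h0. Qed.
Lemma homog_sum d (I : Type) (r : seq I) (P : pred I) (F : I -> M) :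
  (forall i, P i -> hmg d (F i)) -> hmg d (\sum_(i <- r | P i) F i).
Proof. by move=> h; apply: (big_ind (hmg d)) => //; [exact: ch_h0|exact: homogD]. Qed.

Lemma homog0_const f : hmg 0 f -> exists u, f = cst u.
Proof.
suff H d g : hmg d g -> d = 0 -> exists u, g = cst u by move=> /H; apply.
move: d g; apply: ch_hind => [u _|//|d a f1 f2 _ _ h1 h2 d0]; first by exists u.
have [u ->] := h1 d0; have [v ->] := h2 d0.
by exists (a *: u + v); rewrite linearP.
Qed.

Lemma chactM w1 w2 f : act (w1 * w2)%g f = act w1 (act w2 f).
Proof.
elim/(@ch_ind _ _ _ _ M): f => [u|i f IH|a f g IHf IHg].
- by rewrite !ch_act_const repr_mxM ?inE // mulmxA.
- rewrite !ch_act_mulX linear_sum /=.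
  under [RHS]eq_bigr => l _ do rewrite linearZ /= ch_act_mulX scaler_sumr.
  rewrite exchange_big /=; apply: eq_bigr => k _; rewrite IH -mulmxE mxE scaler_suml.
  by apply: eq_bigr => l _; rewrite scalerA mulrC.
- by rewrite !linearP /= IHf IHg.
Qed.

Lemma chact1 f : act 1%g f = f.
Proof.
elim/(@ch_ind _ _ _ _ M): f => [u|i f IH|a f g IHf IHg].
- by rewrite ch_act_const repr_mx1 mul1mx.
- rewrite ch_act_mulX IH (bigD1 i) //= big1 => [|k ki].
    by rewrite addr0 mxE eqxx scale1r.
  by rewrite mxE (negPf ki) scale0r.
- by rewrite linearP /= IHf IHg.
Qed.

Lemma act_homog d w f : hmg d f -> hmg d (act w f).
Proof.
move: d f; apply: ch_hind => [u|d i f _ h|d a f g _ _ hf hg].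
- by rewrite ch_act_const; exact: ch_hconst.
- by rewrite ch_act_mulX; apply: homog_sum => k _; exact/homogZ/ch_hmulX.
- by rewrite linearP; exact: ch_hlin hf hg.
Qed.

Definition corr (i k : 'I_3) f : M :=
  \sum_(v <- positive_roots R) (v 0 i * v 0 k / 2) *: act (sigma v) f.

Lemma corr_is_linear i k : linear (corr i k).
Proof.
move=> a f g; apply: sum_lin => v _; apply: scale_lin; exact: linearP.
Qed.
HB.instance Definition _ i k :=
  GRing.isLinear.Build R M M *:%R (corr i k) (corr_is_linear i k).

Lemma corrC i k f : corr i k f = corr k i f.
Proof. by apply: eq_bigr => v _; rewrite [v 0 i * _]mulrC. Qed.

Lemma D_X i k f :
  D i (X k f) = X k (D i f) + (i == k)%:R *: f + kappa *: corr i k f.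
Proof. exact: ch_dunkl_mulX. Qed.

(** Conjugation by w permutes the reflections, so after reindexing the roots only the coordinates of
    v w remain to be expanded. *)
Lemma act_corr w i k f :
  act w (corr i k f) =
  \sum_l \sum_m ((w : 'M_3) l i * (w : 'M_3) m k) *: corr l m (act w f).
Proof.
pose F (v : 'rV[R]_3) := (v 0 i * v 0 k / 2) *: act w (act (sigma v) f).
have FN v : F (- v) = F v by rewrite /F sigmaN !mxE mulrNN.
pose F' (v : 'rV[R]_3) :=
  ((v *m w) 0 i * (v *m w) 0 k / 2) *: act (sigma v) (act w f).
have F'N v : F' (- v) = F' v by rewrite /F' sigmaN mulNmx !mxE mulrNN.
transitivity (\sum_(v <- positive_roots R) F v).
  by rewrite linear_sum; apply: eq_bigr => v _; rewrite linearZ.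
rewrite (sum_pos_roots FN) -(sum_roots_act w).
have -> : \sum_(v <- H3_roots R) F (v *m w) = \sum_(v <- H3_roots R) F' v.
  apply: eq_big_seq => v vR; rewrite /F /F' sigma_act // -!chactM.
  by congr (_ *: act _ _); rewrite !mulgA mulgV mul1g.
rewrite -(sum_pos_roots F'N) /corr.
under [RHS]eq_bigr => l _ do (under eq_bigr => m _ do rewrite scaler_sumr;
  rewrite exchange_big /=).
rewrite exchange_big /=; apply: eq_bigr => v _; rewrite /F' !mxE.
rewrite big_distrl /= big_distrl scaler_suml /=; apply: eq_bigr => l _.
rewrite big_distrr /= big_distrl scaler_suml /=; apply: eq_bigr => m _.
by rewrite scalerA; congr (_ *: _); ring.
Qed.

Lemma H3_col_orth w i k : \sum_l (w : 'M_3) l i * (w : 'M_3) l k = (i == k)%:R.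
Proof.
have /matrixP/(_ i k) : (w : 'M_3)^T *m w = 1%:M.
  by rewrite -H3_inv_tr -H3_mxM mulVg.
by rewrite !mxE => <-; apply: eq_bigr => l _; rewrite mxE.
Qed.

Lemma act_D w i f : act w (D i f) = \sum_l (w : 'M_3) l i *: D l (act w f).
Proof.
elim/(@ch_ind _ _ _ _ M): f => [u|k f IH|a f g IHf IHg].
- rewrite ch_dunkl_const linear0 big1 // => l _.
  by rewrite ch_act_const ch_dunkl_const scaler0.
- rewrite D_X linearD linearD !linearZ /= ch_act_mulX IH act_corr ch_act_mulX.
  under [RHS]eq_bigr => l _ do rewrite linear_sum scaler_sumr /=.
  transitivity (\sum_l \sum_m ((w : 'M_3) l i * (w : 'M_3) m k) *:
     (X m (D l (act w f)) + (l == m)%:R *: act w f + kappa *: corr l m (act w f))).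
    under [RHS]eq_bigr => l _ do
      (under eq_bigr => m _ do rewrite !scalerDr; rewrite !big_split /=).
    rewrite !big_split /=; congr (_ + _ + _).
    + rewrite exchange_big /=; apply: eq_bigr => m _.
      rewrite linear_sum scaler_sumr; apply: eq_bigr => l _ /=.
      by rewrite linearZ scalerA mulrC.
    + rewrite -(H3_col_orth w) scaler_suml; apply: eq_bigr => l _.
      rewrite (bigD1 l) //= big1 ?addr0 => [|m ml]; first by rewrite eqxx scale1r.
      by rewrite eq_sym (negPf ml) scale0r scaler0.
    + rewrite scaler_sumr; apply: eq_bigr => l _; rewrite scaler_sumr.
      by apply: eq_bigr => m _; rewrite !scalerA mulrC.
  apply: eq_bigr => l _; apply: eq_bigr => m _.
  by rewrite linearZ /= D_X scalerA.
- rewrite (linearP (D i)) /= [LHS](linearP (act w)) /= IHf IHg; symmetry; apply: sum_lin => l _.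
  by apply: scale_lin; rewrite (linearP (act w)) /=; exact: linearP.
Qed.

Definition Ddir (v : 'rV[R]_3) f : M := \sum_l v 0 l *: D l f.

(** Equivariance [act_D] for a reflection, whose matrix entries are delta_lk - v_l v_k / 2. *)
Lemma D_sigma v i f : v \in H3_roots R ->
  D i (act (sigma v) f) = act (sigma v) (D i f - (v 0 i / 2) *: Ddir v f).
Proof.
move=> vR; set g := act (sigma v) f.
have -> : f = act (sigma v) g by rewrite /g -chactM sigma_inv // chact1.
rewrite linearB linearZ /= /Ddir linear_sum act_D /=.
under [X in _ - _ *: X]eq_bigr => l _ do rewrite linearZ /= act_D.
rewrite -chactM sigma_inv // chact1 sigmaE //.
have eR l k : refl v l k = (l == k)%:R - v 0 l * v 0 k / 2.
  by rewrite /refl !mxE big_ord1 !mxE (root_norm vR); congr (_ - _); field.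
have sel k : \sum_l (l == k)%:R *: D l g = D k g.
  rewrite (bigD1 k) //= eqxx scale1r big1 ?addr0 // => l /negPf->.
  by rewrite scale0r.
have e1 k : \sum_l refl v l k *: D l g = D k g - (v 0 k / 2) *: Ddir v g.
  rewrite -[in RHS](sel k) /Ddir scaler_sumr -sumrB; apply: eq_bigr => l _.
  by rewrite eR scalerBl scalerA; congr (_ - _ *: _); ring.
rewrite e1; under eq_bigr => l _ do rewrite e1 scalerBr scalerA.
rewrite sumrB -/(Ddir v g) -scaler_suml.
have -> : \sum_l v 0 l * (v 0 l / 2) = 2.
  have := root_norm vR; rewrite /dot => e; under eq_bigr => l _ do rewrite mulrA.
  by rewrite -mulr_suml e; field.
by rewrite scaler_nat mulr2n opprD addrA subrr sub0r scalerN opprK subrK.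
Qed.

(** By induction on the polynomial it suffices to see that [corr i m (D k f) + D i (corr k m f)] is
    symmetric in i and k. By [D_sigma] this is true root by root: the only extra term is a multiple
    of v_i v_k v_m. *)
Theorem dunklC i k f : D i (D k f) = D k (D i f).
Proof.
elim/(@ch_ind _ _ _ _ M): f => [u|m f IH|a f g IHf IHg].
- by rewrite !ch_dunkl_const !linear0.
- have H j l : D j (D l (X m f)) = X m (D j (D l f)) +
     ((j == m)%:R *: D l f + (l == m)%:R *: D j f) +
     kappa *: (corr j m (D l f) + D j (corr l m f)).
    rewrite D_X 2!(linearD (D j)) 2!linearZ /= D_X scalerDr.
    by rewrite -!addrA; congr (_ + (_ + _)); rewrite addrCA.
  rewrite !H IH [in RHS](addrC (_ *: D i f)); congr (_ + _ + _ *: _).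
  rewrite /corr !linear_sum -!big_split; apply: eq_big_seq => v /pos_roots_sub vR /=.
  rewrite !linearZ /= !D_sigma // !linearB !linearZ /=.
  by rewrite addrCA !scalerA; congr (_ + (_ + _ *: _)); ring.
- rewrite (linearP (D k)) /= (linearP (D i)) /= (linearP (D i)) /= (linearP (D k)) /=.
  by rewrite IHf IHg.
Qed.

Lemma D_homog d i f : hmg d.+1 f -> hmg d (D i f).
Proof.
pose P d f := if d is e.+1 then hmg e (D i f) else D i f = 0.
suff H e g : hmg e g -> P e g by apply: (H d.+1).
have hcorr d' k h : hmg d' h -> hmg d' (kappa *: corr i k h).
  by move=> hh; apply/homogZ/homog_sum => v _; exact/homogZ/act_homog.
move: e g; apply: ch_hind => [u|[|e] k g hg Pg|[|e] a g h _ _ Pg Ph] /=.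
- exact: ch_dunkl_const.
- rewrite D_X Pg linear0 add0r; apply: homogD; last exact: hcorr.
  exact: homogZ.
- rewrite D_X; apply: homogD; last exact: hcorr.
  by apply: homogD; [exact: ch_hmulX|exact: homogZ].
- by rewrite linearP /= Pg Ph scaler0 addr0.
- by rewrite linearP; exact: ch_hlin Pg Ph.
Qed.

Lemma D_homog0 i f : hmg 0 f -> D i f = 0.
Proof. by case/homog0_const => u ->; exact: ch_dunkl_const. Qed.

Definition Omega f : M := \sum_(v <- positive_roots R) act (sigma v) f.

Lemma Omega_is_linear : linear Omega.
Proof. by move=> a f g; apply: sum_lin => v _; exact: linearP. Qed.
HB.instance Definition _ := GRing.isLinear.Build R M M *:%R Omega Omega_is_linear.

(** Both sides have the same commutator with x_k: on the left it is x_k plus kappa times the sum of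
    the x_i [corr i k], and that sum is also x_k Omega - Omega x_k. *)
Lemma euler_dunkl gam d f :
  \sum_(v <- positive_roots R) tau (sigma v) = gam%:M -> hmg d f ->
  \sum_i X i (D i f) = (d%:R + kappa * gam) *: f - kappa *: Omega f.
Proof.
move=> egam; move: d f; apply: ch_hind => [u|d k f _ IH|d a f g _ _ IHf IHg].
- rewrite big1 => [|i _]; last by rewrite ch_dunkl_const linear0.
  rewrite /Omega; under eq_bigr => v _ do rewrite ch_act_const.
  rewrite -linear_sum -mulmx_suml egam mul_scalar_mx.
  by rewrite [cst (_ *: _)]linearZ /= add0r scalerA subrr.
- under eq_bigr => i _ do rewrite D_X 2!linearD !linearZ /= ch_mulXC.
  rewrite !big_split /= -linear_sum IH linearB !linearZ /=.
  rewrite [X in _ + X + _](_ : _ = X k f); last first.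
    rewrite (bigD1 k) //= eqxx scale1r big1 ?addr0 // => i /negPf ->.
    by rewrite scale0r.
  rewrite -scaler_sumr.
  have -> : Omega (X k f) = X k (Omega f) - \sum_i X i (corr i k f).
    rewrite /Omega; apply/eqP; rewrite eq_sym subr_eq eq_sym; apply/eqP.
    rewrite linear_sum /=; under [X in _ + X]eq_bigr => i _ do rewrite linear_sum /=.
    rewrite exchange_big /= -big_split; apply: eq_big_seq => v /pos_roots_sub vR /=.
    have eR l m : refl v l m = (l == m)%:R - v 0 l * v 0 m / 2.
      by rewrite /refl !mxE big_ord1 !mxE (root_norm vR); congr (_ - _); field.
    rewrite ch_act_mulX -big_split (bigD1 k) //= big1 => [|i ik].
      by rewrite addr0 linearZ /= -scalerDl sigmaE // eR eqxx subrK scale1r.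
    by rewrite linearZ /= -scalerDl sigmaE // eR (negPf ik) subrK scale0r.
  rewrite opprB [kappa *: (_ - _)]scalerDr -natr1 [_ + 1 + _]addrAC [(_ + 1) *: _]scalerDl scale1r.
  by rewrite [X in X + _ = _]addrAC -[LHS]addrA [X in _ + X = _]addrC.
- under eq_bigr => i _ do rewrite !linearP.
  rewrite big_split /= -scaler_sumr IHf IHg; symmetry; apply: add_lin.
    exact: scale_lin.
  by rewrite -!scaleNr; apply: scale_lin; exact: linearP.
Qed.

End CherednikOperators.

(** * The contravariant form and the Gaussian form *)

Section Forms.
Variables (R : realType) (n : nat) (tau : H3_repr R n) (kappa : R).
Variable M : cherednik_module tau kappa.
Notation D := (chD M).
Notation X := (chX M).
Notation act := (chA M).
Notation cst := (chc M).
Notation hmg := (@chh _ _ _ _ M).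
Implicit Types (f g h : M) (u : 'cV[R]_n) (w : H3 R).
Local Opaque positive_roots H3_roots sigma.

Definition shiftX s i f : M := X i f + s *: D i f.

Lemma shiftX_is_linear s i : linear (shiftX s i).
Proof.
by move=> a f g; apply: add_lin; [exact: linearP|apply: scale_lin; exact: linearP].
Qed.
HB.instance Definition _ s i :=
  GRing.isLinear.Build R M M *:%R (shiftX s i) (shiftX_is_linear s i).

(** The D_i commute and the commutator of D_i with x_k is symmetric in i and k, so the operators x_i
    + s D_i commute. They are the conjugates of the x_i by the heat operator, which can therefore be
    defined by freeness, with no exponential series. *)
Lemma shiftXC s i k f : shiftX s i (shiftX s k f) = shiftX s k (shiftX s i f).
Proof.
rewrite /shiftX !linearD !linearZ /= !D_X !linearD !linearZ /= ch_mulXC.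
rewrite (corrC k i) [in RHS](eq_sym k i) (dunklC k i).
rewrite -!addrA; congr (_ + _).
exact: addrCA.
Qed.

(* exp(s (D_1^2 + D_2^2 + D_3^2) / 2) *)
Definition heat s : {linear M -> M} := s2val (@ch_ext _ _ _ _ M M (shiftX s) cst (shiftXC s)).

Lemma heat_const s u : heat s (cst u) = cst u.
Proof. by rewrite /heat; case: ch_ext. Qed.
Lemma heat_X s i f : heat s (X i f) = X i (heat s f) + s *: D i (heat s f).
Proof. by rewrite /heat; case: ch_ext. Qed.

Lemma heat_act s w f : heat s (act w f) = act w (heat s f).
Proof.
elim/(@ch_ind _ _ _ _ M): f => [u|i f IH|a f g IHf IHg].
- by rewrite ch_act_const !heat_const ch_act_const.
- rewrite ch_act_mulX linear_sum heat_X linearD linearZ /= ch_act_mulX act_D.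
  rewrite scaler_sumr -big_split; apply: eq_bigr => k _ /=.
  by rewrite linearZ /= heat_X IH scalerDr !scalerA [_ * s]mulrC.
- by rewrite (linearP (act w)) /= !(linearP (heat s)) /= (linearP (act w)) /= IHf IHg.
Qed.

Lemma heat_corr s i k f : heat s (corr i k f) = corr i k (heat s f).
Proof.
rewrite /corr linear_sum; apply: eq_bigr => v _.
by rewrite linearZ /= heat_act.
Qed.

Lemma heat_D s i f : heat s (D i f) = D i (heat s f).
Proof.
elim/(@ch_ind _ _ _ _ M): f => [u|k f IH|a f g IHf IHg].
- by rewrite heat_const ch_dunkl_const linear0.
- rewrite D_X !linearD !linearZ /= !heat_X heat_corr IH linearD linearZ /= D_X.
  rewrite (dunklC k i) -!addrA; congr (_ + _).
  by rewrite [in LHS]addrC -!addrA.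
- by rewrite (linearP (D i)) /= !(linearP (heat s)) /= (linearP (D i)) /= IHf IHg.
Qed.

Lemma heatK s : cancel (heat s) (heat (- s)).
Proof.
move=> f; elim/(@ch_ind _ _ _ _ M): f => [u|k f IH|a f g IHf IHg].
- by rewrite !heat_const.
- rewrite heat_X linearD linearZ /= heat_X IH heat_D IH.
  by rewrite scaleNr subrK.
- by rewrite (linearP (heat s)) /= (linearP (heat (- s))) /= IHf IHg.
Qed.

Lemma heat_Omega s f : heat s (Omega f) = Omega (heat s f).
Proof.
by rewrite /Omega linear_sum; apply: eq_bigr => v _; rewrite /= heat_act.
Qed.

(** Letting every variable act as zero turns the extension property into the constant-term map. *)
Definition ctT (i : 'I_3) : {linear 'cV[R]_n -> 'cV[R]_n} := \0.
Definition ctC : {linear 'cV[R]_n -> 'cV[R]_n} := idfun.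
Lemma ctTC i k z : ctT i (ctT k z) = ctT k (ctT i z).
Proof. by []. Qed.

Definition ct : {linear M -> 'cV[R]_n} := s2val (@ch_ext _ _ _ _ M _ ctT ctC ctTC).
Lemma ct_const u : ct (cst u) = u.
Proof. by rewrite /ct; case: ch_ext. Qed.
Lemma ct_X i f : ct (X i f) = 0.
Proof. by rewrite /ct; case: ch_ext. Qed.

Lemma ct_act w f : ct (act w f) = tau w *m ct f.
Proof.
elim/(@ch_ind _ _ _ _ M): f => [u|i f IH|a f g IHf IHg].
- by rewrite ch_act_const !ct_const.
- rewrite ch_act_mulX linear_sum ct_X mulmx0 big1 // => k _.
  by rewrite linearZ /= ct_X scaler0.
- by rewrite (linearP (act w)) /= !(linearP ct) /= IHf IHg mulmxDr -scalemxAr.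
Qed.

Section Contravariant.
Variable G : 'M[R]_n.

(** The form is built as a map from M to functions on M. Letting x_i act there as the transpose of
    D_i makes adjointness in the first argument hold by construction. *)
Definition dualD (i : 'I_3) (F : M -> R^o) : M -> R^o := fun g => F (D i g).
Lemma dualD_is_linear i : linear (dualD i).
Proof. by move=> a F H; apply/funext. Qed.
HB.instance Definition _ i :=
  GRing.isLinear.Build R (M -> R^o) (M -> R^o) *:%R (dualD i) (dualD_is_linear i).
Lemma dualDC i k F : dualD i (dualD k F) = dualD k (dualD i F).
Proof. by apply/funext => g; rewrite /dualD dunklC. Qed.

Definition dual_const u : M -> R^o := fun g => (u^T *m G *m ct g) 0 0.
Lemma dual_const_is_linear : linear dual_const.
Proof.
move=> a u v; apply/funext => g; rewrite /dual_const linearD linearZ /=.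
by rewrite !mulmxDl -!scalemxAl mxE [X in X + _]mxE.
Qed.
HB.instance Definition _ :=
  GRing.isLinear.Build R 'cV[R]_n (M -> R^o) *:%R dual_const dual_const_is_linear.

Definition cform : M -> M -> R := s2val (@ch_ext _ _ _ _ M _ dualD dual_const dualDC).

Lemma cform_const u g : cform (cst u) g = (u^T *m G *m ct g) 0 0.
Proof. by rewrite /cform; case: ch_ext => F /= ->. Qed.
Lemma cform_X i f g : cform (X i f) g = cform f (D i g).
Proof. by rewrite /cform; case: ch_ext => F /= _ ->. Qed.
Lemma cform_linl a f h g : cform (a *: f + h) g = a * cform f g + cform h g.
Proof. by rewrite /cform; case: ch_ext => F /= _ _; rewrite linearP. Qed.

Lemma cform_linr f : scalar (cform f).
Proof.
move=> a g h; elim/(@ch_ind _ _ _ _ M): f g h => [u|i f IH|b f f' IHf IHg] g h.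
- by rewrite !cform_const linearP /= mulmxDr -scalemxAr mxE [X in X + _]mxE.
- by rewrite !cform_X linearP IH.
- by rewrite !cform_linl IHf IHg; ring.
Qed.
HB.instance Definition _ f :=
  GRing.isLinear.Build R M R *%R (cform f) (cform_linr f).

Lemma cform0l g : cform 0 g = 0.
Proof. by have := cform_linl (-1) 0 0 g; rewrite scaler0 addr0 mulN1r addNr. Qed.

Lemma cform_suml (I : Type) (r : seq I) (F : I -> M) g :
  cform (\sum_(i <- r) F i) g = \sum_(i <- r) cform (F i) g.
Proof.
elim: r => [|i r IH]; first by rewrite !big_nil cform0l.
by rewrite !big_cons -[F i]scale1r cform_linl scale1r mul1r IH.
Qed.

Lemma cform_Zl a f g : cform (a *: f) g = a * cform f g.
Proof.
by rewrite -[a *: f]addr0 cform_linl cform0l addr0.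
Qed.

Hypothesis Ginv : forall w, (tau w)^T *m G *m tau w = G.
Hypothesis Gsym : G^T = G.

Lemma cform_act w f g : cform (act w f) (act w g) = cform f g.
Proof.
elim/(@ch_ind _ _ _ _ M): f g => [u|i f IH|a f h IHf IHh] g.
- rewrite ch_act_const !cform_const ct_act trmx_mul -!mulmxA.
  by rewrite [_^T *m (G *m _)]mulmxA [_^T *m G *m _]mulmxA Ginv.
- rewrite ch_act_mulX cform_suml cform_X -IH act_D linear_sum.
  by apply: eq_bigr => k _; rewrite cform_Zl cform_X linearZ.
- by rewrite (linearP (act w)) /= !cform_linl IHf IHh.
Qed.

Lemma cform_sigma v f g : v \in H3_roots R ->
  cform (act (sigma v) f) g = cform f (act (sigma v) g).
Proof. by move=> vR; rewrite -(cform_act (sigma v)) -chactM sigma_inv // chact1. Qed.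

Lemma cform_corr i k f g : cform (corr i k f) g = cform f (corr i k g).
Proof.
rewrite /corr cform_suml linear_sum; apply: eq_big_seq => v /pos_roots_sub vR.
by rewrite cform_Zl linearZ /= cform_sigma.
Qed.

Lemma cform_Omega f g : cform (Omega f) g = cform f (Omega g).
Proof.
rewrite /Omega cform_suml linear_sum; apply: eq_big_seq => v /pos_roots_sub vR.
by rewrite cform_sigma.
Qed.

(** Adjointness on the other side is not built in. For g = x_k g' both sides are expanded by the
    commutation relation; the correction terms agree because [corr] is self-adjoint and symmetric in
    its indices. *)
Lemma cform_Xr i f g : cform g (X i f) = cform (D i g) f.
Proof.
elim/(@ch_ind _ _ _ _ M): g f => [u|k g IH|a g h IHg IHh] f.
- by rewrite cform_const ct_X mulmx0 mxE ch_dunkl_const cform0l.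
- rewrite cform_X !D_X -[_ + _ + _ in RHS]addrA -[X k _]scale1r.
  rewrite cform_linl mul1r cform_X -IH -addrA cform_linl cform_Zl cform_corr.
  by rewrite !linearD !linearZ /= [k == i]eq_sym corrC.
- by rewrite (linearP (D i)) /= !cform_linl IHg IHh.
Qed.

Lemma cformC f g : cform f g = cform g f.
Proof.
elim/(@ch_ind _ _ _ _ M): f g => [u|k f IH|a f h IHf IHh] g.
- elim/(@ch_ind _ _ _ _ M): g => [v|k g IH|a g h IHg IHh].
  + rewrite !cform_const !ct_const -[in RHS]Gsym.
    have -> (A : 'M[R]_1) : A 0 0 = A^T 0 0 by rewrite mxE.
    by rewrite !trmx_mul trmxK mulmxA.
  + by rewrite cform_Xr ch_dunkl_const cform0l cform_X ch_dunkl_const linear0.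
  + by rewrite linearP /= cform_linl IHg IHh.
- by rewrite cform_X IH cform_Xr.
- by rewrite cform_linl linearP /= IHf IHh.
Qed.

Lemma cform_orth d e f g : d != e -> hmg d f -> hmg e g -> cform f g = 0.
Proof.
move=> de hf; move: d f hf e g de.
apply: ch_hind => [u|d i f hf IH|d a f f' _ _ IHf IHf'] [|e] g //.
- move=> _ hg; rewrite cformC; move: (e.+1) g hg (ltn0Sn e).
  apply: ch_hind => // [d i g hg _ _|d a g g' _ _ IHg IHg' d0].
    by rewrite cform_X ch_dunkl_const linear0.
  by rewrite cform_linl IHg // IHg' // mulr0 addr0.
- by move=> _ hg; rewrite cform_X D_homog0 // linear0.
- by rewrite eqSS => de hg; rewrite cform_X (IH e) //; exact: D_homog.
- by move=> de hg; rewrite cform_linl (IHf 0%N) // (IHf' 0%N) // mulr0 addr0.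
- by move=> de hg; rewrite cform_linl (IHf e.+1) // (IHf' e.+1) // mulr0 addr0.
Qed.

Hypothesis Gpos : forall u, u != 0 -> 0 < (u^T *m G *m u) 0 0.
Variable gam : R.
Hypothesis tau_gam : \sum_(v <- positive_roots R) tau (sigma v) = gam%:M.

Definition posdef_degree d := forall f, hmg d f -> f != 0 -> 0 < cform f f.

(* The operator [\sum_i X i (D i f)] is the scalar d + kappa (gam - c) on the
   summand H c; [S] bounds the set of eigenvalues that occur. *)
Definition Omega_spectrum (d : nat) (spec : seq R) (S : pred R) :=
  forall f, hmg d f -> exists H : R -> M,
    [/\ f = \sum_(c <- spec) H c, forall c, hmg d (H c),
        forall c, Omega (H c) = c *: H c & forall c, ~~ S c -> H c = 0].

Lemma euler_eigen d c f : hmg d f -> Omega f = c *: f ->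
  \sum_i X i (D i f) = (d%:R + kappa * (gam - c)) *: f.
Proof.
move=> hf e; rewrite (euler_dunkl tau_gam hf) e scalerA -scalerBl.
by congr (_ *: _); ring.
Qed.

Lemma cform_euler d c f : hmg d f -> Omega f = c *: f ->
  (d%:R + kappa * (gam - c)) * cform f f = \sum_i cform (D i f) (D i f).
Proof.
move=> hf e; rewrite -cform_Zl -(euler_eigen hf e) cform_suml.
by apply: eq_bigr => i _; rewrite cform_X.
Qed.

Lemma posdef_degree_ge0 d f : posdef_degree d -> hmg d f -> 0 <= cform f f.
Proof.
move=> pd hf; have [->|f0] := eqVneq f 0; first by rewrite cform0l.
by rewrite ltW // pd.
Qed.

Lemma posdef_degree0 : posdef_degree 0.
Proof.
move=> _ /homog0_const[u ->] u0; rewrite cform_const ct_const Gpos //.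
by apply: contraNneq u0 => ->; rewrite linear0.
Qed.

(** Omega is self-adjoint, so its eigencomponents are orthogonal and can be treated one at a time.
    If (H c, H c) were 0, every D_i (H c) would vanish, hence also the Euler operator on [H c],
    although its eigenvalue is positive. *)
Lemma posdef_degreeS d spec S : uniq spec ->
  Omega_spectrum d.+1 spec S ->
  (forall c, S c -> 0 < d.+1%:R + kappa * (gam - c)) ->
  posdef_degree d -> posdef_degree d.+1.
Proof.
move=> us dec pos pd f hf f0; have [H [ef hH eH zH]] := dec f hf.
have orthH c c' : c != c' -> cform (H c) (H c') = 0.
  move=> cc; have /eqP : c * cform (H c) (H c') = c' * cform (H c) (H c').
    by rewrite -cform_Zl -eH cform_Omega eH linearZ.
  by rewrite -subr_eq0 -mulrBl mulf_eq0 subr_eq0 (negPf cc) /= => /eqP.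
have ge0H c : 0 <= \sum_i cform (D i (H c)) (D i (H c)).
  by apply: sumr_ge0 => i _; apply: posdef_degree_ge0 pd _; exact: D_homog.
have posH c : H c != 0 -> 0 < cform (H c) (H c).
  move=> Hc0; have Sc : S c by apply: contraNT Hc0 => /zH ->.
  have l0 := pos c Sc; have e := cform_euler (hH c) (eH c).
  have : 0 <= cform (H c) (H c) by rewrite -(pmulr_rge0 _ l0) e.
  rewrite le_eqVlt => /orP[/eqP c0|//].
  move: e; rewrite -c0 mulr0 => /esym/eqP; rewrite psumr_eq0; last first.
    by move=> i _; apply: posdef_degree_ge0 pd _; exact: D_homog.
  move=> /allP h; have D0 i : D i (H c) = 0.
    have := h i; rewrite mem_index_enum => /(_ isT) h0.
    apply: contraTeq h0 => Dn0; rewrite gt_eqF // pd //; exact: D_homog.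
  have := euler_eigen (hH c) (eH c); rewrite big1 => [/esym/eqP|i _].
    by rewrite scaler_eq0 (negPf Hc0) orbF gt_eqF.
  by rewrite D0 linear0.
have -> : cform f f = \sum_(c <- spec) cform (H c) (H c).
  rewrite {1}ef cform_suml; apply: eq_big_seq => c cs.
  rewrite ef linear_sum (bigD1_seq c) //= big1 ?addr0 // => c' cc.
  by rewrite orthH // eq_sym.
have geH c : 0 <= cform (H c) (H c).
  by have [->|/posH/ltW//] := eqVneq (H c) 0; rewrite cform0l.
rewrite lt_neqAle sumr_ge0 // andbT eq_sym; apply: contraNneq f0 => /eqP.
rewrite psumr_eq0 // => /allP h; rewrite ef big1_seq // => c /andP[_ /h /=].
by apply: contraTeq => /posH; exact: lt0r_neq0.
Qed.

Lemma dunkl_kernel_eigen d c f : hmg d.+1 f -> Omega f = c *: f ->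
  d.+1%:R + kappa * (gam - c) = 0 -> posdef_degree d -> forall i, D i f = 0.
Proof.
move=> hf e l0 pd i.
have /esym/eqP := cform_euler hf e; rewrite l0 mul0r psumr_eq0; last first.
  by move=> k _; apply: posdef_degree_ge0 pd _; exact: D_homog.
move=> /allP/(_ i); rewrite mem_index_enum => /(_ isT) h0.
apply: contraTeq h0 => Dn0; rewrite gt_eqF // pd //; exact: D_homog.
Qed.

Lemma cform_posdef : (forall d, posdef_degree d) -> forall f, f != 0 -> 0 < cform f f.
Proof.
move=> pd f f0; have [N ef] := ch_compE f.
have -> : cform f f = \sum_(d < N) cform (chp M d f) (chp M d f).
  rewrite {1}ef cform_suml; apply: eq_bigr => d _.
  rewrite {2}ef linear_sum (bigD1 d) //= big1 ?addr0 // => e ed.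
  by apply: (@cform_orth d e); rewrite 1?eq_sym //; exact: ch_comp_homog.
have ge d : 0 <= cform (chp M d f) (chp M d f).
  by apply: posdef_degree_ge0 (pd d) _; exact: ch_comp_homog.
rewrite lt_neqAle sumr_ge0 // andbT eq_sym; apply: contraNneq f0 => /eqP.
rewrite psumr_eq0 // => /allP h; rewrite ef big1 // => d _.
have := h d; rewrite mem_index_enum => /(_ isT).
by apply: contraTeq => d0; rewrite gt_eqF // (pd d) //; exact: ch_comp_homog.
Qed.

End Contravariant.

Definition gauss_axioms (G : 'M[R]_n) (B : M -> M -> R) :=
  [/\ (forall f g, B f g = B g f) /\ (forall f, scalar (B f)),
      forall w f g, B (act w f) (act w g) = B f g,
      forall i f g, B (D i f) g = B f (X i g - D i g)
    & forall u u', B (cst u) (cst u') = (u^T *m G *m u') 0 0].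

Section Gauss.
Variable G : 'M[R]_n.
Hypothesis Ginv : forall w, (tau w)^T *m G *m tau w = G.
Hypothesis Gsym : G^T = G.

Definition gform f g := cform G (heat 1 f) (heat 1 g).

Lemma gform_axioms : gauss_axioms G gform.
Proof.
split.
- split=> [f g|f a g h]; first exact: cformC.
  by rewrite /gform linearP /= linearP.
- by move=> w f g; rewrite /gform !heat_act cform_act.
(* [heat 1] carries x_i - D_i to x_i, which reduces the Gaussian relation to contravariance. *)
- move=> i f g; rewrite /gform heat_D -cform_Xr //; congr cform.
  by rewrite linearB /= heat_X heat_D scale1r addrK.
- by move=> u u'; rewrite /gform !heat_const cform_const ct_const.
Qed.

Lemma gform_posdef : (forall f, f != 0 -> 0 < cform G f f) ->
  forall f, f != 0 -> 0 < gform f f.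
Proof.
move=> pos f f0; apply: pos; apply: contraNneq f0 => e.
by rewrite -(heatK 1 f) e linear0.
Qed.

Section Uniqueness.
Variable B : M -> M -> R.
Hypothesis HB : gauss_axioms G B.

Let Bsym f g : B f g = B g f. Proof. by case: HB => -[]. Qed.
Let Blin f : scalar (B f). Proof. by case: HB => -[]. Qed.
Let BD i f g : B (D i f) g = B f (X i g - D i g). Proof. by case: HB. Qed.
Let Bact w f g : B (act w f) (act w g) = B f g. Proof. by case: HB. Qed.
Let Bconst u u' : B (cst u) (cst u') = (u^T *m G *m u') 0 0. Proof. by case: HB. Qed.

HB.instance Definition _ f := GRing.isLinear.Build R M R *%R (B f) (Blin f).

Lemma gauss_adj i f g : B (heat (- 1) (X i f)) g = B (heat (- 1) f) (D i g).
Proof. by rewrite heat_X scaleN1r Bsym -BD Bsym. Qed.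

(** The adjunction [gauss_adj] strips the variables off [f], and once [f] is constant off
    [heat 1 g], until only the prescribed values on constants are left. *)
Lemma gauss_unique f g : B (heat (- 1) f) g =
  cform G f (heat 1 g).
Proof.
elim/(@ch_ind _ _ _ _ M): f g => [u|i f IH|a f h IHf IHh] g.
- have : g = heat (- 1) (heat 1 g) by rewrite heatK.
  move: (heat 1 g) => g' ->; rewrite heat_const cform_const.
  elim/(@ch_ind _ _ _ _ M): g' => [v|k g' IH|a g' h IHg IHh].
  + by rewrite heat_const Bconst ct_const.
  + by rewrite Bsym gauss_adj ch_dunkl_const linear0 ct_X mulmx0 mxE.
  + rewrite (linearP (heat _)) /= (linearP (B _)) /= IHg IHh (linearP ct) /=.
    by rewrite mulmxDr -scalemxAr [RHS]mxE [X in _ = X + _]mxE.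
- by rewrite gauss_adj IH cform_X heat_D.
- rewrite (linearP (heat _)) /= Bsym (linearP (B _)) /= ![B g _]Bsym IHf IHh.
  by rewrite cform_linl.
Qed.

Lemma gauss_eq_gform f g : B f g = gform f g.
Proof. by rewrite /gform -gauss_unique heatK. Qed.

Variable gam : R.
Hypothesis tau_gam : \sum_(v <- positive_roots R) tau (sigma v) = gam%:M.
Hypothesis Bpos : forall f, f != 0 -> 0 < B f f.

(* If the eigenvalue d + kappa (gam - c) of \sum_i (X i - D i) (D i) at
   [heat (-1) p] vanishes, then [heat (-1) p] is orthogonal to the constants and
   to the ranges of all X i - D i. *)
Lemma gauss_posdef_eigen d c p : hmg d.+1 p -> p != 0 -> Omega p = c *: p ->
  0 < d.+1%:R + kappa * (gam - c).
Proof.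
move=> hp p0 ep; set lam := _ + _; pose q := heat (- 1) p.
have q0 : q != 0.
  by apply: contraNneq p0 => e; rewrite -[p](heatK (- 1)) -/q e linear0.
have ge i f : 0 <= B (D i f) (D i f).
  by have [->|/Bpos/ltW//] := eqVneq (D i f) 0; rewrite linear0.
have e : lam * B q q = \sum_i B (D i q) (D i q).
  transitivity (B q (heat (- 1) (\sum_i X i (D i p)))).
    by rewrite (euler_eigen tau_gam hp ep) linearZ /= linearZ.
  rewrite linear_sum linear_sum; apply: eq_bigr => i _ /=.
  by rewrite Bsym gauss_adj heat_D.
have : 0 <= lam by rewrite -(pmulr_lge0 _ (Bpos q0)) e sumr_ge0.
rewrite le_eqVlt => /orP[/eqP l0|//]; exfalso.
move: e; rewrite -l0 mul0r => /esym/eqP; rewrite psumr_eq0 // => /allP h.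
have Dq i : D i q = 0.
  have := h i; rewrite mem_index_enum => /(_ isT).
  by apply: contraTeq => /Bpos; exact: lt0r_neq0.
(* Omega acts on constants by [gam]. In positive degree a vanishing Euler eigenvalue forces [c] to
   differ from it, so that [q] is orthogonal to the constants. *)
have cg : c != gam.
  apply/eqP => cg; move/eqP: l0.
  by rewrite /lam cg subrr mulr0 addr0 eq_sym pnatr_eq0.
have BO f g : B (Omega f) g = B f (Omega g).
  rewrite Bsym /Omega !linear_sum; apply: eq_big_seq => v /pos_roots_sub vR /=.
  by rewrite Bsym -(Bact (sigma v)) -chactM sigma_inv // chact1.
have orth f : B q (heat (- 1) f) = 0.
  elim/(@ch_ind _ _ _ _ M): f => [u|i f IH|a f g IHf IHg].
  - rewrite heat_const; apply/eqP.
    have : c * B q (cst u) = gam * B q (cst u).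
      transitivity (B (Omega q) (cst u)).
        by rewrite -heat_Omega ep linearZ /= [RHS]Bsym linearZ /= [in LHS]Bsym.
      rewrite BO (_ : Omega _ = gam *: cst u) ?linearZ //.
      rewrite /Omega; under eq_bigr => v _ do rewrite ch_act_const.
      by rewrite -linear_sum -mulmx_suml tau_gam mul_scalar_mx linearZ.
    move=> /eqP; rewrite -subr_eq0 -mulrBl mulf_eq0 subr_eq0 (negPf cg).
    by [].
  - by rewrite Bsym gauss_adj Dq linear0.
  - by rewrite (linearP (heat _)) /= (linearP (B _)) /= IHf IHg mulr0 addr0.
by have := Bpos q0; rewrite {2}/q orth ltxx.
Qed.

End Uniqueness.
End Gauss.

(** No form is involved. As D_i lowers the degree by one, each homogeneous component of [f] is
    killed by all D_i, hence by the Euler operator, which is injective in positive degree. *)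
Lemma dunkl_kernel_const gam spec (S : nat -> pred R) :
  \sum_(v <- positive_roots R) tau (sigma v) = gam%:M -> uniq spec ->
  (forall d, Omega_spectrum d.+1 spec (S d.+1)) ->
  (forall d c, S d.+1 c -> d.+1%:R + kappa * (gam - c) != 0) ->
  forall f, (forall i, D i f = 0) -> exists u, f = cst u.
Proof.
move=> tg us dec nz f Df.
have Dp d i : D i (chp M d.+1 f) = chp M d (D i f).
  have [N ef] := ch_compE f.
  have key e : e != d.+1 -> chp M d (D i (chp M e f)) = 0.
    case: e => [|e] ed; first by rewrite D_homog0 ?linear0 //; exact: ch_comp_homog.
    apply: (@ch_comp_ne _ _ _ _ M d e); last exact/D_homog/ch_comp_homog.
    by rewrite eq_sym -eqSS.
  rewrite {2}ef 2!linear_sum /=.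
  have [dN|Nd] := ltnP d.+1 N.
    rewrite (bigD1 (Ordinal dN)) //= big1 => [|e ed]; last exact: key.
    by rewrite addr0 [RHS]ch_comp_id //; exact/D_homog/ch_comp_homog.
  rewrite big1 => [|e _]; last by apply: key; rewrite neq_ltn (leq_trans (ltn_ord e)).
  rewrite ef linear_sum big1 ?linear0 // => e _ /=.
  apply: (@ch_comp_ne _ _ _ _ M d.+1 e); last exact: ch_comp_homog.
  by rewrite neq_ltn (leq_trans (ltn_ord e)) ?orbT.
have p0 d : chp M d.+1 f = 0.
  have hp := ch_comp_homog d.+1 f; set p := chp M d.+1 f in hp *.
  have [H [ep hH eH zH]] := dec d p hp.
  have e0 : \sum_(c <- spec) (d.+1%:R + kappa * (gam - c)) *: H c = 0.
    transitivity (\sum_i X i (D i p)); last first.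
      by rewrite big1 // => i _; rewrite /p Dp Df !linear0.
    under [RHS]eq_bigr => i _ do rewrite ep 2!linear_sum.
    rewrite exchange_big; apply: eq_bigr => c _ /=.
    by rewrite (euler_eigen tg (hH c) (eH c)).
  suff H0 : forall c, c \in spec -> H c = 0 by rewrite ep big1_seq // => c /andP[_ /H0].
  (* Eigenvectors for distinct eigenvalues are independent: applying Omega - c to a relation removes
     the summand at c. *)
  suff ind s : uniq s -> forall a : R -> R,
      \sum_(c <- s) a c *: H c = 0 -> forall c, c \in s -> a c *: H c = 0.
    move=> c cs; have /eqP := ind _ us _ e0 c cs; rewrite scaler_eq0.
    case/orP=> [|/eqP//]; case: (boolP (S d.+1 c)) => [Sc|/zH//].
    by rewrite (negPf (nz _ _ Sc)).
  elim: s => // c s IH /= /andP[cs us'] a; rewrite big_cons => e.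
  have e' : \sum_(c' <- s) (a c' * (c' - c)) *: H c' = 0.
    pose Y := a c *: H c + \sum_(c' <- s) a c' *: H c'.
    transitivity (Omega Y - c *: Y); last by rewrite /Y e linear0 scaler0 subr0.
    rewrite /Y linearD linearZ /= eH linear_sum scalerDr scaler_sumr.
    rewrite opprD addrACA !scalerA [a c * c]mulrC subrr add0r -sumrB.
    apply: eq_bigr => c' _; rewrite linearZ /= eH !scalerA -scalerBl.
    by congr (_ *: _); ring.
  have z c' : c' \in s -> a c' *: H c' = 0.
    move=> c's; have /eqP := IH us' _ e' c' c's; rewrite mulrC -scalerA scaler_eq0.
    rewrite subr_eq0; case: eqP => [cc|_ /eqP//].
    by rewrite cc in c's; rewrite c's in cs.
  move=> c'; rewrite inE => /orP[/eqP->|/z//].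
  by move: e; rewrite big1_seq ?addr0 // => c'' /andP[_ /z].
have [N ef] := ch_compE f; have [u0 eu] := homog0_const (ch_comp_homog 0 f).
case: N ef => [|N] ef.
  by exists 0; rewrite linear0 ef big_ord0.
exists u0; rewrite ef big_ord_recl /= eu big1 => [|i _]; first by rewrite addr0.
by rewrite /bump leq0n p0.
Qed.

End Forms.

(** * Characters of H3, computed in Z[phi] *)

Module H3Codes.
Import ZPhi.

(* An element [w] of H3 is coded by the rows of the matrix 2 w, whose entries
   lie in Z[phi]. *)
Definition mat := (v3 * v3 * v3)%type.
Definition vadd (x y : v3) : v3 :=
  (add x.1.1 y.1.1, add x.1.2 y.1.2, add x.2 y.2).
Definition vmulm (x : v3) (B : mat) : v3 :=
  vadd (scale x.1.1 B.1.1) (vadd (scale x.1.2 B.1.2) (scale x.2 B.2)).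
Definition mmul (A B : mat) : mat := (vmulm A.1.1 B, vmulm A.1.2 B, vmulm A.2 B).
(** Odd numbers are truncated. Exactness where it matters is checked by doubling back in
    [elements_step], [elements_tr] and [chi8_neg]. *)
Definition halfz (z : int) : int :=
  match z with Posz n => Posz n./2 | Negz n => - Posz (n.+1)./2 end.
Definition halft (x : t) : t := (halfz x.1, halfz x.2).
Definition halfv (x : v3) : v3 := (halft x.1.1, halft x.1.2, halft x.2).
Definition mhalf (A : mat) : mat := (halfv A.1.1, halfv A.1.2, halfv A.2).
Definition mdbl (A : mat) : mat := (scale two A.1.1, scale two A.1.2, scale two A.2).
Definition mone : mat :=
  ((two, (0, 0), (0, 0)), ((0, 0), two, (0, 0)), ((0, 0), (0, 0), two)).
Definition mneg : mat :=
  (scale (-1 : int, 0 : int) mone.1.1, scale (-1 : int, 0 : int) mone.1.2,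
   scale (-1 : int, 0 : int) mone.2).
(** Since <v, v> = 4, twice the reflection is 2 - v^T v. *)
Definition mrefl (v : v3) : mat :=
  (sub mone.1.1 (scale v.1.1 v), sub mone.1.2 (scale v.1.2 v), sub mone.2 (scale v.2 v)).

Definition step (A : mat) (v : v3) : mat := mhalf (mmul A (mrefl v)).
Definition extend (s : seq mat) : seq mat :=
  undup (s ++ [seq step A v | A <- s, v <- roots]).

(** In a reflection group of rank 3 every element is a product of at most three reflections, so
    three rounds suffice; [elements_step] confirms closure. The list is stored in normal form for
    the computations below. *)
Definition elements : seq mat :=
  Eval vm_compute in extend (extend (extend [:: mone])).

Lemma elementsE : elements = extend (extend (extend [:: mone])).
Proof. by vm_compute. Qed.

Lemma elements_step : all (fun A => all (fun v =>
  (mdbl (step A v) == mmul A (mrefl v)) && (step A v \in elements)) roots) elements.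
Proof. by vm_compute. Qed.

(** Galois conjugation, phi to 1 - phi. *)
Definition conj (x : t) : t := (x.1 + x.2, - x.2).
Definition tr2 (A : mat) : t := add A.1.1.1.1 (add A.1.2.1.2 A.2.2).
Definition tr (A : mat) : t := halft (tr2 A).
Definition det8 (A : mat) : t :=
  let: ((a, b, c), (d, e, f), (g, h, i)) := A in
  add (mul a (add (mul e i) (opp (mul f h))))
  (add (opp (mul b (add (mul d i) (opp (mul f g)))))
       (mul c (add (mul d h) (opp (mul e g))))).
Definition eps (A : mat) : t := if det8 A == (8, 0) then (1, 0) else (-1, 0).

Lemma elements_tr : all (fun A => (mul two (tr A) == tr2 A) &&
  (mul (8 : int, 0 : int) (eps A) == det8 A)) elements.
Proof. by vm_compute. Qed.

(* T9 comes from T3 (x) T3 = T1 + T4 + T9, where T4 is the exterior square, and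
   T7 from T3 (x) T5 = T7 + T9. *)
Definition chi (i : label) (A : mat) : t :=
  let s := tr A in let e := eps A in
  let c9 := add (mul s s) (opp (add (1, 0) (mul e s))) in
  let c7 := add (mul s (conj s)) (opp c9) in
  match i with
  | T1 => (1, 0) | T2 => e
  | T3 => s | T4 => mul e s
  | T5 => conj s | T6 => mul e (conj s)
  | T7 => c7 | T8 => mul e c7
  | T9 => c9 | T10 => mul e c9
  end.

Definition labels : seq label := [:: T1; T2; T3; T4; T5; T6; T7; T8; T9; T10].

(** The value 15 chi(sigma) / chi(1) of the sum of the 15 reflections. *)
Definition gam (i : label) : int :=
  match i with
  | T1 => 15 | T2 => -15 | T3 | T5 => 5 | T4 | T6 => -5 | T7 | T8 => 0
  | T9 => 3 | T10 => -3
  end.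

Definition sumt (s : seq t) : t := foldr add (0, 0) s.

(** The decomposition of the regular character. It gives a resolution of the identity in every
    representation; see [proj_sum] and [isoproj_sum]. *)
Lemma chi_regular : all (fun A => sumt [seq mul (irrep_dim i : int, 0 : int) (chi i A)
  | i <- labels] == (if A == mone then (120, 0) else (0, 0))) elements.
Proof. by vm_compute. Qed.

(** The factor 2 appears because v and -v give the same reflection. The identity makes the sum of
    the reflections act as [gam i] on the image of the operator defined by [chi i]. *)
Lemma chi_roots : all (fun i => all (fun A => sumt [seq chi i (step A v) | v <- roots] ==
  mul (gam i * 2, 0) (chi i A)) elements) labels.
Proof. by vm_compute. Qed.

Lemma chi_norm : all (fun i => sumt [seq mul (chi i A) (chi i A) | A <- elements] ==
  (120, 0)) labels.
Proof. by vm_compute. Qed.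

Lemma chi8_neg : all (fun A => (mhalf (mmul mneg A) \in elements) &&
  (mdbl (mhalf (mmul mneg A)) == mmul mneg A) &&
  (chi T8 (mhalf (mmul mneg A)) == opp (chi T8 A))) elements.
Proof. by vm_compute. Qed.

Lemma roots_transitive : all (fun v => has (fun A =>
  vmulm (two, (0, 0), (0, 0)) A == scale two v) elements) roots.
Proof. by vm_compute. Qed.

Definition expt (x : t) (n : nat) : t := iter n (mul x) (1, 0).
(* 120 times the multiplicity of [j] in (R^3)^{(x) n} (x) [i]. *)
Definition tensor_mult (n : nat) (i j : label) : t :=
  sumt [seq mul (chi j A) (mul (chi i A) (expt (tr A) n)) | A <- elements].
(* If this is nonzero, then [j] occurs in the submodule of P (x) [i] generated
   by x_1^n (x) [i]; the entry A.1.1.1.1 is 2 w_00. *)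
Definition zonal_mult (n : nat) (i j : label) : t :=
  sumt [seq mul (chi j A) (mul (chi i A) (expt A.1.1.1.1 n)) | A <- elements].

End H3Codes.

Section CodedElements.
Variable R : realType.
Import H3Codes.
Notation ev := (@ZPhi.ev R).
Notation evv := (@ZPhi.evv R).
Implicit Types (A B : mat) (w : H3 R).
Local Opaque elements ZPhi.roots.

Definition evm A : 'M[R]_3 := \matrix_(i < 3) (2^-1 *: evv (nth A.1.1 [:: A.1.1; A.1.2; A.2] i)).

Lemma ev0 : ev (0, 0) = 0. Proof. by rewrite /ZPhi.ev /=; ring. Qed.
Lemma ev1 : ev (1, 0) = 1. Proof. by rewrite /ZPhi.ev /=; ring. Qed.
Lemma evN1 : ev (-1, 0) = -1. Proof. by rewrite /ZPhi.ev /= rmorphN1; ring. Qed.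
Lemma ev_int (z : int) : ev (z, 0) = z%:~R. Proof. by rewrite /ZPhi.ev /=; ring. Qed.
Lemma ev_two : ev ZPhi.two = 2. Proof. exact: ev_int. Qed.

Lemma ev_inj : injective ev.
Proof.
move=> a b e; have : ZPhi.ev R (ZPhi.add a (ZPhi.opp b)) = 0.
  by rewrite ZPhi.ev_add ZPhi.ev_opp e subrr.
by move/ev_eq0; case: a b {e} => [? ?] [? ?] [/eqP + /eqP];
  rewrite !subr_eq0 => /eqP-> /eqP->.
Qed.

Lemma two_neq0 : (2 : R) != 0. Proof. by rewrite pnatr_eq0. Qed.

Lemma evm_inj : injective evm.
Proof.
move=> [[a b] c] [[a' b'] c'] /row_matrixP e.
have half u v : 2^-1 *: evv u = 2^-1 *: evv v -> u = v.
  by move/(scalerI (invr_neq0 two_neq0))/evv_inj.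
have := e 0; have := e 1; have := e 2%:R; rewrite !rowK /=.
by move=> /half -> /half -> /half ->.
Qed.

Lemma evv_add x y : evv (vadd x y) = evv x + evv y.
Proof.
by apply/rowP => i; rewrite !mxE; case: (ord3P i) => -> /=; rewrite ZPhi.ev_add.
Qed.

Lemma row_mul3 (x : 'rV[R]_3) (B : 'M[R]_3) :
  x *m B = x 0 0 *: row 0 B + (x 0 1 *: row 1 B + x 0 2%:R *: row 2%:R B).
Proof.
apply/rowP => j; rewrite !mxE !big_ord_recl big_ord0 addr0.
by congr (_ * _ + (x _ _ * B _ _ + x _ _ * B _ _)); apply/val_inj.
Qed.

Lemma evv_mulm x B : evv x *m evm B = 2^-1 *: evv (vmulm x B).
Proof.
rewrite row_mul3 !rowK /= /vmulm !evv_add !ZPhi.evv_scale !mxE /= !scalerDr.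
by rewrite !scalerA ![2^-1 * _]mulrC.
Qed.

Lemma evm_mul A B C : mdbl C = mmul A B -> evm A *m evm B = evm C.
Proof.
move=> e; apply/row_matrixP => i; rewrite row_mul !rowK -scalemxAl evv_mulm.
congr (_ *: _); apply: (scalerI two_neq0); rewrite scalerA divff ?two_neq0 // scale1r.
rewrite -ev_two -ZPhi.evv_scale; congr evv.
case: (ord3P i) => ->; [exact: (congr1 (fun X : mat => X.1.1) (esym e))
  |exact: (congr1 (fun X : mat => X.1.2) (esym e))|exact: (congr1 (fun X : mat => X.2) (esym e))].
Qed.

Lemma evm_one : evm mone = 1.
Proof.
apply/matrixP => i j; rewrite !mxE.
by case: (ord3P i) => ->; case: (ord3P j) => -> /=;
  rewrite ?ev0 ?ev_two ?mulr0 ?mulVf ?two_neq0.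
Qed.

Lemma evm_neg : evm mneg = -1.
Proof.
apply/matrixP => i j; rewrite !mxE.
have e2 : ev (ZPhi.mul (-1 : int, 0 : int) ZPhi.two) = - 2.
  by rewrite ZPhi.ev_mul evN1 ev_two mulN1r.
have e0 : ev (ZPhi.mul (-1 : int, 0 : int) (0, 0)) = 0.
  by rewrite ZPhi.ev_mul ev0 mulr0.
by case: (ord3P i) => ->; case: (ord3P j) => ->; rewrite /= ?e0 ?e2;
  rewrite ?mulr0 ?oppr0 // mulrN mulVf ?two_neq0.
Qed.

Lemma evm_refl v : v \in ZPhi.roots -> evm (mrefl v) = refl (evv v).
Proof.
move=> vR; have vR' : evv v \in H3_roots R by rewrite -ZPhi.ev_roots map_f.
apply/row_matrixP => i; rewrite rowK [in RHS]rowE reflE (root_norm vR').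
have -> : dot (delta_mx 0 i) (evv v) = evv v 0 i.
  rewrite /dot (bigD1 i) //= mxE !eqxx mul1r big1 ?addr0 // => k ki.
  by rewrite mxE (negPf ki) andbF mul0r.
have half (a : R) : 2 * a / 4 = 2^-1 * a by field.
rewrite half; apply: (scalerI two_neq0).
rewrite scalerA divff ?two_neq0 // scale1r scalerBr !scalerA mulrA divff ?two_neq0 // mul1r.
by case: (ord3P i) => -> /=; rewrite ZPhi.evv_sub ZPhi.evv_scale mxE; congr (_ - _);
  apply/rowP => j; case: (ord3P j) => ->; rewrite !mxE /= ?ev0 ?ev_two ?mulr1 ?mulr0.
Qed.

Lemma stepE A v : A \in elements -> v \in ZPhi.roots ->
  evm (step A v) = evm A * refl (evv v) /\ step A v \in elements.
Proof.
move=> As vs; have /andP[/eqP e ->] := allP (allP elements_step A As) v vs.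
by rewrite -(evm_refl vs) -(evm_mul e).
Qed.

Lemma elements_in_H3 A : A \in elements -> in_H3 (evm A).
Proof.
pose good (s : seq mat) := {subset s <= elements} /\ {in s, forall A, in_H3 (evm A)}.
have ext (s : seq mat) : good s -> good (extend s).
  move=> [sub inH]; split=> B; rewrite mem_undup mem_cat => /orP[].
  - exact: sub.
  - by case/allpairsP => -[C v] [/sub Cs vR ->]; case: (stepE Cs vR).
  - exact: inH.
  - case/allpairsP => -[C v] [Cs vR ->]; have [-> _] := stepE (sub _ Cs) vR.
    apply: in_H3_mul; first exact: inH.
    by apply: in_H3_refl; rewrite -ZPhi.ev_roots map_f.
suff [_ h] : good elements by exact: h.
rewrite elementsE; apply/ext/ext/ext; split=> B; rewrite inE => /eqP->.
  by rewrite elementsE; do 3!(rewrite mem_undup mem_cat; apply/orP; left); rewrite inE.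
by rewrite evm_one; exact: in_H3_1.
Qed.

Lemma elements_cover w : exists2 A, A \in elements & evm A = w.
Proof.
have /asboolP[s] := H3_mxP w; move: (H3_mx w) => W.
elim/last_ind: s W => [|s v IH] W h ->.
  exists mone; last by rewrite evm_one big_nil.
  by rewrite elementsE; do 3!(rewrite mem_undup mem_cat; apply/orP; left); rewrite inE.
have [||A As eA] := IH (\prod_(v <- s) refl v) => //.
  by move=> u us; apply: h; rewrite mem_rcons inE us orbT.
have : v \in H3_roots R by apply: h; rewrite mem_rcons mem_head.
rewrite -ZPhi.ev_roots => /mapP[v' vR ->]; have [e Bs] := stepE As vR.
by exists (step A v') => //; rewrite e eA -cats1 big_cat big_seq1.
Qed.

Lemma elements_uniq : uniq elements.
Proof. by rewrite elementsE undup_uniq. Qed.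

Definition el A : H3 R := insubd (H3_one R) (evm A).
Lemma elE A : A \in elements -> H3_mx (el A) = evm A.
Proof. by move=> As; apply/insubdK/elements_in_H3. Qed.

Definition code w : mat := nth mone elements (find (fun A => evm A == w) elements).
Lemma codeP w : code w \in elements /\ evm (code w) = w.
Proof.
have h : has (fun A => evm A == w) elements.
  by have [A As e] := elements_cover w; apply/hasP; exists A => //; rewrite e.
by split; [rewrite mem_nth // -has_find|apply/eqP/(nth_find mone h)].
Qed.
Lemma codeK w : el (code w) = w.
Proof. by have [h e] := codeP w; apply/val_inj; rewrite -[LHS]/(H3_mx (el _)) elE. Qed.
Lemma elK A : A \in elements -> code (el A) = A.
Proof. by move=> As; have [_ e] := codeP (el A); apply: evm_inj; rewrite e elE. Qed.

Lemma sum_elements (Z : nmodType) (F : H3 R -> Z) :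
  \sum_(w : H3 R) F w = \sum_(A <- elements) F (el A).
Proof.
rewrite -(big_map el predT F); apply: perm_big; apply: uniq_perm.
- by rewrite index_enum_uniq.
- rewrite map_inj_in_uniq ?elements_uniq // => A B As Bs e.
  by rewrite -(elK As) e elK.
move=> w; rewrite mem_index_enum; apply/esym/mapP; exists (code w).
  by case: (codeP w).
by rewrite codeK.
Qed.

Lemma ev_sumt (s : seq ZPhi.t) : ev (sumt s) = \sum_(x <- s) ev x.
Proof.
by elim: s => [|x s IH] /=; rewrite ?big_nil ?ev0 // big_cons ZPhi.ev_add IH.
Qed.

Lemma ev_expt x n : ev (expt x n) = ev x ^+ n.
Proof. by elim: n => [|n IH]; rewrite ?ev1 // exprS /= ZPhi.ev_mul -IH. Qed.

Definition mchi i w : R := ev (chi i (code w)).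

Lemma det_mx33 (B : 'M[R]_3) : \det B =
  B 0 0 * (B 1 1 * B 2%:R 2%:R - B 1 2%:R * B 2%:R 1) -
  B 0 1 * (B 1 0 * B 2%:R 2%:R - B 1 2%:R * B 2%:R 0) +
  B 0 2%:R * (B 1 0 * B 2%:R 1 - B 1 1 * B 2%:R 0).
Proof.
rewrite (expand_det_row _ 0) !big_ord_recl big_ord0 /cofactor.
rewrite !(expand_det_row _ 0) !big_ord_recl !big_ord0 /cofactor !det_mx11 !mxE /=.
(* Indices in nat let the ordinals produced by the two expansions be identified by computation. *)
pose b (i j : nat) := B (inord i) (inord j).
have bE i j : B i j = b i j by rewrite /b !inord_val.
rewrite !bE /= /bump /= !add1n !add0n /= !addr0 !(expr0, expr1, expr2).
ring.
Qed.

Lemma evm_tr A : \tr (evm A) = 2^-1 * ev (tr2 A).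
Proof.
rewrite /mxtrace !big_ord_recl big_ord0 !mxE /= /tr2 !ZPhi.ev_add addr0 !mulrDr.
by [].
Qed.

Lemma evm_det A : \det (evm A) = 8^-1 * ev (det8 A).
Proof.
rewrite det_mx33 !mxE /=; case: A => -[[[a b] c] [[d e] f]] [[g h] i] /=.
by rewrite !(ZPhi.ev_add, ZPhi.ev_mul, ZPhi.ev_opp); field.
Qed.

Lemma code_tr w : ev (tr (code w)) = \tr w /\ ev (eps (code w)) = \det w.
Proof.
have [h e] := codeP w; have /andP[/eqP et /eqP ed] := allP elements_tr _ h.
split; first rewrite -e evm_tr -et ZPhi.ev_mul ev_two; first by field.
by rewrite -e evm_det -ed ZPhi.ev_mul ev_int; field.
Qed.

Lemma mchi1 w : mchi T1 w = 1. Proof. exact: ev1. Qed.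
Lemma mchi2 w : mchi T2 w = \det w. Proof. by case: (code_tr w). Qed.
Lemma mchi3 w : mchi T3 w = \tr w. Proof. by case: (code_tr w). Qed.
Lemma mchi4 w : mchi T4 w = \det w * mchi T3 w.
Proof. by rewrite -mchi2 /mchi /chi ZPhi.ev_mul. Qed.
Lemma mchi6 w : mchi T6 w = \det w * mchi T5 w.
Proof. by rewrite -mchi2 /mchi /chi ZPhi.ev_mul. Qed.
Lemma mchi8 w : mchi T8 w = \det w * mchi T7 w.
Proof. by rewrite -mchi2 /mchi /chi ZPhi.ev_mul. Qed.
Lemma mchi10 w : mchi T10 w = \det w * mchi T9 w.
Proof. by rewrite -mchi2 /mchi /chi ZPhi.ev_mul. Qed.

Lemma all_labels (P : pred label) : all P labels -> forall i, P i.
Proof. by move=> h i; move: h; rewrite /=; case: i; do ?case/andP=> ? //; case/andP. Qed.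

Lemma code1 : code 1%g = mone.
Proof. by apply: evm_inj; have [_ ->] := codeP 1%g; rewrite evm_one. Qed.

Lemma mchi_regular w :
  \sum_(i <- labels) (irrep_dim i)%:R * mchi i w = 120 * (w == 1%g)%:R.
Proof.
have [h e] := codeP w; have /eqP/(congr1 ev) := allP chi_regular _ h.
rewrite ev_sumt big_map => e'.
transitivity (ev (if code w == mone then (120, 0) else (0, 0))).
  by rewrite -e'; apply: eq_bigr => i _; rewrite ZPhi.ev_mul ev_int.
have -> : (code w == mone) = (w == 1%g).
  by apply/eqP/eqP => [cw|->]; [rewrite -[w]codeK -[RHS]codeK cw code1|exact: code1].
by case: eqP; rewrite ev_int ?mulr1 ?mulr0.
Qed.

Lemma mchi_el i A : A \in elements -> mchi i (el A) = ev (chi i A).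
Proof. by move=> As; rewrite /mchi elK. Qed.

Lemma el_step A v : A \in elements -> v \in ZPhi.roots ->
  el (step A v) = (el A * sigma (evv v))%g.
Proof.
move=> As vR; apply/val_inj; have [e Bs] := stepE As vR.
rewrite -[LHS]/(H3_mx (el _)) elE // e -elE //.
rewrite -[RHS]/(H3_mx (el A) *m H3_mx (sigma _)) sigmaE //.
by rewrite -ZPhi.ev_roots map_f.
Qed.

Lemma mchi_roots i w :
  \sum_(v <- positive_roots R) mchi i (w * sigma v)%g = (gam i)%:~R * mchi i w.
Proof.
have /allP/(_ (code w)) := @all_labels _ chi_roots i.
have [h e] := codeP w => /(_ h)/eqP/(congr1 ev).
rewrite ev_sumt big_map ZPhi.ev_mul ev_int -/(mchi i w) rmorphM /= => e'.
pose F (v : 'rV[R]_3) : R^o := mchi i (w * sigma v)%g.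
have FN v : F (- v) = F v by rewrite /F sigmaN.
rewrite -[LHS]/(\sum_(v <- positive_roots R) F v) (sum_pos_roots FN).
rewrite -ZPhi.ev_roots big_map.
have -> : \sum_(v <- ZPhi.roots) F (evv v) = \sum_(v <- ZPhi.roots) ev (chi i (step (code w) v)).
  apply: eq_big_seq => v vR; have [_ Bs] := stepE h vR.
  by rewrite /F -{1}[w]codeK -el_step // mchi_el.
by rewrite e' -[_ *: _]/(_ * _); field.
Qed.

Lemma sum_mchi (F : H3 R -> R) (f : mat -> ZPhi.t) :
  {in elements, forall A, F (el A) = ev (f A)} ->
  \sum_w F w = ev (sumt [seq f A | A <- elements]).
Proof. by move=> h; rewrite sum_elements (eq_big_seq _ h) ev_sumt big_map. Qed.

Lemma mchi_norm i : \sum_w mchi i w * mchi i w = 120.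
Proof.
rewrite (@sum_mchi _ (fun A => ZPhi.mul (chi i A) (chi i A))) => [|A As].
  by rewrite (eqP (@all_labels _ chi_norm i)) ev_int.
by rewrite mchi_el // ZPhi.ev_mul.
Qed.

Lemma mchi8_neg w : mchi T8 (minus_one R * w)%g = - mchi T8 w.
Proof.
have [h e] := codeP w; have /andP[/andP[Bs /eqP eB] /eqP e8] := allP chi8_neg _ h.
have -> : (minus_one R * w)%g = el (mhalf (mmul mneg (code w))).
  apply/val_inj; rewrite -[RHS]/(H3_mx (el _)) elE // -(evm_mul eB) evm_neg e.
  by [].
by rewrite mchi_el // e8 ZPhi.ev_opp.
Qed.

Lemma tensor_multE n i j :
  \sum_w mchi j w * (mchi i w * (\tr w) ^+ n) = ev (tensor_mult n i j).
Proof.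
rewrite (@sum_mchi _ (fun A => ZPhi.mul (chi j A) (ZPhi.mul (chi i A) (expt (tr A) n)))) //.
move=> A As; rewrite !mchi_el // !ZPhi.ev_mul ev_expt.
by have [<- _] := code_tr (el A); rewrite elK.
Qed.

Lemma zonal_multE n i j :
  \sum_w mchi j w * (mchi i w * ((w : 'M_3) 0 0) ^+ n) = 2^-1 ^+ n * ev (zonal_mult n i j).
Proof.
transitivity (2^-1 ^+ n * (2 ^+ n * \sum_w mchi j w * (mchi i w * ((w : 'M_3) 0 0) ^+ n))).
  by rewrite mulrA -exprMn mulVf ?two_neq0 // expr1n mul1r.
congr (_ * _); rewrite mulr_sumr.
rewrite (@sum_mchi _ (fun A => ZPhi.mul (chi j A) (ZPhi.mul (chi i A) (expt A.1.1.1.1 n)))) //.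
move=> A As; rewrite !mchi_el // !ZPhi.ev_mul ev_expt elE //.
have -> : ev A.1.1.1.1 = 2 * evm A 0 0 by rewrite !mxE /= mulrA divff ?two_neq0 // mul1r.
by rewrite exprMn; ring.
Qed.

Lemma sigma_conj v v' : v \in H3_roots R -> v' \in H3_roots R ->
  exists w, (w * sigma v' = sigma v * w)%g.
Proof.
have H u : u \in H3_roots R -> exists w, u = evv (ZPhi.two, (0, 0), (0, 0)) *m w.
  rewrite -ZPhi.ev_roots => /mapP[x xR ->].
  have /hasP[A As /eqP e] := allP roots_transitive x xR.
  exists (el A); rewrite elE // evv_mulm e ZPhi.evv_scale ev_two scalerA.
  by rewrite mulVf ?two_neq0 // scale1r.
have v0R : evv (ZPhi.two, (0, 0), (0, 0)) \in H3_roots R.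
  by rewrite -ZPhi.ev_roots map_f //; vm_compute.
move=> /H[w ->] /H[w' ->]; exists (w^-1 * w')%g.
by rewrite !sigma_act // !mulgA !mulgK.
Qed.

End CodedElements.

(** * The irreducible representations and their characters *)

Section Representations.
Variable R : realType.
Notation G := [set: H3 R]%G.
Local Open Scope ring_scope.
Local Opaque positive_roots H3_roots sigma.

Section Intertwiners.
Variables (m n : nat) (rho : H3_repr R m) (tau : H3_repr R n) (A : 'M[R]_(m, n)).
Hypothesis hA : forall w, rho w *m A = A *m tau w.
Hypothesis A0 : A != 0.

Lemma intertwiner_free : mx_irreducible rho -> row_free A.
Proof.
case=> _ _ simple; rewrite -kermx_eq0; apply: contraNT A0 => k0.
have : (1%:M <= kermx A)%MS.
  apply: simple => //; last exact: submx1.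
  apply/mxmoduleP => w _; apply/sub_kermxP.
  by rewrite -mulmxA hA mulmxA mulmx_ker mul0mx.
by move/sub_kermxP; rewrite mul1mx => ->.
Qed.

Lemma intertwiner_full : mx_irreducible tau -> row_full A.
Proof.
case=> _ _ simple; rewrite -sub1mx -(genmxE A).
apply: simple; rewrite ?submx1 //; last by rewrite (eqmx_eq0 (genmxE A)).
by apply/mxmoduleP => w _; rewrite (eqmxMr _ (genmxE A)) genmxE -hA submxMl.
Qed.

Lemma intertwiner_sim : mx_irreducible rho -> mx_irreducible tau -> mx_rsim rho tau.
Proof.
move=> /intertwiner_free fr /intertwiner_full fu.
by apply: (MxReprSim (B := A)) => //; rewrite -(eqP fr) (eqP fu).
Qed.

End Intertwiners.

Lemma mx_rsim_trace m n (rho : H3_repr R m) (tau : H3_repr R n) w :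
  mx_rsim rho tau -> \tr (rho w) = \tr (tau w).
Proof.
move=> /mx_rsim_def[B [B' BB e]]; rewrite e ?inE //.
by rewrite mxtrace_mulC mulmxA BB mul1mx.
Qed.

Lemma reprM n (tau : H3_repr R n) w1 w2 : tau (w1 * w2)%g = tau w1 *m tau w2.
Proof. by rewrite repr_mxM ?inE. Qed.

Lemma orth_inv n (tau : H3_repr R n) w : orthogonal_repr tau ->
  tau (w^-1)%g = (tau w)^T.
Proof.
move=> h; rewrite -[LHS]mul1mx -(h w) -mulmxA -reprM mulgV repr_mx1.
exact: mulmx1.
Qed.

Section Averages.
Variables (m n : nat) (rho : H3_repr R m) (tau : H3_repr R n).
Hypothesis otau : orthogonal_repr tau.

Definition avg (E : 'M[R]_(m, n)) := \sum_w rho w *m E *m (tau w)^T.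

Lemma avg_intertwiner E g : rho g *m avg E = avg E *m tau g.
Proof.
rewrite /avg mulmx_sumr mulmx_suml (reindex_inj (mulgI (g^-1)%g)) /=.
apply: eq_bigr => w _; rewrite !mulmxA -reprM mulKVg -[RHS]mulmxA; congr (_ *m _).
by rewrite -!orth_inv // invMg invgK reprM.
Qed.

Lemma avg_delta i j k l : avg (delta_mx j l) i k = \sum_w rho w i j * tau w k l.
Proof.
rewrite summxE; apply: eq_bigr => w _; rewrite mxE (bigD1 l) //=.
rewrite big1 => [|x xl].
  rewrite !mxE (bigD1 j) //= mxE !eqxx mulr1 big1 ?addr0 // => y yj.
  by rewrite mxE (negPf yj) mulr0.
rewrite mxE big1 ?mul0r // => y _.
by rewrite mxE (negPf xl) andbF mulr0.
Qed.

Hypotheses (irho : mx_irreducible rho) (itau : mx_irreducible tau).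

Lemma schur_orth i j k l : ~ mx_rsim rho tau -> \sum_w rho w i j * tau w k l = 0.
Proof.
move=> ns; rewrite -avg_delta.
have [->|A0] := eqVneq (avg (delta_mx j l)) 0; first by rewrite mxE.
by case: ns; apply: intertwiner_sim A0 irho itau; exact: avg_intertwiner.
Qed.

Lemma schur_trace : ~ mx_rsim rho tau -> \sum_w \tr (rho w) *: tau w = 0.
Proof.
move=> ns; apply/matrixP => k l; rewrite summxE mxE.
under eq_bigr => w _ do rewrite mxE /mxtrace mulr_suml.
by rewrite exchange_big big1 //= => i _; exact: schur_orth.
Qed.

End Averages.

Lemma sum1_H3 : \sum_(w : H3 R) 1 = 120 :> R.
Proof.
by rewrite -[RHS](@mchi_norm R T1); apply: eq_bigr => w _; rewrite mchi1 mul1r.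
Qed.

Section Absolute.
Variables (n : nat) (tau : H3_repr R n).
Hypotheses (otau : orthogonal_repr tau) (itau : mx_irreducible tau).

(* A projection of rank one commuting with an intertwiner yields a real
   eigenvector of it; hence the intertwiner is a scalar. *)
Lemma commutant_scalar (P X : 'M[R]_n) : P *m P = P -> \tr P = 1 ->
  X *m P = P *m X -> (forall w, tau w *m X = X *m tau w) -> exists a, X = a%:M.
Proof.
move=> PP trP XP hX.
(* A full-rank factorization P = C B of an idempotent satisfies B C = 1, so its trace is its
   rank. *)
have [r [C [B [eP r1]]]] : exists r (C : 'M[R]_(n, r)) (B : 'M[R]_(r, n)),
    P = C *m B /\ r = 1%N.
  move: (mulmx_base P) (col_base_full P) (row_base_free P).
  move: (\rank P) (col_base P) (row_base P).
  move=> r C B eP /row_fullP[C' CC] /row_freeP[B' BB]; exists r, C, B; split=> //.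
  have e : B *m C = 1%:M.
    have : C' *m (P *m P) *m B' = C' *m P *m B' by rewrite PP.
    rewrite -eP !mulmxA CC !mul1mx -[B *m C *m B *m B']mulmxA BB mulmx1.
    by [].
  move: trP; rewrite -eP mxtrace_mulC e mxtrace1 => /eqP.
  by rewrite pnatr_eq1 => /eqP.
subst r; pose a := (B *m X *m C) 0 0; exists a.
have eXP : X *m P = a *: P.
  rewrite -{1}PP mulmxA XP {1 2}eP -!mulmxA [B *m (X *m _)]mulmxA eP.
  rewrite [_ *m (C *m B)]mulmxA -/(B *m X *m C) [B *m X *m C]mx11_scalar -/a.
  by rewrite mul_scalar_mx -scalemxAr.
apply/eqP; rewrite -subr_eq0; apply/negPn/negP => A0.
have hA w : tau w *m (X - a%:M) = (X - a%:M) *m tau w.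
  by rewrite mulmxBr mulmxBl hX scalar_mxC.
have /row_freeP[Y AY] := intertwiner_free hA A0 itau.
have : P = 0.
  rewrite -[P]mul1mx -(mulmx1C AY) -mulmxA mulmxBl eXP mul_scalar_mx subrr.
  by rewrite mulmx0.
by move=> P0; move: trP; rewrite P0 mxtrace0 => /eqP; rewrite eq_sym oner_eq0.
Qed.

Hypothesis scal : forall X : 'M[R]_n, (forall w, tau w *m X = X *m tau w) ->
  exists a, X = a%:M.

Lemma irr_dim_gt0 : (0 < n)%N.
Proof. by case: itau => _ h _; case: n h => // ; rewrite flatmx0 eqxx. Qed.

Lemma schur_norm i j k l :
  \sum_w tau w i j * tau w k l = 120 / n%:R * (i == k)%:R * (j == l)%:R.
Proof.
have [a ea] := scal (avg_intertwiner tau otau (delta_mx j l)).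
have n0 : n%:R != 0 :> R by rewrite pnatr_eq0 -lt0n irr_dim_gt0.
rewrite -avg_delta ea mxE -[a *+ _]mulr_natr [RHS]mulrAC; congr (_ * _).
apply: (mulIf n0); rewrite [LHS]mulr_natr -mxtrace_scalar -ea /avg linear_sum /=.
transitivity (\sum_(w : H3 R) (j == l)%:R : R).
  apply: eq_bigr => w _; rewrite mxtrace_mulC mulmxA otau mul1mx.
  rewrite /mxtrace; under eq_bigr => x _ do rewrite mxE.
  have [->|jl] := eqVneq j l.
    rewrite (bigD1 l) //= eqxx big1 ?addr0 // => x /negPf->.
    by [].
  rewrite big1 // => x _; case: eqP => // ->.
  by rewrite (negPf jl).
have -> : \sum_(w : H3 R) (j == l)%:R = (\sum_(w : H3 R) 1) * (j == l)%:R :> R.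
  by rewrite mulr_suml; apply: eq_bigr => w _; rewrite mul1r.
by rewrite sum1_H3; field.
Qed.

Lemma trace_norm : \sum_w \tr (tau w) * \tr (tau w) = 120.
Proof.
have n0 : n%:R != 0 :> R by rewrite pnatr_eq0 -lt0n irr_dim_gt0.
transitivity (\sum_i \sum_k \sum_w tau w i i * tau w k k).
  rewrite exchange_big; under [RHS]eq_bigr => i _ do rewrite exchange_big.
  rewrite exchange_big /=; apply: eq_bigr => w _.
  rewrite /mxtrace mulr_suml exchange_big /=; apply: eq_bigr => i _.
  by rewrite mulr_sumr.
transitivity (\sum_(i < n) (120 / n%:R : R)).
  apply: eq_bigr => i _; rewrite (bigD1 i) //= schur_norm eqxx !mulr1.
  rewrite big1 ?addr0 // => k ki; rewrite schur_norm eq_sym (negPf ki).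
  by rewrite !mulr0.
by rewrite sumr_const card_ord -[_ *+ n]mulr_natr divfK.
Qed.

(** The trace of [tau] and [mchi i] both have squared norm 120, and the hypothesis gives them scalar
    product 120; the sum of the squares of their differences is thus 0. *)
Lemma trace_from_proj i : irrep_dim i = n ->
  \sum_w mchi i w *: tau w = (120 / n%:R)%:M -> forall w, \tr (tau w) = mchi i w.
Proof.
move=> dn proj.
have n0 : n%:R != 0 :> R by rewrite pnatr_eq0 -lt0n irr_dim_gt0.
have cross : \sum_w mchi i w * \tr (tau w) = 120.
  have := congr1 mxtrace proj; rewrite mxtrace_scalar linear_sum /=.
  under eq_bigr => w _ do rewrite mxtraceZ.
  by move=> ->; rewrite -[_ *+ n]mulr_natr divfK.
have : \sum_w (\tr (tau w) - mchi i w) ^+ 2 = 0.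
  transitivity (\sum_w \tr (tau w) * \tr (tau w) + (\sum_w mchi i w * mchi i w
     - 2 * \sum_w mchi i w * \tr (tau w))).
    rewrite mulr_sumr -sumrB -big_split; apply: eq_bigr => w _ /=; ring.
  by rewrite trace_norm mchi_norm cross; ring.
move/eqP; rewrite psumr_eq0 => [/allP h w|w _]; last exact: sqr_ge0.
have := h w; rewrite mem_index_enum => /(_ isT) /=.
by rewrite sqrf_eq0 subr_eq0 => /eqP.
Qed.

End Absolute.

Section GroupAlgebra.
Variables (n : nat) (tau : H3_repr R n).

Definition Om : 'M[R]_n := \sum_(v <- positive_roots R) tau (sigma v).

Lemma Om_commute w : tau w *m Om = Om *m tau w.
Proof.
rewrite /Om mulmx_sumr mulmx_suml.
pose F (v : 'rV[R]_3) := tau w *m tau (sigma v).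
pose F' (v : 'rV[R]_3) := tau (sigma v) *m tau w.
have FN v : F (- v) = F v by rewrite /F sigmaN.
have F'N v : F' (- v) = F' v by rewrite /F' sigmaN.
rewrite -[LHS]/(\sum_(v <- positive_roots R) F v) -[RHS]/(\sum_(v <- positive_roots R) F' v).
rewrite (sum_pos_roots FN) (sum_pos_roots F'N) -(sum_roots_act w).
congr (_ *: _); apply: eq_big_seq => v vR.
by rewrite /F /F' sigma_act // -!reprM !mulgA mulgV mul1g.
Qed.

(** Isotypic projection up to the factor 120 / [irrep_dim i]. The properties [proj_sum] and
    [proj_Om] rest on the tables alone, before any [mchi i] is known to be a character. *)
Definition proj i : 'M[R]_n := \sum_w mchi i w *: tau w.

Lemma proj_sum : \sum_(i <- H3Codes.labels) (irrep_dim i)%:R *: proj i = 120%:M.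
Proof.
under eq_bigr => i _ do rewrite scaler_sumr.
rewrite exchange_big /=.
transitivity (\sum_(w : H3 R) (120 * (w == 1%g)%:R : R) *: tau w).
  apply: eq_bigr => w _; rewrite -mchi_regular scaler_suml.
  by apply: eq_bigr => i _; rewrite scalerA.
rewrite (bigD1 1%g) //= big1 => [|w /negPf->]; last by rewrite mulr0 scale0r.
by rewrite addr0 eqxx mulr1 repr_mx1 scalemx1.
Qed.

Lemma proj_Om i : proj i *m Om = (H3Codes.gam i)%:~R *: proj i.
Proof.
rewrite /proj /Om scaler_sumr mulmx_sumr.
transitivity (\sum_(v <- positive_roots R) \sum_w mchi i (w * sigma v)%g *: tau w).
  apply: eq_big_seq => v /pos_roots_sub vR; rewrite mulmx_suml.
  rewrite (reindex_inj (mulIg (sigma v))) /=; apply: eq_bigr => w _.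
  by rewrite -scalemxAl -reprM -mulgA sigma_inv // mulg1.
rewrite exchange_big /=; apply: eq_bigr => w _.
by rewrite -scaler_suml mchi_roots scalerA.
Qed.

End GroupAlgebra.

End Representations.

(** Boolean comparison of labels goes through this index. *)
Definition lidx (i : label) : nat :=
  match i with
  | T1 => 0 | T2 => 1 | T3 => 2 | T4 => 3 | T5 => 4 | T6 => 5 | T7 => 6 | T8 => 7
  | T9 => 8 | T10 => 9
  end.

Lemma chi_orth i j : lidx i != lidx j -> H3Codes.tensor_mult 0 i j == (0, 0).
Proof.
have h : all (fun i => all (fun j => (lidx i != lidx j) ==>
  (H3Codes.tensor_mult 0 i j == (0, 0))) H3Codes.labels) H3Codes.labels by vm_compute.
by move=> ij; have := all_labels (all_labels h i) j; rewrite ij.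
Qed.

Section IrreducibleCharacters.
Variable R : realType.
Local Opaque positive_roots H3_roots sigma.
Notation gamR i := ((H3Codes.gam i)%:~R : R).

Definition axis (i : 'I_3) : 'rV[R]_3 := 2 *: delta_mx 0 i.

Lemma axis_root i : axis i \in H3_roots R. Proof. exact: root_2e. Qed.

Lemma refl_axis i : refl (axis i) = \matrix_(k, l) ((k == l)%:R - 2 * (k == i)%:R * (l == i)%:R).
Proof.
rewrite /refl root_norm ?axis_root //; apply/matrixP => k l.
by rewrite !mxE big_ord1 !mxE !eqxx /=; field.
Qed.

(** The three coordinate reflections multiply to -I. Where -I acts trivially, this expresses the
    trace of a product of two of them by that of the third, which is what [joint_proj_trace]
    requires. *)
Lemma sigma_axes : (sigma (axis 0%R) * sigma (axis 1%R) = minus_one R * sigma (axis 2%:R%R))%g.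
Proof.
apply/val_inj; rewrite -[LHS]/(H3_mx (sigma _) *m H3_mx (sigma _)).
rewrite -[RHS]/((-1) *m H3_mx (sigma _)) !sigmaE ?axis_root // mulNmx mul1mx !refl_axis.
apply/matrixP => i j; rewrite !mxE !big_ord_recl !big_ord0 !mxE.
by case: (ord3P i) => ->; case: (ord3P j) => ->; rewrite -!val_eqE /=; ring.
Qed.

Lemma sigma_axesC : (sigma (axis 0%R) * sigma (axis 1%R) = sigma (axis 1%R) * sigma (axis 0%R))%g.
Proof.
apply/val_inj; rewrite -[LHS]/(H3_mx (sigma _) *m H3_mx (sigma _)).
rewrite -[RHS]/(H3_mx (sigma _) *m H3_mx (sigma _)) !sigmaE ?axis_root // !refl_axis.
apply/matrixP => i j; rewrite !mxE !big_ord_recl !big_ord0 !mxE.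
by case: (ord3P i) => ->; case: (ord3P j) => ->; rewrite -!val_eqE /=; ring.
Qed.

(** The number 15 of positive roots is read off from the identity for [T1]. *)
Lemma sum_pos_const (c : R) : \sum_(v <- positive_roots R) c = 15 * c.
Proof.
have := @mchi_roots R T1 1%g; rewrite mchi1 mulr1 => e.
transitivity ((\sum_(v <- positive_roots R) mchi T1 (1 * sigma v)%g) * c); last by rewrite e.
by rewrite mulr_suml; apply: eq_bigr => v _; rewrite mchi1 mul1r.
Qed.

Lemma projs_single n (rho : H3_repr R n) i :
  (forall j, lidx j != lidx i -> proj rho j = 0) ->
  (irrep_dim i)%:R *: proj rho i = 120%:M.
Proof.
move=> h; rewrite -(proj_sum rho).
transitivity (\sum_(j <- H3Codes.labels) (lidx j == lidx i)%:R *: ((irrep_dim j)%:R *: proj rho j)).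
  by rewrite !big_cons big_nil; case: (i) => /=; rewrite !scale0r !scale1r ?add0r ?addr0.
apply: eq_bigr => j _; case: (boolP (lidx j == lidx i)) => [_|/h->].
  by rewrite scale1r.
by rewrite !scaler0.
Qed.

Lemma irrep_dim_neq0 i : (irrep_dim i)%:R != 0 :> R.
Proof. by rewrite pnatr_eq0; case: i. Qed.

Lemma proj_scalar n (rho : H3_repr R n) i :
  (irrep_dim i)%:R *: proj rho i = 120%:M -> proj rho i = (120 / (irrep_dim i)%:R)%:M.
Proof.
have d0 := irrep_dim_neq0 i => e.
by apply: (scalerI d0); rewrite e scale_scalar_mx; congr (_%:M); field.
Qed.

Section OneRepresentation.
Variables (n : nat) (tau : H3_repr R n).
Hypotheses (otau : orthogonal_repr tau) (itau : mx_irreducible tau).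
Notation s i := (tau (sigma (axis i))).
Notation z := (tau (minus_one R)).

Lemma s_invol i : s i *m s i = 1%:M.
Proof. by rewrite -reprM sigma_inv ?axis_root // repr_mx1. Qed.

Lemma trace_Om c : trace_on_reflections tau c -> \tr (Om tau) = 15 * c.
Proof.
move=> h; rewrite /Om linear_sum -sum_pos_const; apply: eq_big_seq => v.
by move=> /pos_roots_sub vR; rewrite /= h.
Qed.

(** For orthogonal z the sum of the squared entries of z - 1 is 2 n - 2 tr z. *)
Lemma minus_one_trivial : \tr z = n%:R -> z = 1%:M.
Proof.
move=> trz; have e : \sum_i \sum_j ((z - 1%:M) j i) ^+ 2 = 0.
  transitivity (\tr ((z - 1%:M)^T *m (z - 1%:M))).
    rewrite /mxtrace; apply: eq_bigr => i _; rewrite mxE; apply: eq_bigr => j _.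
    by rewrite [(_ - _)^T i j]mxE.
  have -> : (z - 1%:M)^T = z^T - 1%:M by rewrite linearB /= trmx1.
  rewrite mulmxBl !mulmxBr mul1mx !mulmx1 otau !linearB /=.
  by rewrite mxtrace_tr trz mxtrace1; ring.
apply/eqP; rewrite -subr_eq0; apply/eqP/matrixP => j i; rewrite [RHS]mxE.
move/eqP: e; rewrite psumr_eq0 => [/allP/(_ i)|k _]; last first.
  by apply: sumr_ge0 => l _; exact: sqr_ge0.
rewrite mem_index_enum => /(_ isT) /=; rewrite psumr_eq0 => [/allP/(_ j)|k _].
  by rewrite mem_index_enum => /(_ isT) /=; rewrite sqrf_eq0 => /eqP.
exact: sqr_ge0.
Qed.

Lemma s01_trace : z = 1%:M -> \tr (s 0 *m s 1) = \tr (s 2%:R).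
Proof. by move=> z1; rewrite -reprM sigma_axes reprM z1 mul1mx. Qed.

(* The projection on the joint eigenspace of s 0 and s 1 for the eigenvalues
   1 and a, where a is 1 or -1. *)
Definition joint_proj (a : R) : 'M[R]_n := 4^-1 *: ((1%:M + s 0) *m (1%:M + a *: s 1)).

Lemma joint_proj_idem a : a * a = 1 -> joint_proj a *m joint_proj a = joint_proj a.
Proof.
move=> aa; rewrite /joint_proj -scalemxAl -scalemxAr scalerA.
have C : (1%:M + a *: s 1) *m (1%:M + s 0) = (1%:M + s 0) *m (1%:M + a *: s 1).
  rewrite !mulmxDr !mulmxDl !mul1mx !mulmx1 -scalemxAl -scalemxAr.
  by rewrite -!reprM sigma_axesC addrACA.
have S0 : (1%:M + s 0) *m (1%:M + s 0) = 2 *: (1%:M + s 0).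
  by rewrite mulmxDr !mulmxDl !mul1mx !mulmx1 s_invol addrC [s 0 + 1%:M]addrC scaler_nat mulr2n.
have S1 : (1%:M + a *: s 1) *m (1%:M + a *: s 1) = 2 *: (1%:M + a *: s 1).
  rewrite mulmxDr !mulmxDl !mul1mx !mulmx1 -scalemxAl -scalemxAr s_invol scalerA aa.
  by rewrite scale1r [a *: s 1 + 1%:M]addrC scaler_nat mulr2n.
rewrite -!mulmxA [(1%:M + a *: s 1) *m _]mulmxA C -!mulmxA S1 -!scalemxAr mulmxA S0.
by rewrite -!scalemxAl !scalerA; congr (_ *: _); field.
Qed.

Lemma joint_proj_trace a : \tr (joint_proj a) =
  4^-1 * (n%:R + \tr (s 0) + a * (\tr (s 1) + \tr (s 0 *m s 1))).
Proof.
rewrite /joint_proj mxtraceZ mulmxDr !mulmxDl !mul1mx !mulmx1 -scalemxAr.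
by rewrite !mxtraceD !mxtraceZ mxtrace1; ring.
Qed.

Lemma commutant_from_proj P : P *m P = P -> \tr P = 1 ->
  (forall X, (forall w, tau w *m X = X *m tau w) -> X *m P = P *m X) ->
  forall X : 'M[R]_n, (forall w, tau w *m X = X *m tau w) -> exists a, X = a%:M.
Proof.
move=> PP trP comm X hX; apply: (commutant_scalar itau PP trP _ hX); exact: comm.
Qed.

Lemma joint_proj_comm a (X : 'M[R]_n) : (forall w, tau w *m X = X *m tau w) ->
  X *m joint_proj a = joint_proj a *m X.
Proof.
move=> hX; rewrite /joint_proj -scalemxAr -scalemxAl; congr (_ *: _).
have c0 : X *m (1%:M + s 0) = (1%:M + s 0) *m X.
  by rewrite mulmxDr mulmxDl mulmx1 mul1mx hX.
have c1 : X *m (1%:M + a *: s 1) = (1%:M + a *: s 1) *m X.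
  by rewrite mulmxDr mulmxDl mulmx1 mul1mx -scalemxAr -scalemxAl hX.
by rewrite mulmxA c0 -mulmxA c1 mulmxA.
Qed.

Lemma proj_Om_scalar c i : Om tau = c%:M -> gamR i != c -> proj tau i = 0.
Proof.
move=> eO gc; have := proj_Om tau i; rewrite eO mul_mx_scalar => /eqP.
by rewrite -subr_eq0 -scalerBl scaler_eq0 subr_eq0 eq_sym (negPf gc) => /eqP.
Qed.

Lemma Om_from_proj i c : c != 0 -> proj tau i = c%:M -> Om tau = (gamR i)%:M.
Proof.
move=> c0 e; have := proj_Om tau i; rewrite e mul_scalar_mx scale_scalar_mx.
by rewrite mulrC -scale_scalar_mx => /(scalerI c0).
Qed.

End OneRepresentation.

Variables (tau : forall i, H3_repr R (irrep_dim i)) (htau : irreps_of_H3 tau).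
Notation sim i j := (mx_rsim (tau i) (tau j)).

Let otau i : orthogonal_repr (tau i). Proof. by case: htau => /(_ i)[]. Qed.
Let itau i : mx_irreducible (tau i). Proof. by case: htau => /(_ i)[]. Qed.

Definition has_char i := forall w, \tr (tau i w) = mchi i w.

Lemma char_T1 : has_char T1.
Proof.
case: htau => _ [[h1 _] _] w; rewrite (mx_rsim_trace w h1) mchi1.
exact: mxtrace1.
Qed.

Lemma char_T2 : has_char T2.
Proof.
case: htau => _ [[_ h2] _] w; rewrite (mx_rsim_trace w h2) mchi2.
by rewrite mxtraceZ mxtrace1 mulr1.
Qed.

Lemma char_T3 : has_char T3.
Proof. by case: htau => _ [_ [[h _] _]] w; rewrite (mx_rsim_trace w h) mchi3. Qed.

Lemma char_T4 : has_char T4.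
Proof.
case: htau => _ [_ [[_ h] _]] w; rewrite (mx_rsim_trace w h) mchi4 mxtraceZ.
by rewrite char_T3.
Qed.

Lemma proj_nonsim n (rho : H3_repr R n) i : orthogonal_repr rho -> mx_irreducible rho ->
  has_char i -> ~ mx_rsim (tau i) rho -> proj rho i = 0.
Proof.
move=> orho irho ci ns; rewrite -[RHS](schur_trace orho (itau i) irho ns).
by apply: eq_bigr => w _; rewrite ci.
Qed.

Lemma proj_dim i j : has_char j -> irrep_dim j <> irrep_dim i -> proj (tau i) j = 0.
Proof. by move=> cj ne; apply: proj_nonsim => // /mxrank_rsim/ne. Qed.

(** The (-1)-eigenspace of a reflection has dimension (3 - 1) / 2 = 1, so the commutant is scalar
    and the sum of the reflections is 15 / 3 = 5. Only [T3] and [T5] have this value, and [T3] is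
    excluded by hypothesis. *)
Lemma char_T5 : has_char T5.
Proof.
case: (htau) => _ [_ [_ [[tr5 ns5 _] _]]]; pose r := tau T5.
pose P : 'M[R]_3 := 2^-1 *: (1%:M - r (sigma (axis 0))).
have PP : P *m P = P.
  rewrite /P -scalemxAl -scalemxAr scalerA mulmxBr !mulmxBl !mul1mx !mulmx1.
  rewrite (s_invol r) opprB -mulr2n -scaler_nat scalerA.
  by congr (_ *: _); field.
have trP : \tr P = 1.
  by rewrite mxtraceZ linearB /= mxtrace1 tr5 ?axis_root //; field.
have scal : forall X : 'M[R]_3, (forall w, r w *m X = X *m r w) -> exists a, X = a%:M.
  apply: (commutant_from_proj (itau T5) PP trP) => X hX.
  by rewrite /P -scalemxAr -scalemxAl mulmxBr mulmxBl mulmx1 mul1mx hX.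
have [c eO] := scal _ (Om_commute r).
have c5 : c = 5.
  have := trace_Om tr5; rewrite -/r eO mxtrace_scalar => e.
  by apply: (mulIf (x := 3)); [rewrite pnatr_eq0|rewrite mulr_natr e; ring].
have z i : H3Codes.gam i != 5 -> proj r i = 0.
  move=> g5; apply: (proj_Om_scalar eO); rewrite c5.
  by have -> : 5 = (5 : int)%:~R :> R; rewrite ?eqr_int.
have e : (irrep_dim T5)%:R *: proj r T5 = 120%:M.
  apply: projs_single => -[] // _; try by apply: z.
  apply: proj_nonsim => //; first exact: char_T3.
  by move/mx_rsim_sym.
by move=> w; have := @trace_from_proj _ _ _ (otau T5) (itau T5) scal T5 erefl (proj_scalar e) w.
Qed.

Lemma char_T6 : has_char T6.
Proof.
case: htau => _ [_ [_ [[_ _ h] _]]] w; rewrite (mx_rsim_trace w h) mchi6 mxtraceZ.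
by rewrite char_T5.
Qed.

(** The joint eigenspace for 1 and -1 has dimension (5 + 1 - (1 + 1)) / 4 = 1. The sum of the
    reflections is then 15 / 5 = 3, a value that only [T9] has. *)
Lemma char_T9 : has_char T9.
Proof.
case: (htau) => _ [_ [_ [_ [_ [trz tr9 _]]]]]; pose r := tau T9.
have z1 := minus_one_trivial (otau T9) trz.
have trP : \tr (joint_proj r (- 1)) = 1.
  rewrite joint_proj_trace s01_trace // !tr9 ?axis_root //.
  by rewrite -[irrep_dim T9]/5%N; field.
have aa : -1 * -1 = 1 :> R by rewrite mulrNN mulr1.
have scal := commutant_from_proj (itau T9) (joint_proj_idem r aa) trP
  (@joint_proj_comm _ r (- 1)).
have [c eO] := scal _ (Om_commute r).
have c3 : c = 3.
  have := trace_Om tr9; rewrite -/r eO mxtrace_scalar => e.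
  by apply: (mulIf (x := 5)); [rewrite pnatr_eq0|rewrite mulr_natr e; ring].
have e : (irrep_dim T9)%:R *: proj r T9 = 120%:M.
  apply: projs_single => i i9; apply: (proj_Om_scalar eO); rewrite c3.
  have -> : 3 = (3 : int)%:~R :> R by []; rewrite eqr_int.
  by case: i i9.
by move=> w; have := @trace_from_proj _ _ _ (otau T9) (itau T9) scal T9 erefl (proj_scalar e) w.
Qed.

Lemma char_T10 : has_char T10.
Proof.
case: htau => _ [_ [_ [_ [_ [_ _ h]]]]] w; rewrite (mx_rsim_trace w h) mchi10 mxtraceZ.
by rewrite char_T9.
Qed.

(** The trace on reflections is not given here, so the order is reversed. The dimension excludes all
    labels but [T7] and [T8], and the trivial action of -I excludes [T8]. This yields [Om r] = 0,
    then trace 0 on the single class of reflections, and only then a joint eigenspace of dimension 4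
    / 4 = 1. *)
Lemma char_T7 : has_char T7.
Proof.
case: (htau) => _ [_ [_ [_ [[trz _] _]]]]; pose r := tau T7.
have z1 := minus_one_trivial (otau T7) trz.
have e8 : proj r T8 = 0.
  have eN : proj r T8 = - proj r T8.
    rewrite {1}/proj (reindex_inj (mulgI (minus_one R))) /= -sumrN.
    by apply: eq_bigr => w _; rewrite reprM z1 mul1mx mchi8_neg scaleNr.
  by apply: (scalerI (two_neq0 R)); rewrite scaler0 scaler_nat mulr2n {1}eN addNr.
have e : (irrep_dim T7)%:R *: proj r T7 = 120%:M.
  apply: projs_single => -[] // _; apply: proj_dim => //; do ?[exact: char_T1|
  exact: char_T2|exact: char_T3|exact: char_T4|exact: char_T5|exact: char_T6|
  exact: char_T9|exact: char_T10].
have e' := proj_scalar e.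
have eO : Om r = 0.
  have := Om_from_proj _ e'; rewrite mulf_neq0 ?invr_neq0 ?irrep_dim_neq0 ?pnatr_eq0 // => ->//.
  by rewrite raddf0.
have tr0 : trace_on_reflections r 0.
  move=> v vR; have : \tr (Om r) = 15 * \tr (r (sigma v)).
    apply: trace_Om => v' v'R; have [w ew] := sigma_conj v'R vR.
    rewrite -[sigma v'](mulgK w) -ew !reprM mxtrace_mulC mulmxA -reprM mulVg.
    by rewrite repr_mx1 mul1mx.
  by rewrite eO mxtrace0 => /esym/eqP; rewrite mulf_eq0 pnatr_eq0 => /eqP.
have trP : \tr (joint_proj r 1) = 1.
  rewrite joint_proj_trace s01_trace // !tr0 ?axis_root //.
  by rewrite -[irrep_dim T7]/4%N; field.
have scal := commutant_from_proj (itau T7) (joint_proj_idem r (mulr1 1)) trP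
  (@joint_proj_comm _ r 1).
by move=> w; have := @trace_from_proj _ _ _ (otau T7) (itau T7) scal T7 erefl e' w.
Qed.

Lemma char_T8 : has_char T8.
Proof.
case: htau => _ [_ [_ [_ [[_ h] _]]]] w; rewrite (mx_rsim_trace w h) mchi8 mxtraceZ.
by rewrite char_T7.
Qed.

Theorem irr_char i : has_char i.
Proof.
case: i; [exact: char_T1|exact: char_T2|exact: char_T3|exact: char_T4|exact: char_T5
  |exact: char_T6|exact: char_T7|exact: char_T8|exact: char_T9|exact: char_T10].
Qed.

Lemma irr_nonsim i j : lidx i != lidx j -> ~ sim i j.
Proof.
move=> ij s; have e w : mchi i w = mchi j w :> R by rewrite -!irr_char (mx_rsim_trace w s).
have /eqP/(congr1 (@ZPhi.ev R)) := chi_orth ij; rewrite ev0 -tensor_multE.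
under eq_bigr => w _ do rewrite expr0 mulr1 e.
by rewrite mchi_norm => /eqP; rewrite pnatr_eq0.
Qed.

Theorem irr_Om i : Om (tau i) = (gamR i)%:M.
Proof.
have e : (irrep_dim i)%:R *: proj (tau i) i = 120%:M.
  apply: projs_single => j ji; apply: proj_nonsim => //; first exact: irr_char.
  exact: irr_nonsim.
apply: (Om_from_proj _ (proj_scalar e)).
by rewrite mulf_neq0 ?invr_neq0 ?irrep_dim_neq0 ?pnatr_eq0.
Qed.

End IrreducibleCharacters.

Lemma has_labels (P : pred label) j : P j -> has P H3Codes.labels.
Proof. by case: j => /= ->; rewrite ?orbT. Qed.

(** * Isotypic components of the polynomials *)

Section IsotypicDecomposition.
Variables (R : realType) (tau : forall i, H3_repr R (irrep_dim i)).
Hypothesis htau : irreps_of_H3 tau.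
Variables (i : label) (kappa : R).
Variable M : cherednik_module (tau i) kappa.
Notation D := (chD M).
Notation X := (chX M).
Notation act := (chA M).
Notation cst := (chc M).
Notation hmg := (@chh _ _ _ _ M).
Notation gamR j := ((H3Codes.gam j)%:~R : R).
Implicit Types (f g : M) (w : H3 R).
Local Opaque positive_roots H3_roots sigma H3Codes.elements H3Codes.tensor_mult.

Let otau j : orthogonal_repr (tau j). Proof. by case: htau => /(_ j)[]. Qed.
Let itau j : mx_irreducible (tau j). Proof. by case: htau => /(_ j)[]. Qed.

Lemma Omega_act w f : Omega (act w f) = act w (Omega f).
Proof.
rewrite /Omega linear_sum /=.
pose F (v : 'rV[R]_3) := act (sigma v) (act w f).
pose F' (v : 'rV[R]_3) := act w (act (sigma v) f).
have FN v : F (- v) = F v by rewrite /F sigmaN.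
have F'N v : F' (- v) = F' v by rewrite /F' sigmaN.
rewrite -[LHS]/(\sum_(v <- positive_roots R) F v) -[RHS]/(\sum_(v <- positive_roots R) F' v).
rewrite (sum_pos_roots FN) (sum_pos_roots F'N) -[X in _ = _ *: X](sum_roots_act w).
congr (_ *: _); apply: eq_big_seq => v vR.
by rewrite /F /F' sigma_act // -!chactM !mulgA mulgV mul1g.
Qed.

Definition isoproj j f : M :=
  ((irrep_dim j)%:R / 120) *: \sum_w mchi j w *: act w f.

Lemma isoproj_sum f : \sum_(j <- H3Codes.labels) isoproj j f = f.
Proof.
transitivity (\sum_w (w == 1%g)%:R *: act w f); last first.
  rewrite (bigD1 1%g) //= chact1 eqxx scale1r big1 ?addr0 // => w /negPf->.
  by rewrite scale0r.
rewrite /isoproj; under eq_bigr => j _ do rewrite scaler_sumr.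
rewrite exchange_big; apply: eq_bigr => w _ /=.
under eq_bigr => j _ do rewrite scalerA.
rewrite -scaler_suml; congr (_ *: _).
apply: (mulfI (x := 120)); first by rewrite pnatr_eq0.
rewrite -mchi_regular mulr_sumr; apply: eq_bigr => j _.
by field.
Qed.

Lemma isoproj_Omega j f : Omega (isoproj j f) = gamR j *: isoproj j f.
Proof.
rewrite /isoproj linearZ /= [RHS]scalerA [gamR j * _]mulrC -[RHS]scalerA.
congr (_ *: _).
transitivity (\sum_w mchi j w *: act w (Omega f)).
  by rewrite linear_sum; apply: eq_bigr => w _; rewrite linearZ /= Omega_act.
have e w : mchi j w *: act w (Omega f) =
    \sum_(v <- positive_roots R) mchi j w *: act w (act (sigma v) f).
  by rewrite /Omega (linear_sum (act w)) scaler_sumr.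
rewrite (eq_bigr _ (fun w _ => e w)) exchange_big /= scaler_sumr.
transitivity (\sum_(v <- positive_roots R) \sum_w mchi j (w * sigma v)%g *: act w f).
  apply: eq_big_seq => v /pos_roots_sub vR.
  rewrite (reindex_inj (mulIg (sigma v))) /=; apply: eq_bigr => w _.
  by rewrite -chactM -mulgA sigma_inv // mulg1.
rewrite exchange_big /=; apply: eq_bigr => w _.
by rewrite -scaler_suml mchi_roots scalerA.
Qed.

Lemma isoproj_homog d j f : hmg d f -> hmg d (isoproj j f).
Proof.
by move=> hf; apply/homogZ/homog_sum => w _; exact/homogZ/act_homog.
Qed.

(* The element \sum_w b w w of the group algebra annihilates
   (R^3)^{(x) d} (x) R^n, of which the polynomials of degree d are a quotient. *)
Fixpoint kills (d : nat) (b : H3 R -> R) : Prop :=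
  if d is e.+1 then forall k a, kills e (fun w => b w * (w : 'M_3) k a)
  else forall p q, \sum_w b w * tau i w p q = 0.

Lemma kills_act d b f : kills d b -> hmg d f -> \sum_w b w *: act w f = 0.
Proof.
move=> + hf; move: d f hf b; apply: ch_hind => [u b kb|d k f _ IH b kb|d a f g _ _ IHf IHg b kb].
- have e w : b w *: act w (cst u) = cst ((b w *: tau i w) *m u).
    by rewrite ch_act_const -scalemxAl [RHS]linearZ.
  rewrite (eq_bigr _ (fun w _ => e w)) -linear_sum -mulmx_suml /=.
  rewrite (_ : \sum_w _ = 0) ?mul0mx ?linear0 //.
  apply/matrixP => p q; rewrite summxE mxE -[RHS](kb p q).
  by apply: eq_bigr => w _; rewrite mxE.
- have e w : b w *: act w (X k f) = \sum_l X l ((b w * (w : 'M_3) l k) *: act w f).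
    rewrite ch_act_mulX scaler_sumr; apply: eq_bigr => l _.
    by rewrite scalerA [RHS]linearZ.
  rewrite (eq_bigr _ (fun w _ => e w)) exchange_big big1 //= => l _.
  by rewrite -(linear_sum (X l)) (IH _ (kb l k)) linear0.
- have e w : b w *: act w (a *: f + g) = a *: (b w *: act w f) + b w *: act w g.
    by rewrite (linearP (act w)) /= scalerDr !scalerA [_ * a]mulrC.
  rewrite (eq_bigr _ (fun w _ => e w)) big_split /= -scaler_sumr.
  by rewrite IHf // IHg // scaler0 addr0.
Qed.

(* The trace in the second hypothesis is a sum of squares of the matrix entries
   of the elements \sum_w beta x w w. *)
Lemma kills_positive d (I : finType) (beta : I -> H3 R -> R) (K : H3 R -> R) :
  (forall w w', \sum_x beta x w * beta x w' = K (w^-1 * w')%g) ->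
  \sum_w K w * (mchi i w * (\tr w) ^+ d) = 0 -> forall x, kills d (beta x).
Proof.
elim: d I beta K => [|d IH] I beta K hK sK x.
  move=> p q.
  have : \sum_x \sum_p \sum_q (\sum_w beta x w * tau i w p q) ^+ 2 = 0.
    transitivity (\sum_w \sum_w' K (w^-1 * w')%g * mchi i (w^-1 * w')%g).
      have e y p' q' : (\sum_w beta y w * tau i w p' q') ^+ 2 =
          \sum_w \sum_w' (beta y w * beta y w') * (tau i w p' q' * tau i w' p' q').
        rewrite expr2 mulr_suml; apply: eq_bigr => w _; rewrite mulr_sumr.
        by apply: eq_bigr => w' _; ring.
      under eq_bigr => y _ do (under eq_bigr => p' _ do (under eq_bigr => q' _ do rewrite e;
        rewrite exchange_big); rewrite exchange_big).
      rewrite exchange_big; apply: eq_bigr => w _ /=.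
      under eq_bigr => y _ do (under eq_bigr => p' _ do (rewrite exchange_big);
        rewrite exchange_big).
      rewrite exchange_big; apply: eq_bigr => w' _ /=.
      rewrite -hK mulr_suml; apply: eq_bigr => y _.
      rewrite -(irr_char htau) reprM (orth_inv _ (otau i)).
      under eq_bigr => p' _ do rewrite -mulr_sumr.
      rewrite -mulr_sumr; congr (_ * _); rewrite /mxtrace exchange_big /=.
      by apply: eq_bigr => q' _; rewrite mxE; apply: eq_bigr => p' _; rewrite mxE.
    transitivity (\sum_(w : H3 R) \sum_w' K w' * mchi i w').
      apply: eq_bigr => w _; rewrite [RHS](reindex_inj (mulgI (w^-1)%g)) /=.
      by apply: eq_bigr.
    rewrite big1 // => w _; rewrite -[RHS]sK; apply: eq_bigr => w' _.
    by rewrite expr0 mulr1.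
  have ge (F : R) : 0 <= F ^+ 2 by exact: sqr_ge0.
  move/eqP; rewrite psumr_eq0 => [/allP/(_ x)|y _]; last first.
    by apply: sumr_ge0 => p' _; apply: sumr_ge0 => q' _.
  rewrite mem_index_enum => /(_ isT) /=; rewrite psumr_eq0 => [/allP/(_ p)|y _]; last first.
    by apply: sumr_ge0 => q' _.
  rewrite mem_index_enum => /(_ isT) /=; rewrite psumr_eq0 => [/allP/(_ q)|//].
  by rewrite mem_index_enum => /(_ isT) /=; rewrite sqrf_eq0 => /eqP.
move=> k a.
(* Tensoring with the reflection representation adds a matrix entry to the index and multiplies the
   kernel [K] by the trace of w. *)
pose beta' (y : I * ('I_3 * 'I_3)) w := beta y.1 w * (w : 'M_3) y.2.1 y.2.2.
apply: (IH _ beta' (fun w => K w * \tr w) _ _ (x, (k, a))) => [w w'|].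
  rewrite -(pair_bigA_idem _ (fun y ka => beta' (y, ka) w * beta' (y, ka) w')) /= ?addr0 //.
  rewrite -hK mulr_suml; apply: eq_bigr => y _.
  rewrite -(pair_bigA_idem _ (fun k a => beta' (y, (k, a)) w * beta' (y, (k, a)) w')) /= ?addr0 //.
  have -> : \tr (w^-1 * w')%g = \tr ((w : 'M_3)^T *m (w' : 'M_3)).
    by rewrite -H3_inv_tr -H3_mxM.
  rewrite /mxtrace mulr_sumr exchange_big /=; apply: eq_bigr => a' _.
  by rewrite mxE mulr_sumr; apply: eq_bigr => k' _; rewrite /beta' mxE /=; ring.
by rewrite -[RHS]sK; apply: eq_bigr => w _; rewrite exprS; ring.
Qed.

(** [mchi j] is the sum of the diagonal entries of [tau j]. The family of all entries has kernel
    [mchi j], so a vanishing multiplicity makes each entry separately annihilate degree d. *)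
Lemma isoproj_eq0 d j f : H3Codes.tensor_mult d i j = (0, 0) -> hmg d f -> isoproj j f = 0.
Proof.
move=> e0 hf; rewrite /isoproj (_ : \sum_w _ = 0) ?scaler0 //.
transitivity (\sum_p \sum_w tau j w p p *: act w f).
  rewrite exchange_big; apply: eq_bigr => w _ /=.
  by rewrite -(irr_char htau) /mxtrace scaler_suml.
rewrite big1 // => p _; apply: kills_act hf.
pose beta (y : 'I_(irrep_dim j) * 'I_(irrep_dim j)) w := tau j w y.1 y.2.
apply: (@kills_positive d _ beta (mchi j) _ _ (p, p)) => [w w'|].
  rewrite -(pair_bigA_idem _ (fun p q => beta (p, q) w * beta (p, q) w')) /= ?addr0 //.
  rewrite -(irr_char htau) reprM (orth_inv _ (otau j)) /mxtrace exchange_big /=.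
  by apply: eq_bigr => q _; rewrite mxE; apply: eq_bigr => r _; rewrite mxE.
by rewrite tensor_multE e0 ev0.
Qed.

Definition Omega_values : seq int := [:: 15; -15; 5; -5; 0; 3; -3].
(** An upper estimate of the constituents in degree d; from degree 4 on no label is excluded. *)
Definition occurs (d : nat) (j : label) : bool :=
  (3 < d)%N || (H3Codes.tensor_mult d i j != (0, 0)).
Definition Omega_pred (d : nat) : pred R :=
  fun c => has (fun j => (gamR j == c) && occurs d j) H3Codes.labels.

Lemma Omega_values_uniq : uniq [seq (x%:~R : R) | x <- Omega_values].
Proof. by rewrite map_inj_uniq //; exact: intr_inj. Qed.

(** Labels sharing a value of [gam], such as [T3] and [T5], are merged, since Omega does not
    separate them. *)
Lemma isoproj_spectrum d : @Omega_spectrum _ _ _ _ M d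
  [seq (x%:~R : R) | x <- Omega_values] (Omega_pred d).
Proof.
move=> f hf; exists (fun c => \sum_(j <- H3Codes.labels | gamR j == c) isoproj j f); split.
- rewrite big_map (exchange_big_dep predT) //= -[LHS]isoproj_sum.
  apply: eq_bigr => j _; under eq_bigl => c do rewrite eqr_int.
  by case: j; rewrite !big_cons big_nil /= addr0.
- by move=> c; apply: homog_sum => j _; exact: isoproj_homog.
- move=> c; rewrite linear_sum scaler_sumr; apply: eq_bigr => j /eqP <-.
  exact: isoproj_Omega.
- move=> c nS; rewrite big1 // => j /eqP gj; apply: (@isoproj_eq0 d) hf.
  apply/eqP; apply: contraNT nS => nz.
  by apply: (has_labels (j := j)); rewrite gj eqxx /occurs nz orbT.
Qed.

End IsotypicDecomposition.

(** Submodules consist of row vectors while [rho] acts here on columns. Transposition turns w into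
    its inverse by orthogonality, whence the reindexing by inverses. *)
Lemma orbit_span (R : realType) n (rho : H3_repr R n) (u v : 'cV[R]_n) :
  orthogonal_repr rho -> mx_irreducible rho -> u != 0 ->
  exists c : H3 R -> R, v = \sum_w c w *: (rho w *m u).
Proof.
move=> orho [_ _ simple] u0.
pose U := (\sum_(w : H3 R) <<u^T *m rho w>>)%MS.
have modU : mxmodule rho U.
  apply/mxmoduleP => g _; rewrite sumsmxMr; apply/sumsmx_subP => w _.
  rewrite (eqmxMr _ (genmxE _)) -mulmxA -reprM.
  apply: (sumsmx_sup (w * g)%g) => //; by rewrite genmxE.
have U0 : U != 0.
  apply: contraNneq u0 => e; rewrite -trmx_eq0 -submx0 -e.
  by apply: (sumsmx_sup 1%g) => //; rewrite genmxE repr_mx1 mulmx1.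
have : (v^T <= U)%MS by apply: submx_trans (submx1 _) (simple _ modU (submx1 _) U0).
move=> /sub_sumsmxP[c ec].
have cw w : exists a : R, c w *m <<u^T *m rho w>>%MS = a *: (u^T *m rho w).
  by apply/sub_rVP; rewrite -(genmxE (u^T *m rho w)); exact: submxMl.
have [a ea] := choice cw.
exists (fun w => a (w^-1)%g); rewrite -[v]trmxK ec linear_sum /=.
rewrite (reindex_inj invg_inj); apply: eq_bigr => w _ /=.
rewrite ea linearZ /= trmx_mul trmxK; congr (_ *: (_ *m _)).
by rewrite (orth_inv _ orho) trmxK.
Qed.

Section Embedding.
Variables (R : realType) (tau : forall i, H3_repr R (irrep_dim i)).
Hypothesis htau : irreps_of_H3 tau.
Variables (i r : label) (kappa : R) (N : nat).
Variable M : cherednik_module (tau i) kappa.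
Notation X := (chX M).
Notation act := (chA M).
Notation cst := (chc M).
Notation hmg := (@chh _ _ _ _ M).
Implicit Types (f g : M) (w : H3 R).
Local Opaque positive_roots H3_roots sigma H3Codes.elements H3Codes.zonal_mult.

Let otau j : orthogonal_repr (tau j). Proof. by case: htau => /(_ j)[]. Qed.
Let itau j : mx_irreducible (tau j). Proof. by case: htau => /(_ j)[]. Qed.

Let Z := 'cV[R]_(irrep_dim i).
Let evalT (k : 'I_3) : {linear Z -> Z} :=
  if k == 0 then (idfun : {linear Z -> Z}) else (\0 : {linear Z -> Z}).
Let evalTC k l z : evalT k (evalT l z) = evalT l (evalT k z).
Proof. by rewrite /evalT; case: eqP; case: eqP. Qed.
Let evalC : {linear 'cV[R]_(irrep_dim i) -> Z} := idfun.

(* Evaluation at x = (1, 0, 0). *)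
Let eval1 : {linear M -> Z} := s2val (@ch_ext _ _ _ _ M Z evalT evalC evalTC).

Let eval1_const u : eval1 (cst u) = u.
Proof. by rewrite /eval1; case: ch_ext => F /= ->. Qed.
Let eval1_X k f : eval1 (X k f) = evalT k (eval1 f).
Proof. by rewrite /eval1; case: ch_ext => F /= _ ->. Qed.

Let monomial u : M := iter N (X 0) (cst u).

Let monomial_linear : linear monomial.
Proof.
by rewrite /monomial => a u v; elim: N => [|d IH] /=; rewrite ?IH linearP.
Qed.

Let eval1_monomial w u :
  eval1 (act w (monomial u)) = ((w : 'M_3) 0 0) ^+ N *: (tau i w *m u).
Proof.
rewrite /monomial; elim: N => [|d IH] /=.
  by rewrite ch_act_const eval1_const expr0 scale1r.
rewrite ch_act_mulX linear_sum (bigD1 0) //= big1 ?addr0 => [|k /negPf k0].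
  by rewrite linearZ /= eval1_X /evalT eqxx /= IH scalerA exprS.
by rewrite linearZ /= eval1_X /evalT k0 /= scaler0.
Qed.

(** Averaging over the group makes u |-> x_1^N (x) C u equivariant for any matrix C. *)
Let average C u : M := \sum_w act w (monomial (C *m (tau r w)^T *m u)).

Let average_linear C : linear (average C).
Proof.
move=> a u v; apply: sum_lin => w _.
by rewrite mulmxDr -scalemxAr monomial_linear linearP.
Qed.

(** Evaluating [average C] at (1, 0, 0) gives the matrix [A C]. Summing the (p, q) entry of
    [A (delta_mx p q)] over p and q gives the sum in [zonal_multE], so some matrix unit has [A C]
    nonzero. A kernel vector of the resulting map would, by irreducibility, generate everything and
    force [A C] = 0. *)
Theorem isotypic_embedding : H3Codes.zonal_mult N i r != (0, 0) ->
  exists h : {linear 'cV[R]_(irrep_dim r) -> M},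
    [/\ injective h, forall w u, h (tau r w *m u) = act w (h u),
        forall u, hmg N (h u)
      & forall u, Omega (h u) = (H3Codes.gam r)%:~R *: h u].
Proof.
move=> nz; pose A C := \sum_(w : H3 R) ((w : 'M_3) 0 0) ^+ N *: (tau i w *m C *m (tau r w)^T).
have evA C u : eval1 (average C u) = A C *m u.
  rewrite /average linear_sum mulmx_suml; apply: eq_bigr => w _ /=.
  by rewrite eval1_monomial -scalemxAl !mulmxA.
have [[p q] Apq] : exists y : 'I_(irrep_dim i) * 'I_(irrep_dim r),
    A (delta_mx y.1 y.2) != 0.
  apply/existsP; apply: contraNT nz; rewrite negb_exists => /forallP A0.
  apply/eqP/(@ev_inj R); rewrite ev0; apply: (mulfI (x := 2^-1 ^+ N)).
    by rewrite expf_neq0 // invr_neq0 // two_neq0.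
  rewrite -zonal_multE mulr0.
  transitivity (\sum_p \sum_q A (delta_mx p q) p q); last first.
    rewrite big1 // => p _; rewrite big1 // => q _.
    by have /negPn/eqP/= -> := A0 (p, q); rewrite mxE.
  have e w p q : (tau i w *m delta_mx p q *m (tau r w)^T) p q = tau i w p p * tau r w q q.
    rewrite mxE (bigD1 q) //= big1 ?addr0 => [|l lq].
      rewrite !mxE (bigD1 p) //= mxE !eqxx mulr1 big1 ?addr0 // => l lp.
      by rewrite mxE (negPf lp) mulr0.
    rewrite mxE big1 ?mul0r // => k _.
    by rewrite mxE (negPf lq) andbF mulr0.
  have e' p q : A (delta_mx p q) p q =
      \sum_(w : H3 R) ((w : 'M_3) 0 0) ^+ N * (tau i w p p * tau r w q q).
    by rewrite summxE; apply: eq_bigr => w _; rewrite mxE e.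
  transitivity (\sum_p \sum_(w : H3 R) \sum_q ((w : 'M_3) 0 0) ^+ N * (tau i w p p * tau r w q q)).
    rewrite exchange_big; apply: eq_bigr => w _ /=.
    rewrite -!(irr_char htau) mulrC /mxtrace -mulrA mulr_suml.
    apply: eq_bigr => k _; rewrite !mulr_sumr; apply: eq_bigr => l _ /=; ring.
  apply: eq_bigr => k _; rewrite exchange_big; apply: eq_bigr => l _.
  by rewrite e'.
set C := delta_mx _ _ in Apq.
pose Lm := GRing.isLinear.Build R _ _ *:%R (average C) (average_linear C).
pose h : {linear 'cV[R]_(irrep_dim r) -> M} := HB.pack (average C) Lm.
have hE u : h u = average C u by [].
have eqv w u : h (tau r w *m u) = act w (h u).
  rewrite !hE /average linear_sum /= (reindex_inj (mulgI w)) /=.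
  apply: eq_bigr => g _; rewrite chactM; congr (act w (act g (monomial _))).
  by rewrite reprM trmx_mul -!mulmxA; congr (_ *m (_ *m _)); rewrite mulmxA otau mul1mx.
exists h; split=> //.
- apply: raddf_inj => u hu; apply: contraNeq Apq => u0.
  suff A0 (v : 'cV_(irrep_dim r)) : A C *m v = 0.
    apply/eqP/matrixP => k l.
    by have /matrixP/(_ k 0) := A0 (delta_mx l 0); rewrite -colE !mxE.
  have [c ->] := orbit_span v (otau r) (itau r) u0.
  rewrite mulmx_sumr big1 // => w _.
  by rewrite -scalemxAr -evA -hE eqv hu (linear0 (act w)) (linear0 eval1) scaler0.
- move=> u; apply: homog_sum => w _; apply: act_homog; rewrite /monomial.
  by elim: N => [|d IH] /=; [exact: ch_hconst|exact: ch_hmulX].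
- move=> u; rewrite /Omega; under eq_bigr => v _ do rewrite -eqv.
  transitivity (h (Om (tau r) *m u)).
    by rewrite /Om mulmx_suml (linear_sum h).
  by rewrite (irr_Om htau) mul_scalar_mx linearZ.
Qed.

End Embedding.

(** * The extreme singular values *)

Module H3Endpoints.
Import H3Codes.

(* 30 (d + kappa (gam i - gam j)) for kappa = a / 30 *)
Definition lam30 (a : int) (i j : label) (d : nat) : int :=
  30 * d%:Z + a * (gam i - gam j).

(** Here N is the critical degree and r the isotype that becomes singular there. Strict positivity
    below N makes the contravariant form definite up to degree N - 1; from N on, nonnegativity is
    enough. Degree 4 stands for all higher degrees, as [lam30] grows with d. *)
Definition check (i : label) (a : int) (r : label) (N : nat) : bool :=
  [&& (0 < N <= 4)%N,
      all (fun j => (0 <= lam30 a i j 4) && all (fun d =>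
        (tensor_mult d i j == (0, 0)) ||
        (if (d < N)%N then 0 < lam30 a i j d else 0 <= lam30 a i j d)) [:: 1; 2; 3]%N) labels,
      lam30 a i r N == 0 & zonal_mult N i r != (0, 0)].

Lemma check_T1 : check T1 (-3) T3 1. Proof. by vm_compute. Qed.
Lemma check_T2 : check T2 3 T4 1. Proof. by vm_compute. Qed.
Lemma check_T3 : check T3 (-3) T4 1 && check T3 3 T1 1. Proof. by vm_compute. Qed.
Lemma check_T4 : check T4 (-3) T2 1 && check T4 3 T3 1. Proof. by vm_compute. Qed.
Lemma check_T5 : check T5 (-6) T7 1 && check T5 9 T1 3. Proof. by vm_compute. Qed.
Lemma check_T6 : check T6 (-9) T2 3 && check T6 6 T8 1. Proof. by vm_compute. Qed.
Lemma check_T7 : check T7 (-6) T2 3 && check T7 6 T5 1. Proof. by vm_compute. Qed.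
Lemma check_T8 : check T8 (-6) T6 1 && check T8 6 T1 3. Proof. by vm_compute. Qed.
Lemma check_T9 : check T9 (-5) T10 1 && check T9 5 T1 2. Proof. by vm_compute. Qed.
Lemma check_T10 : check T10 (-5) T2 2 && check T10 5 T9 1. Proof. by vm_compute. Qed.

Lemma checkP i a r N d j : check i a r N -> occurs i d.+1 j ->
  0 <= lam30 a i j d.+1 /\ ((d.+1 < N)%N -> 0 < lam30 a i j d.+1).
Proof.
case/and4P=> /andP[N0 N4] h _ _; have /andP[h4 h3] := all_labels h j.
rewrite /occurs; case: (ltnP 3 d.+1) => [d3 _|d3 /= nz].
  split=> [|dN]; last by have := leq_trans dN N4; rewrite ltnS leqNgt d3.
  apply: le_trans h4 _; rewrite /lam30 lerD2r ler_pM2l //.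
have /allP/(_ d.+1) := h3; rewrite (negPf nz) /=.
have -> : d.+1 \in [:: 1; 2; 3]%N by case: d d3 {nz} => [|[|[|]]].
by move=> /(_ isT); case: ifP => _ l; split=> //; exact: ltW.
Qed.

End H3Endpoints.

Section Endpoints.
Variables (R : realType) (tau : forall i, H3_repr R (irrep_dim i)).
Hypothesis htau : irreps_of_H3 tau.
Variable i : label.
Notation n := (irrep_dim i).
Notation gamR j := ((H3Codes.gam j)%:~R : R).
Local Opaque positive_roots H3_roots sigma H3Codes.elements H3Codes.tensor_mult
  H3Codes.zonal_mult.

Let otau j : orthogonal_repr (tau j). Proof. by case: htau => /(_ j)[]. Qed.
Let itau j : mx_irreducible (tau j). Proof. by case: htau => /(_ j)[]. Qed.

(* The eigenvalue of \sum_k x_k D_k on the polynomials of degree d and isotype j. *)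
Definition euler_value (kappa : R) (d : nat) (j : label) : R :=
  d%:R + kappa * (gamR i - gamR j).

Definition euler_positive (kappa : R) (m : nat) :=
  forall d j, (d < m)%N -> occurs i d.+1 j -> 0 < euler_value kappa d.+1 j.

Lemma Omega_predP (d : nat) (c : R) : Omega_pred i d c ->
  exists2 j, gamR j = c & occurs i d j.
Proof.
rewrite /Omega_pred; elim: H3Codes.labels => //= j s IH /orP[/andP[/eqP e o]|/IH//].
by exists j.
Qed.

Let tau_gam : \sum_(v <- positive_roots R) tau i (sigma v) = (gamR i)%:M.
Proof. exact: (irr_Om htau). Qed.

Lemma identity_inner_product : invariant_inner_product (tau i) 1%:M.
Proof.
split=> [|u u0|w]; first exact: trmx1; last by rewrite mulmx1 otau.
rewrite mulmx1 mxE lt_neqAle eq_sym sumr_ge0 => [|k _]; last first.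
  by rewrite mxE -expr2 sqr_ge0.
rewrite andbT; apply: contraNneq u0 => /eqP; rewrite psumr_eq0 => [/allP h|k _]; last first.
  by rewrite mxE -expr2 sqr_ge0.
apply/eqP/colP => k; rewrite [RHS]mxE; have := h k.
by rewrite mem_index_enum mxE -expr2 sqrf_eq0 => /(_ isT) /eqP.
Qed.

Section Positivity.
Variables (kappa : R) (G : 'M[R]_n).
Hypothesis invG : invariant_inner_product (tau i) G.
Notation M := (dunkl_module (tau i) kappa).

Lemma euler_positive_posdef m : euler_positive kappa m ->
  forall d, (d <= m)%N -> posdef_degree M G d.
Proof.
case: invG => Gsym Gpos Ginv pos; elim=> [_|d IH dm].
  exact: posdef_degree0.
refine (posdef_degreeS Ginv tau_gam (Omega_values_uniq R)
  (@isoproj_spectrum _ _ htau i kappa M d.+1) _ (IH (ltnW dm))).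
by move=> c /Omega_predP[j <- o]; exact: pos.
Qed.

Lemma gaussian_posdef_positive : (forall m, euler_positive kappa m) ->
  gaussian_posdef (tau i) G kappa.
Proof.
case: (invG) => Gsym Gpos Ginv pos; exists (gform (M := M) G); split.
  split; first exact: (gform_axioms M Ginv Gsym).
  move=> B hB; apply/funext => f; apply/funext => g.
  by rewrite (@gauss_eq_gform _ _ _ _ M G B hB).
have pd d : posdef_degree M G d := euler_positive_posdef (pos d) (leqnn d).
exact (gform_posdef (cform_posdef Ginv Gsym pd)).
Qed.

End Positivity.

Lemma euler_positive_not_singular kappa : (forall m, euler_positive kappa m) ->
  ~ exists p, singular_poly (tau i) kappa p.
Proof.
move=> pos [p [nc Dp]]; apply: nc.
apply: (@dunkl_kernel_const _ _ _ _ (dunkl_module (tau i) kappa) (gamR i)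
  _ (fun d => @Omega_pred R i d) tau_gam (Omega_values_uniq R)) => // [d|d c /Omega_predP[j <- o]].
  exact: isoproj_spectrum.
by rewrite gt_eqF // (pos d.+1).
Qed.

Lemma ones_neq0 j : const_mx 1 != 0 :> 'cV[R]_(irrep_dim j).
Proof.
by case: j; apply/eqP => /matrixP/(_ 0 0)/eqP; rewrite !mxE oner_eq0.
Qed.

Section Isotype.
Variables (r : label) (N : nat) (kappa : R).
Hypothesis zonal : H3Codes.zonal_mult N i r != (0, 0).

Lemma gaussian_not_posdef (G : 'M[R]_n) : (0 < N)%N -> euler_value kappa N r <= 0 ->
  invariant_inner_product (tau i) G -> ~ gaussian_posdef (tau i) G kappa.
Proof.
move=> N0 le0 [Gsym Gpos Ginv] [B [[hB _] Bpos]].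
pose M := dunkl_module (tau i) kappa.
have [h [inj _ hN eO]] := @isotypic_embedding _ _ htau i r kappa N M zonal.
pose u : 'cV[R]_(irrep_dim r) := const_mx 1.
have u0 : u != 0 by exact: ones_neq0.
have hu0 : h u != 0 by rewrite raddf_eq0.
have := @gauss_posdef_eigen _ _ _ _ M G B hB (gamR i) tau_gam Bpos N.-1 _ (h u).
rewrite prednK // => /(_ _ (hN u) hu0 (eO u)).
by rewrite ltNge -/(euler_value kappa N r) le0.
Qed.

Lemma singular_isotype : (0 < N)%N -> euler_positive kappa N.-1 ->
  euler_value kappa N r = 0 ->
  exists p, singular_poly (tau i) kappa p /\ of_isotype (tau i) (tau r) p.
Proof.
move=> N0 pos e0; pose M := dunkl_module (tau i) kappa.
have [h [inj eqv hN eO]] := @isotypic_embedding _ _ htau i r kappa N M zonal.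
pose u : 'cV[R]_(irrep_dim r) := const_mx 1.
have u0 : u != 0 by exact: ones_neq0.
have hu0 : h u != 0 by rewrite raddf_eq0.
exists (h u); split; last first.
  exists h; split=> // q; split=> [[v ->]|[c ->]].
    have [c ->] := orbit_span v (otau r) (itau r) u0.
    exists c; rewrite linear_sum; apply: eq_bigr => w _ /=.
    by rewrite linearZ /= eqv.
  exists (\sum_w c w *: (tau r w *m u)); rewrite linear_sum; apply: eq_bigr => w _ /=.
  by rewrite linearZ /= eqv.
split.
  case=> v e; case/eqP: hu0; rewrite -(@ch_comp_id _ _ _ _ M N (h u)) //.
  rewrite [h u]e; apply: (@ch_comp_ne _ _ _ _ M N 0); first by rewrite -lt0n.
  exact: (@ch_hconst _ _ _ _ M).
(* Singularity does not refer to an inner product, so the standard one serves as auxiliary. *)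
have [Gsym Gpos Ginv] := identity_inner_product.
have eN : N = N.-1.+1 by rewrite prednK.
apply: (@dunkl_kernel_eigen _ _ _ _ M 1%:M (gamR i) tau_gam N.-1 _ _ _ (eO u)).
- by rewrite -eN.
- by rewrite -eN.
- exact: (euler_positive_posdef identity_inner_product pos).
Qed.

End Isotype.

End Endpoints.

(** * From the endpoint checks to intervals of positivity *)

Section Rows.
Variables (R : realType) (tau : forall i, H3_repr R (irrep_dim i)).
Hypothesis htau : irreps_of_H3 tau.
Notation gamR j := ((H3Codes.gam j)%:~R : R).
Local Opaque positive_roots H3_roots sigma H3Codes.elements H3Codes.tensor_mult
  H3Codes.zonal_mult.

Section Endpoint.
Variables (i r : label) (a : int) (N : nat) (k : rat).
Hypotheses (chk : H3Endpoints.check i a r N) (ka : k = a%:~R / 30).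

Lemma ratr_endpoint : ratr k = a%:~R / 30 :> R.
Proof. by rewrite ka fmorph_div /= ratr_int ratr_nat. Qed.

(** Writing kappa as t times the endpoint treats both signs at once: 0 <= t < 1 is the inside and t
    >= 1 the outside. *)
Lemma euler_value_endpoint (t : R) d j :
  euler_value i (t * ratr k) d j =
  (1 - t) * d%:R + t * ((H3Endpoints.lam30 a i j d)%:~R / 30).
Proof.
rewrite /euler_value ratr_endpoint /H3Endpoints.lam30 !(rmorphD, rmorphM, rmorphN) /=.
by field.
Qed.

Lemma euler_positive_inside (t : R) m : 0 <= t < 1 -> euler_positive i (t * ratr k) m.
Proof.
case/andP=> t0 t1 d j _ /(H3Endpoints.checkP chk)[l0 _].
rewrite euler_value_endpoint ltr_wpDr ?mulr_gt0 ?subr_gt0 ?ltr0n //.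
by rewrite mulr_ge0 // divr_ge0 ?ler0n ?ler0z.
Qed.

Lemma check_zonal : H3Codes.zonal_mult N i r != (0, 0).
Proof. by case/and4P: chk. Qed.
Lemma check_degree : (0 < N)%N.
Proof. by case/and4P: chk => /andP[]. Qed.
Lemma check_lam30 : H3Endpoints.lam30 a i r N = 0.
Proof. by case/and4P: chk => _ _ /eqP. Qed.

Lemma singular_endpoint : singular_of_isotype (tau i) k (tau r).
Proof.
apply: (singular_isotype htau check_zonal check_degree) => [d j dN o|].
  rewrite -[ratr k]mul1r euler_value_endpoint subrr mul0r add0r mul1r.
  have [_ l0] := H3Endpoints.checkP chk o.
  by rewrite divr_gt0 ?ltr0n ?ltr0z // l0 // -ltn_predRL.
by rewrite -[ratr k]mul1r euler_value_endpoint check_lam30 subrr mul0r mul0r mulr0 addr0.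
Qed.

Lemma singular_value_endpoint : singular_value (tau i) k.
Proof. by have [p [? _]] := singular_endpoint; exists p. Qed.

(** On the critical component the Euler value is (1 - t) N. *)
Lemma not_posdef_outside (t : R) G : 1 <= t -> invariant_inner_product (tau i) G ->
  ~ gaussian_posdef (tau i) G (t * ratr k).
Proof.
move=> t1; apply: (gaussian_not_posdef htau check_zonal check_degree).
rewrite euler_value_endpoint check_lam30 mul0r mulr0 addr0 mulr_le0_ge0 ?ler0n ?subr_le0 //.
Qed.

Hypothesis a0 : a != 0.

Lemma endpoint_neq0 : ratr k != 0 :> R.
Proof. by rewrite ratr_endpoint mulf_neq0 ?intr_eq0 // invr_neq0 // pnatr_eq0. Qed.

Lemma posdef_inside (kappa : R) G : 0 <= kappa / ratr k < 1 ->
  invariant_inner_product (tau i) G -> gaussian_posdef (tau i) G kappa.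
Proof.
move=> t01 invG; apply: gaussian_posdef_positive => // m.
by rewrite -[kappa](divfK endpoint_neq0); exact: euler_positive_inside.
Qed.

Lemma posdef_side (kappa : R) G : 0 <= kappa / ratr k ->
  invariant_inner_product (tau i) G ->
  (gaussian_posdef (tau i) G kappa <-> kappa / ratr k < 1).
Proof.
move=> t0 invG; split=> [pd|t1]; last by apply: posdef_inside; rewrite ?t0.
rewrite ltNge; apply/negP => t1; apply: (not_posdef_outside t1 invG).
by rewrite divfK ?endpoint_neq0.
Qed.

Lemma not_singular_inside (k' : rat) : 0 <= k' / k < 1 -> ~ singular_value (tau i) k'.
Proof.
have k0 : k != 0 by have := endpoint_neq0; rewrite fmorph_eq0.
move=> t01; apply: (euler_positive_not_singular htau) => m.
rewrite -[k'](divfK k0) rmorphM; apply: euler_positive_inside.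
by rewrite ler0q -(rmorph1 (@ratr R)) ltr_rat.
Qed.

End Endpoint.

Section Halves.
Variables (i r : label) (a : int) (N : nat) (k : rat).
Hypotheses (chk : H3Endpoints.check i a r N) (ka : k = a%:~R / 30).

Lemma negative_half : a < 0 ->
  (smallest_negative_singular_value (tau i) k /\ singular_of_isotype (tau i) k (tau r)) /\
  forall G, invariant_inner_product (tau i) G -> forall kappa : R, kappa <= 0 ->
    (gaussian_posdef (tau i) G kappa <-> ratr k < kappa).
Proof.
move=> a0; have an0 : a != 0 by rewrite lt_eqF.
have k0 : k < 0 by rewrite ka pmulr_llt0 ?ltrz0 ?invr_gt0.
have rk0 : ratr k < 0 :> R by rewrite ltrq0.
split; first split.
- split=> //; first exact: singular_value_endpoint chk ka.
  move=> k' sk' k'0; rewrite leNgt; apply/negP => kk'.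
  apply: (not_singular_inside chk ka an0 _ sk').
  rewrite ltr_ndivrMr // mul1r mulr_le0 ?invr_le0 ?ltW //=.
  by move: kk'; rewrite !ltr0_norm // ltrN2.
- exact: singular_endpoint chk ka.
move=> G invG kappa le0; rewrite (posdef_side chk ka an0 _ invG).
  by rewrite ltr_ndivrMr // mul1r.
by rewrite mulr_le0 // invr_le0 ltW.
Qed.

Lemma positive_half : 0 < a ->
  (smallest_positive_singular_value (tau i) k /\ singular_of_isotype (tau i) k (tau r)) /\
  forall G, invariant_inner_product (tau i) G -> forall kappa : R, 0 <= kappa ->
    (gaussian_posdef (tau i) G kappa <-> kappa < ratr k).
Proof.
move=> a0; have an0 : a != 0 by rewrite gt_eqF.
have k0 : 0 < k by rewrite ka divr_gt0 ?ltr0z.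
have rk0 : 0 < ratr k :> R by rewrite ltr0q.
split; first split.
- split=> //; first exact: singular_value_endpoint chk ka.
  move=> k' sk' k'0; rewrite leNgt; apply/negP => kk'.
  apply: (not_singular_inside chk ka an0 _ sk').
  rewrite ltr_pdivrMr // mul1r divr_ge0 ?ltW //=.
  by move: kk'; rewrite !gtr0_norm.
- exact: singular_endpoint chk ka.
move=> G invG kappa ge0; rewrite (posdef_side chk ka an0 _ invG).
  by rewrite ltr_pdivrMr // mul1r.
by rewrite divr_ge0 // ltW.
Qed.

End Halves.

Section FreeHalf.
Variables (i : label) (kappa : R).
Hypothesis sgn : forall j, 0 <= kappa * (gamR i - gamR j).

(** For [T1] with kappa >= 0 and [T2] with kappa <= 0: there [gam i] is extreme, so the kappa term
    never lowers the degree term. *)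
Lemma euler_positive_free m : euler_positive i kappa m.
Proof. by move=> d j _ _; rewrite ltr_wpDr ?ltr0n. Qed.

Lemma posdef_free G : invariant_inner_product (tau i) G -> gaussian_posdef (tau i) G kappa.
Proof. by move=> invG; apply: gaussian_posdef_positive => //; exact: euler_positive_free. Qed.

Lemma not_singular_free : ~ exists p, singular_poly (tau i) kappa p.
Proof. exact/(euler_positive_not_singular htau)/euler_positive_free. Qed.

End FreeHalf.

Lemma singular_row_interval i a r N k a' r' N' k' :
  H3Endpoints.check i a r N && H3Endpoints.check i a' r' N' ->
  a < 0 < a' -> k = a%:~R / 30 -> k' = a'%:~R / 30 ->
  singular_row tau i (Some (k, r)) (Some (k', r')).
Proof.
case/andP=> c c' /andP[a0 a'0] ek ek'.
have [n1 n2] := negative_half c ek a0; have [p1 p2] := positive_half c' ek' a'0.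
have rk0 : ratr k < 0 :> R by case: n1 => -[_ k0 _] _; rewrite ltrq0.
have rk'0 : 0 < ratr k' :> R by case: p1 => -[_ k0 _] _; rewrite ltr0q.
split=> // G invG kappa; case: (leP kappa 0) => k0.
  rewrite (n2 G invG _ k0); split=> [h|[//]]; split=> //.
  exact: le_lt_trans k0 rk'0.
rewrite (p2 G invG _ (ltW k0)); split=> [h|[//]]; split=> //.
exact: lt_trans rk0 k0.
Qed.

Lemma singular_row_ray_gt i a r N k :
  H3Endpoints.check i a r N -> a < 0 -> k = a%:~R / 30 ->
  (forall j, H3Codes.gam j <= H3Codes.gam i) ->
  singular_row tau i (Some (k, r)) None.
Proof.
move=> c a0 ek gmax; have [n1 n2] := negative_half c ek a0.
have rk0 : ratr k < 0 :> R by case: n1 => -[_ k0 _] _; rewrite ltrq0.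
have sgn (kappa : R) : 0 <= kappa -> forall j, 0 <= kappa * (gamR i - gamR j).
  by move=> k0 j; apply: mulr_ge0; rewrite ?subr_ge0 ?ler_int.
split=> //.
  by case=> k' [sk' k'0]; apply: not_singular_free sk'; apply: sgn; rewrite ler0q ltW.
move=> G invG kappa; case: (leP kappa 0) => k0.
  by rewrite (n2 G invG _ k0); split=> [|[]].
split=> [_|_]; last by apply: posdef_free invG; apply/sgn/ltW.
by split=> //; apply: lt_trans rk0 k0.
Qed.

Lemma singular_row_ray_lt i a r N k :
  H3Endpoints.check i a r N -> 0 < a -> k = a%:~R / 30 ->
  (forall j, H3Codes.gam i <= H3Codes.gam j) ->
  singular_row tau i None (Some (k, r)).
Proof.
move=> c a0 ek gmin; have [p1 p2] := positive_half c ek a0.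
have rk0 : 0 < ratr k :> R by case: p1 => -[_ k0 _] _; rewrite ltr0q.
have sgn (kappa : R) : kappa <= 0 -> forall j, 0 <= kappa * (gamR i - gamR j).
  by move=> k0 j; apply: mulr_le0; rewrite ?subr_le0 ?ler_int.
split=> //.
  by case=> k' [sk' k'0]; apply: not_singular_free sk'; apply: sgn; rewrite lerq0 ltW.
move=> G invG kappa; case: (leP kappa 0) => k0; last first.
  by rewrite (p2 G invG _ (ltW k0)); split=> [|[]].
split=> [_|_]; last by apply: posdef_free invG; exact: sgn.
by split=> //; apply: le_lt_trans k0 rk0.
Qed.

Lemma posdef_not_symmetric i k r k' r' kappa G :
  singular_row tau i (Some (k, r)) (Some (k', r')) ->
  invariant_inner_product (tau i) G -> k < kappa < k' -> ~~ (k < - kappa < k') ->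
  ~ (forall kappa : R, gaussian_posdef (tau i) G kappa <-> gaussian_posdef (tau i) G (- kappa)).
Proof.
move=> [_ _ pd] invG /andP[h1 h2] h3 sym.
have [_ /(_ _)] := pd G invG (ratr kappa); rewrite !ltr_rat => /(_ (conj h1 h2)).
move/(sym (ratr kappa)); rewrite -rmorphN => /(pd G invG)[]; rewrite !ltr_rat => h4 h5.
by move: h3; rewrite h4 h5.
Qed.

End Rows.

Theorem mainTheorem1 (R : realType) (tau : forall i, H3_repr R (irrep_dim i))
  (htau : irreps_of_H3 tau) :
  singular_row tau T1 (Some (- (1 / 10), T3)) None /\
  singular_row tau T2 None (Some (1 / 10, T4)) /\
  singular_row tau T3 (Some (- (1 / 10), T4)) (Some (1 / 10, T1)) /\
  singular_row tau T4 (Some (- (1 / 10), T2)) (Some (1 / 10, T3)) /\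
  singular_row tau T5 (Some (- (1 / 5), T7)) (Some (3 / 10, T1)) /\
  singular_row tau T6 (Some (- (3 / 10), T2)) (Some (1 / 5, T8)) /\
  singular_row tau T7 (Some (- (1 / 5), T2)) (Some (1 / 5, T5)) /\
  singular_row tau T8 (Some (- (1 / 5), T6)) (Some (1 / 5, T1)) /\
  singular_row tau T9 (Some (- (1 / 6), T10)) (Some (1 / 6, T1)) /\
  singular_row tau T10 (Some (- (1 / 6), T2)) (Some (1 / 6, T9)) /\
  (forall i, i = T5 \/ i = T6 -> forall G, invariant_inner_product (tau i) G ->
     ~ (forall kappa : R, gaussian_posdef (tau i) G kappa <->
                          gaussian_posdef (tau i) G (- kappa))).
Proof.
have interval i := @singular_row_interval R tau htau i.
have r5 := interval _ _ _ _ _ _ _ _ _ H3Endpoints.check_T5 isT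
  (erefl : - (1 / 5) = (-6)%:~R / 30 :> rat) (erefl : 3 / 10 = 9%:~R / 30 :> rat).
have r6 := interval _ _ _ _ _ _ _ _ _ H3Endpoints.check_T6 isT
  (erefl : - (3 / 10) = (-9)%:~R / 30 :> rat) (erefl : 1 / 5 = 6%:~R / 30 :> rat).
split; first by apply: (singular_row_ray_gt htau H3Endpoints.check_T1 isT erefl); case.
split; first by apply: (singular_row_ray_lt htau H3Endpoints.check_T2 isT erefl); case.
split; first exact: (interval _ _ _ _ _ _ _ _ _ H3Endpoints.check_T3 isT erefl erefl).
split; first exact: (interval _ _ _ _ _ _ _ _ _ H3Endpoints.check_T4 isT erefl erefl).
split; first exact: r5.
split; first exact: r6.
split; first exact: (interval _ _ _ _ _ _ _ _ _ H3Endpoints.check_T7 isT erefl erefl).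
split; first exact: (interval _ _ _ _ _ _ _ _ _ H3Endpoints.check_T8 isT erefl erefl).
split; first exact: (interval _ _ _ _ _ _ _ _ _ H3Endpoints.check_T9 isT erefl erefl).
split; first exact: (interval _ _ _ _ _ _ _ _ _ H3Endpoints.check_T10 isT erefl erefl).
move=> i [->|->] G invG.
  (* 1/4 lies in (-1/5, 3/10) but -1/4 does not; for [T6] the signs are reversed. *)
  exact: (posdef_not_symmetric (kappa := 1 / 4) r5 invG isT isT).
exact: (posdef_not_symmetric (kappa := - (1 / 4)) r6 invG isT isT).
Qed.
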